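(* Let $k$ be an algebraically closed field of characteristic $5$, let $\Gamma\subset\mathbb{P}^2$ be a $k$-Hermitian curve, and let $\mathcal{D}$ be the set of connected components of the graph $G$ on the set $\mathcal{Q}$ of non-singular conics totally tangent to $\Gamma$. Let $H$ be the graph whose set of vertices is $\mathcal{D}$, and whose set of edges is the set of pairs $\{D,D'\}$ such that $D\neq D'$ and $T(D,D')=\alpha^{15}\gamma^{6}$. Then $H$ has exactly three connected components, and each connected component is (isomorphic to) the Hoffman-Singleton graph.
   Context: Work over an algebraically closed field $k$ of characteristic $5$. A $k$-Hermitian curve is a projective plane curve $\Gamma\subset\mathbb{P}^2$ of degree $6$ that is projectively isomorphic (via $\mathrm{PGL}_3(k)$) to the Fermat curve $\Gamma_5: x^6+y^6+z^6=0$. $\mathcal{P}$ denotes the set of Weierstrass points of $\Gamma$; equivalently, the set of points $P\in\Gamma$ whose tangent line meets $\Gamma$ at $P$ with intersection multiplicity $6$ (for $\Gamma=\Gamma_5$, the $\mathbb{F}_{25}$-rational points). One has $|\mathcal{P}|=126$. A line of $\mathbb{P}^2$ is a special secant line of $\Gamma$ if it passes through two distinct points of $\mathcal{P}$. A non-singular conic $Q\subset\mathbb{P}^2$ is totally tangent to $\Gamma$ if $Q$ meets $\Gamma$ at six distinct points, each with intersection multiplicity $2$. $\mathcal{Q}$ denotes the set of all such conics; one has $|\mathcal{Q}|=3150$ and $Q\cap\Gamma\subset\mathcal{P}$ for $Q\in\mathcal{Q}$. For $Q\in\mathcal{Q}$, $\mathcal{S}(Q)$ is the set of the $15$ special secant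 lines of $\Gamma$ passing through two distinct points of $Q\cap\Gamma$. $G$ is the graph with vertex set $\mathcal{Q}$ in which distinct $Q,Q'$ are adjacent if and only if $|Q\cap Q'|=4$ and $|\mathcal{S}(Q)\cap\mathcal{S}(Q')|=3$. $\mathcal{D}$ is the set of connected components of $G$ (there are $150$ of them); each $D\in\mathcal{D}$ is regarded as a subset of $\mathcal{Q}$, consisting of $21$ conics. For $Q\in\mathcal{Q}$ and $D'\in\mathcal{D}$ with $Q\notin D'$, the type $t(Q,D')\in\{\alpha,\beta,\gamma\}$ is defined by the values of $|Q\cap Q'\cap\Gamma|$ as $Q'$ runs over the $21$ conics of $D'$: $t(Q,D')=\alpha$ if the value is $2$ for $3$ conics and $0$ for $18$; $t(Q,D')=\beta$ if it is $2$ for $1$ conic, $1$ for $4$ conics and $0$ for $16$; $t(Q,D')=\gamma$ if it is $1$ for $6$ conics and $0$ for $15$. (One of these three cases always occurs.) For distinct $D,D'\in\mathcal{D}$, the type $T(D,D')$ is: $\beta^{21}$ if $t(Q,D')=\beta$ for all $Q\in D$; $\gamma^{21}$ if $t(Q,D')=\gamma$ for all $Q\in D$; $\alpha^{15}\gamma^{6}$ if $t(Q,D')=\alpha$ for $15$ conics $Q\in D$ and $\gamma$ for the other $6$; $\alpha^{3}\gamma^{18}$ if $t(Q,D')=\alpha$ for $3$ conics $Q\in D$ and $\gamma$ for the other $18$. (One of these four cases always occurs, and $T(D,D')=T(D',D)$.) The Hoffman-Singleton graph is the unique strongly regular graph of parameters $(v,k,\lambda,\mu)=(50,7,0,1)$.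 *)

(* Defs.v *)
From HB Require Import structures.
From mathcomp Require Import all_boot all_order all_algebra.
From mathcomp Require Import boolp classical_sets functions cardinality.
From mathcomp Require Import mpoly.
From Stdlib Require Import Relation_Operators.

Set Implicit Arguments.
Unset Strict Implicit.
Unset Printing Implicit Defensive.

Import GRing.Theory.
Local Open Scope ring_scope.
Local Open Scope classical_set_scope.
Local Open Scope card_scope.

Local Notation "x %:F" := (tofrac x) : ring_scope.

Section Graphs.

Record graph (V : Type) := Graph {
  vertices : set V;
  edge : V -> V -> Prop   (* only meaningful between elements of vertices *)
}.

Definition adj (V : Type) (g : graph V) (x y : V) : Prop :=
  [/\ vertices g x, vertices g y & edge g x y].

Definition component (V : Type) (g : graph V) (x : V) : set V :=
  [set y | vertices g y /\ clos_refl_sym_trans V (adj g) x y].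

Definition components (V : Type) (g : graph V) : set (set V) :=
  [set C | exists2 x, vertices g x & C = component g x].

Definition induced (V : Type) (g : graph V) (C : set V) : graph V :=
  Graph C (adj g).

Definition graph_iso (V W : Type) (g : graph V) (h : graph W) : Prop :=
  exists phi : V -> W,
    set_bij (vertices g) (vertices h) phi /\
    forall x y, vertices g x -> vertices g y ->
      (adj g x y <-> adj h (phi x) (phi y)).

Definition neighbours (V : Type) (g : graph V) (x : V) : set V :=
  [set y | adj g x y].

Definition strongly_regular (V : Type) (g : graph V) (v d lam mu : nat) : Prop :=
  [/\ (forall x, ~ adj g x x) /\ (forall x y, adj g x y -> adj g y x),
      vertices g #= `I_v,
      (forall x, vertices g x -> neighbours g x #= `I_d),
      (forall x y, adj g x y -> neighbours g x `&` neighbours g y #= `I_lam) &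
      (forall x y, vertices g x -> vertices g y -> x <> y -> ~ adj g x y ->
         neighbours g x `&` neighbours g y #= `I_mu)].

(* There is exactly one such graph up to isomorphism. *)
Definition is_Hoffman_Singleton (V : Type) (g : graph V) : Prop :=
  strongly_regular g 50 7 0 1.

End Graphs.

Section ProjectivePlane.
Variable k : fieldType.

Definition P2 := {L : {vspace 'rV[k]_3} | \dim L == 1%N}.
Definition P2_line := {l : {vspace 'rV[k]_3} | \dim l == 2%N}.

Definition on_line (P : P2) (l : P2_line) : Prop := (val P <= val l)%VS.

(* Homogeneous coordinates of P, fixed up to a nonzero scalar by P.  Forms are
   evaluated at them only in ways that do not depend on this scalar. *)
Definition coords (P : P2) : 'I_3 -> k := fun i => vpick (val P) 0 i.

(* A plane curve of degree d is given by a nonzero form of degree d, and [zeros]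
   is its set of points. *)
Definition zeros (f : {mpoly k[3]}) : set P2 := [set P | f.@[coords P] = 0].

Definition nonsingular (f : {mpoly k[3]}) : Prop :=
  forall P, zeros f P -> exists i : 'I_3, (f^`M(i)).@[coords P] != 0.

(* The equation of the tangent line at a nonsingular point P of f = 0. *)
Definition tangent_form (f : {mpoly k[3]}) (P : P2) : {mpoly k[3]} :=
  \sum_(i < 3) (f^`M(i)).@[coords P] *: 'X_i.

(* The local ring of the plane at P, as fractions a / b of forms of the same
   degree with b(P) <> 0. *)
Definition local_ring (P : P2) : set {fraction {mpoly k[3]}} :=
  [set x | exists (d : nat) (a b : {mpoly k[3]}),
    [/\ a \is d.-homog, b \is d.-homog, b.@[coords P] != 0 &
        x = a%:F / b%:F]].

(* The ideal of the local ring at P generated by local equations of the curves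
   f = 0 and g = 0, for forms f and g. *)
Definition local_ideal (f g : {mpoly k[3]}) (P : P2) :
    set {fraction {mpoly k[3]}} :=
  [set x | exists (d : nat) (a b : {mpoly k[3]}),
    [/\ a \is d.-homog, b \is d.-homog, b.@[coords P] != 0,
        exists u w : {mpoly k[3]}, a = u * f + w * g &
        x = a%:F / b%:F]].

(* The k-vector space local_ring P / local_ideal f g P has dimension n: [e] is
   a basis of it. *)
Definition intersection_multiplicity
    (f g : {mpoly k[3]}) (P : P2) (n : nat) : Prop :=
  exists e : 'I_n -> {fraction {mpoly k[3]}},
    (forall i, local_ring P (e i)) /\
    forall x, local_ring P x ->
      exists! c : 'rV[k]_n,
        local_ideal f g P (x - \sum_(i < n) (c 0 i)%:MP%:F * e i).

Definition linear_subst (M : 'M[k]_3) (f : {mpoly k[3]}) : {mpoly k[3]} :=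
  f \mPo [tuple \sum_(j < 3) M i j *: 'X_j | i < 3].

Definition fermat_sextic : {mpoly k[3]} := \sum_(i < 3) 'X_i ^+ 6.

Definition is_Hermitian_curve (f : {mpoly k[3]}) : Prop :=
  f \is 6.-homog /\
  exists (M : 'M[k]_3) (c : k),
    [/\ M \in unitmx, c != 0 & linear_subst M f = c *: fermat_sextic].

End ProjectivePlane.

(* [f] is the equation of the curve Gamma. *)
Section HermitianCurve.
Variables (k : fieldType) (f : {mpoly k[3]}).

(* Hyperflexes, which are the Weierstrass points of a Hermitian curve. *)
Definition weierstrass_points : set (P2 k) :=
  [set P | zeros f P /\ intersection_multiplicity (tangent_form f P) f P 6].

Definition special_secant : set (P2_line k) :=
  [set l | exists P P', [/\ weierstrass_points P, weierstrass_points P',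
                            P <> P', on_line P l & on_line P' l]].

(* A nonsingular conic is determined by its set of points since the field of
   interest is algebraically closed. *)
Definition tangent_conics : set (set (P2 k)) :=
  [set Q | exists q : {mpoly k[3]},
    [/\ q \is 2.-homog, nonsingular q, Q = zeros q,
        Q `&` zeros f #= `I_6 &
        forall P, (Q `&` zeros f) P -> intersection_multiplicity q f P 2]].

Definition secants_of (Q : set (P2 k)) : set (P2_line k) :=
  [set l | special_secant l /\
     exists P P', [/\ (Q `&` zeros f) P, (Q `&` zeros f) P',
                      P <> P', on_line P l & on_line P' l]].

Definition graph_G : graph (set (P2 k)) :=
  Graph tangent_conics
    (fun Q Q' => [/\ Q <> Q', Q `&` Q' #= `I_4 &
                     secants_of Q `&` secants_of Q' #= `I_3]).

Definition calD : set (set (set (P2 k))) := components graph_G.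

Inductive conic_type := Alpha | Beta | Gamma.

(* The number of conics Q' in D' such that Q, Q' and the curve have exactly m
   points in common, when t(Q, D') = t; the three numbers for m = 0, 1, 2 add
   up to |D'| = 21. *)
Definition conic_profile (t : conic_type) (m : nat) : nat :=
  match t with
  | Alpha => nth 0 [:: 18; 0; 3] m
  | Beta  => nth 0 [:: 16; 4; 1] m
  | Gamma => nth 0 [:: 15; 6; 0] m
  end%N.

Definition has_conic_type (Q : set (P2 k)) (D' : set (set (P2 k)))
    (t : conic_type) : Prop :=
  forall m : nat,
    [set Q' | D' Q' /\ Q `&` Q' `&` zeros f #= `I_m] #= `I_(conic_profile t m).

Inductive component_type := Beta21 | Gamma21 | Alpha15Gamma6 | Alpha3Gamma18.

Definition component_profile (T : component_type) (t : conic_type) : nat :=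
  match T, t with
  | Beta21, Beta => 21
  | Gamma21, Gamma => 21
  | Alpha15Gamma6, Alpha => 15
  | Alpha15Gamma6, Gamma => 6
  | Alpha3Gamma18, Alpha => 3
  | Alpha3Gamma18, Gamma => 18
  | _, _ => 0
  end%N.

Definition has_component_type (D D' : set (set (P2 k)))
    (T : component_type) : Prop :=
  forall t : conic_type,
    [set Q | D Q /\ has_conic_type Q D' t] #= `I_(component_profile T t).

Definition graph_H : graph (set (set (P2 k))) :=
  Graph calD (fun D D' => D <> D' /\ has_component_type D D' Alpha15Gamma6).

End HermitianCurve.

(* Main.v *)
(** In suitable coordinates the curve is x z^5 + x^5 z = 2 y^6.  On the conic y^2 = x z, with
    its parametrisation (1 : t : t^2), this form becomes (t^5 - t)^2, so the conic is totally
    tangent to the curve at the six points with t in P^1(F_5).  Conversely, a totally tangent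
    conic can be parametrised in the same way, with 0, 1 and infinity among the parameters of
    tangency.  The pullback of the form is then the square of a monic quintic g, up to a factor;
    since only the exponents 0, 1, 2 mod 5 occur in it, its third derivative vanishes, which
    forces g'' = 0 and g = t^5 - t, and the coordinate change is unitary up to a scalar.  So the
    totally tangent conics form one orbit of the unitary group of the form, whose elements have
    entries in F_25, and every question can be transported to the base conic.

    The 21 conics in the component of the base conic partition the 126 special points.  Hence
    each component contains exactly one conic through the point (1 : 0 : 0); there are 150 such
    conics, obtained from the lower triangular unitary matrices.  The remaining statements
    concern finitely many explicit matrices over F_25 and are decided by computation. *)
Require Import Defs.
From HB Require Import structures.
From mathcomp Require Import all_boot all_order all_algebra.
From mathcomp Require Import boolp classical_sets functions cardinality.
From mathcomp Require Import separable mpoly ring.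
From Stdlib Require Import Relation_Operators.

Set Implicit Arguments.
Unset Strict Implicit.
Unset Printing Implicit Defensive.

Import GRing.Theory.
Local Open Scope ring_scope.
Local Open Scope classical_set_scope.
Local Open Scope card_scope.

Local Notation "x %:F" := (tofrac x) : ring_scope.

(** * Intersection multiplicities along a rational curve *)

(** An intersection multiplicity is the dimension of a quotient of a ring of fractions. Along a
    conic or a line with a rational parametrisation, that quotient is identified with k[t]/(t^n),
    where n is the order of vanishing of the pulled back equation; from then on only polynomials in
    t occur.

    Unitary matrices have entries in F_25 because conjugating and transposing the unitary relation
    gives the same relation with g replaced by its double Frobenius conjugate.

    The obstacle to a finite computation is adjacency in G: the four common points of two conics
    need not be defined over F_25. The condition on secants involves only points of tangency, so it
    is tested first, on all 150 * 126 candidates. A survivor is either one of ten listed conics,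
    whose four common points are rational over F_25, or its quartic has a double root in F_25 and it
    cannot meet the base conic in four points.

    Every computed fact about the base conic is stated for an arbitrary frame, that is, for all
    coordinates in which the curve has the given equation. Replacing the frame [M] by [g *m M] with
    [g] unitary moves the fact to any other conic, so each test is run from one base conic only. *)

Section Points.
Variable k : fieldType.
Implicit Types (v w : 'rV[k]_3) (a b q f : {mpoly k[3]}) (P : P2 k).

Lemma line_dim1 v : v != 0 -> \dim <[v]> == 1%N.
Proof. by move=> v0; rewrite dim_vline v0. Qed.

Lemma delta_neq0 : (delta_mx 0 0 : 'rV[k]_3) != 0.
Proof. by apply/eqP => /rowP /(_ 0) /eqP; rewrite !mxE /= oner_eq0. Qed.

(* [pt 0] is a junk value. *)
Definition pt v : P2 k :=
  insubd (exist (fun L : {vspace 'rV[k]_3} => \dim L == 1%N) _ (line_dim1 delta_neq0))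
    <[v]>%VS.

Lemma val_pt v : v != 0 -> val (pt v) = <[v]>%VS.
Proof. by move=> v0; rewrite insubdK //; exact: line_dim1. Qed.

Definition co P : 'rV[k]_3 := vpick (val P).

Lemma co_neq0 P : co P != 0.
Proof. by rewrite vpick0 -dimv_eq0 (eqP (valP P)). Qed.

Lemma ptE P : P = pt (co P).
Proof.
apply: val_inj; rewrite val_pt ?co_neq0 //; apply/esym/eqP.
by rewrite eqEdim -memvE memv_pick dim_vline co_neq0 (eqP (valP P)).
Qed.

Lemma pt_eq v w : v != 0 -> w != 0 ->
  pt v = pt w <-> exists2 c : k, c != 0 & v = c *: w.
Proof.
move=> v0 w0; split.
  move/(congr1 val); rewrite !val_pt // => e.
  have /vlineP[c vE] : v \in <[w]>%VS by rewrite -e memv_line.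
  exists c => //; apply: contra_neq v0 => c0; by rewrite vE c0 scale0r.
case=> c c0 ->; apply: val_inj; rewrite !val_pt // ?scaler_eq0 ?negb_or ?c0 //.
apply/eqP; rewrite eqEdim -memvE !dim_vline scaler_eq0 (negPf c0) (negPf w0) /=.
by rewrite memvZ ?memv_line.
Qed.

Lemma ptZ c v : c != 0 -> v != 0 -> pt (c *: v) = pt v.
Proof.
by move=> c0 v0; apply/pt_eq; rewrite ?scaler_eq0 ?negb_or ?c0 //; exists c.
Qed.

Lemma co_pt v : v != 0 -> exists2 c : k, c != 0 & co (pt v) = c *: v.
Proof. by move=> v0; apply/pt_eq; rewrite ?co_neq0 // -ptE. Qed.

Definition ev a v : k := a.@[fun i => v 0 i].

Lemma evZ d a c v : a \is d.-homog -> ev a (c *: v) = c ^+ d * ev a v.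
Proof.
move=> /dhomogP ha; rewrite /ev !mevalE mulr_sumr !big_seq; apply: eq_bigr => m /ha.
rewrite /= mdegE => <-; rewrite mulrCA; congr (_ * _).
rewrite -prodrXr -big_split; apply: eq_bigr => i _ /=.
by rewrite !mxE exprMn.
Qed.

Lemma ev_pt0 d a v : a \is d.-homog -> v != 0 ->
  (ev a (co (pt v)) == 0) = (ev a v == 0).
Proof.
move=> ha /co_pt[c c0 ->]; by rewrite (evZ _ _ ha) mulf_eq0 expf_eq0 (negPf c0) andbF.
Qed.

Lemma zeros_pt d a v : a \is d.-homog -> v != 0 -> zeros a (pt v) <-> ev a v = 0.
Proof.
move=> ha v0; have e := ev_pt0 ha v0; split=> [h|h]; apply/eqP.
  by rewrite -e; apply/eqP.
by change (ev a (co (pt v)) == 0); rewrite e h.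
Qed.

End Points.

(** * Pullback of forms along a parametrised curve *)

Section Pullback.
Variable k : fieldType.

Definition pb (phi : 'I_3 -> {poly k}) (a : {mpoly k[3]}) : {poly k} :=
  mmap (@polyC k) phi a.
HB.instance Definition _ phi := GRing.RMorphism.copy (pb phi) (mmap (@polyC k) phi).

Lemma pbX phi i : pb phi 'X_i = phi i.
Proof. by rewrite /pb mmapX mmap1U. Qed.

Lemma pbC phi c : pb phi c%:MP = c%:P.
Proof. by rewrite /pb mmapC. Qed.

Lemma pbZ phi c a : pb phi (c *: a) = c *: pb phi a.
Proof. by rewrite -mul_mpolyC rmorphM /= pbC mul_polyC. Qed.

Lemma horner_pb phi a t : (pb phi a).[t] = a.@[fun i => (phi i).[t]].
Proof.
elim/mpolyind: a => [|c m a _ _ IH]; first by rewrite !rmorph0 horner0.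
rewrite !rmorphD /= hornerD IH pbZ mevalZ hornerZ; congr (_ * _ + _).
rewrite /pb mmapX mevalX /mmap1 horner_prod; apply: eq_bigr => i _.
by rewrite horner_exp.
Qed.

End Pullback.

Lemma size_polyM_leS (R : nzRingType) (p q : {poly R}) n m :
  (size p <= n.+1)%N -> (size q <= m.+1)%N -> (size (p * q)%R <= (n + m).+1)%N.
Proof.
move=> hp hq; apply: leq_trans (size_polyMleq _ _) _.
by have := leq_add hp hq; rewrite addSn addnS; case: (_ + _)%N.
Qed.

Lemma cross_mul (F : fieldType) (x y z w : F) :
  y != 0 -> w != 0 -> x / y = z / w -> x * w = z * y.
Proof. by move=> y0 w0 /eqP; rewrite eqr_div // => /eqP. Qed.

(** * The local quotient as truncated power series in the parameter *)

Section LocalMultiplicity.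
Variables (k : fieldType) (q l0 l1 : {mpoly k[3]}) (phi : 'I_3 -> {poly k}).
Implicit Types (a b f : {mpoly k[3]}) (al be : {poly k}).
Hypotheses (l0h : l0 \is 1.-homog) (l1h : l1 \is 1.-homog).
Hypotheses (pb_l0 : pb phi l0 = 1) (pb_l1 : pb phi l1 = 'X) (pb_q : pb phi q = 0).

(** Homogenisation of a polynomial in the parameter t = [l1] / [l0]. Extra powers of [l0] are
    harmless, since [l0] pulls back to 1 and so does not vanish at the point. *)
Definition hmg N al : {mpoly k[3]} := \sum_(i < N.+1) al`_i *: (l1 ^+ i * l0 ^+ (N - i)).

Hypothesis phi_size : forall i, (size (phi i) <= 3)%N.
(** What makes the curve [q] = 0 rational in t: modulo [q], each coordinate times [l0] is a
    quadratic form in [l0] and [l1]. Degree 2 serves lines as well as conics. *)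
Hypothesis red : forall i, exists c, l0 * 'X_i = hmg 2 (phi i) + c * q.

Let K := {fraction {mpoly k[3]}}.
Let sc : {rmorphism k -> K} := (@tofrac {mpoly k[3]}) \o (@mpolyC 3 k).

Lemma l0_neq0 : l0 != 0.
Proof. by apply/eqP => e; move: pb_l0; rewrite e rmorph0 => /esym/eqP; rewrite oner_eq0. Qed.

(** In the fraction field a homogenisation is a value at [l1] / [l0], so its multiplicativity
    follows from that of evaluation, without double sums. *)
Lemma hmgE N al : (size al <= N.+1)%N ->
  (hmg N al)%:F = l0%:F ^+ N * (map_poly sc al).[l1%:F / l0%:F].
Proof.
move=> sz; have l0n : l0%:F != 0 :> K by rewrite tofrac_eq0 l0_neq0.
rewrite (@horner_coef_wide _ N.+1) ?(leq_trans (size_poly _ _)) // mulr_sumr rmorph_sum.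
apply: eq_bigr => i _; rewrite coef_map /= -mul_mpolyC !rmorphM !rmorphXn /=.
rewrite expr_div_n [RHS]mulrCA; congr (_ * _).
rewrite [RHS]mulrCA; congr (_ * _).
have iN : (i <= N)%N by rewrite -ltnS.
by rewrite (_ : l0%:F ^+ N = l0%:F ^+ (N - i) * l0%:F ^+ i) ?mulfK ?expf_neq0 // -exprD subnK.
Qed.

Lemma hmgM N M al be : (size al <= N.+1)%N -> (size be <= M.+1)%N ->
  hmg N al * hmg M be = hmg (N + M) (al * be).
Proof.
move=> sa sb; apply/eqP; rewrite -tofrac_eq; apply/eqP.
rewrite rmorphM /= !hmgE //; last first.
  exact: size_polyM_leS.
by rewrite rmorphM /= hornerM exprD mulrACA.
Qed.

Lemma hmgD N al be : hmg N (al + be) = hmg N al + hmg N be.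
Proof. by rewrite -big_split; apply: eq_bigr => i _; rewrite coefD scalerDl. Qed.

Lemma hmgZ N c al : hmg N (c *: al) = c *: hmg N al.
Proof. by rewrite scaler_sumr; apply: eq_bigr => i _; rewrite coefZ scalerA. Qed.

Lemma hmg_homog N al : hmg N al \is N.-homog.
Proof.
apply: rpred_sum => i _; apply: rpredZ.
have iN : (i <= N)%N by rewrite -ltnS.
by have := dhomogM (dhomogMn i l1h) (dhomogMn (N - i) l0h); rewrite !mul1n subnKC.
Qed.

Lemma pb_hmg N al : (size al <= N.+1)%N -> pb phi (hmg N al) = al.
Proof.
move=> sz; rewrite rmorph_sum /= -[RHS](coefK al) (poly_def).
rewrite (big_ord_widen _ (fun i => al`_i *: 'X^i) sz) [RHS]big_mkcond.
apply: eq_bigr => i _; rewrite pbZ rmorphM !rmorphXn /= pb_l0 pb_l1 expr1n mulr1.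
by case: ltnP => // h; rewrite nth_default // scale0r.
Qed.

(* l0^d a agrees modulo q with the form of degree 2d determined by its pullback *)
Lemma hmg_red d a : a \is d.-homog ->
  (size (pb phi a) <= d.*2.+1)%N /\ exists c, l0 ^+ d * a = hmg d.*2 (pb phi a) + c * q.
Proof.
(* The property is stable under products, sums and scalars, so it suffices to have it for the
   variables, where it is [red]. *)
pose R d a := (size (pb phi a) <= d.*2.+1)%N /\
  exists c, l0 ^+ d * a = hmg d.*2 (pb phi a) + c * q.
have RM d1 d2 a1 a2 : R d1 a1 -> R d2 a2 -> R (d1 + d2)%N (a1 * a2).
  move=> [s1 [c1 e1]] [s2 [c2 e2]]; split.
    by rewrite rmorphM doubleD; exact: size_polyM_leS.
  exists (c1 * (l0 ^+ d2 * a2) + hmg d1.*2 (pb phi a1) * c2).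
  rewrite exprD mulrACA {1}e1 mulrDl {1}e2 rmorphM doubleD -hmgM //.
  ring.
have RD a1 a2 : R d a1 -> R d a2 -> R d (a1 + a2).
  move=> [s1 [c1 e1]] [s2 [c2 e2]]; split.
    by rewrite rmorphD; apply: leq_trans (size_polyD _ _) _; rewrite geq_max s1.
  by exists (c1 + c2); rewrite mulrDr e1 e2 rmorphD hmgD; ring.
have RZ c a1 : R d a1 -> R d (c *: a1).
  move=> [s1 [c1 e1]]; split.
    by rewrite pbZ; apply: leq_trans (size_scale_leq _ _) _.
  by exists (c *: c1); rewrite pbZ -scalerAr e1 hmgZ scalerDr scalerAl.
have R1 : R 0%N 1.
  split; first by rewrite rmorph1 size_poly1.
  by exists 0; rewrite rmorph1 /hmg big_ord1 coefC /= !expr0 mul0r addr0 !mulr1 scale1r.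
have RX i : R 1%N 'X_i.
  split; first by rewrite pbX.
  by have [c e] := red i; exists c; rewrite expr1 e pbX.
have RXn i n : R n ('X_i ^+ n).
  elim: n => [//|n IH]; rewrite exprS -add1n; exact: RM.
have RXm m : R (mdeg m) 'X_[m].
  rewrite mpolyXE_id mdegE; elim/big_rec2: _ => [//|i n a1 _ IH]; exact: RM.
move=> ha; rewrite [a]mpolyE; move/dhomogP: ha => ha; rewrite -/(R d _).
rewrite big_seq; apply: (big_ind (R d)) => [|a1 a2|m /ha /= e]; last by apply: RZ; rewrite -e; exact: RXm.
- split; first by rewrite rmorph0 size_poly0.
  exists 0; rewrite rmorph0 mulr0 mul0r addr0 /hmg big1 // => i _.
  by rewrite coef0 scale0r.
- exact: RD.
Qed.

Variable P : P2 k.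
Hypothesis phi_P : exists2 c, c != 0 & forall i, coords P i = c * (phi i).[0].

Lemma pb_at0 d b : b \is d.-homog -> (b.@[coords P] != 0) = ((pb phi b).[0] != 0).
Proof.
move=> hb; have [c c0 e] := phi_P.
have -> : b.@[coords P] = ev b (c *: \row_i (phi i).[0]).
  by apply: meval_eq => i; rewrite !mxE e.
rewrite (evZ _ _ hb) mulf_eq0 expf_eq0 (negPf c0) andbF /= horner_pb.
by congr (_ != 0); apply: meval_eq => i; rewrite mxE.
Qed.

Lemma coprime_Xn n al : al.[0] != 0 -> coprimep 'X^n al.
Proof.
move=> h; apply: coprimep_expl; rewrite coprimep_sym -['X]subr0 -polyC0.
by rewrite coprimep_XsubC.
Qed.

Lemma neq0_at0 a : (pb phi a).[0] != 0 -> a != 0.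
Proof. by apply: contraNneq => ->; rewrite rmorph0 horner0. Qed.

Variables (f : {mpoly k[3]}) (df n : nat) (be : {poly k}).
Hypotheses (fh : f \is df.-homog) (pb_f : pb phi f = 'X^n * be) (be0 : be.[0] != 0).

(** Forward, [q] pulls back to 0, [f] to a multiple of t^n, and denominators to units at t = 0.
    Conversely, let t^n divide the pullback of [a]. Then [a] times the homogenisation of [be] and a
    power of [l0] has the same pullback as a multiple of [f], so by [hmg_red] it lies in the ideal
    of [q] and [f]; the extra factor is a unit at [P] because [be] is nonzero at 0. *)
Lemma local_idealP d a b : a \is d.-homog -> b \is d.-homog -> (pb phi b).[0] != 0 ->
  local_ideal q f P (a%:F / b%:F) <-> 'X^n %| pb phi a.
Proof.
move=> ha hb b0; have bn : b%:F != 0 :> K by rewrite tofrac_eq0 neq0_at0.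
split.
  case=> d' [a' [b' [ha' hb' b'0 [u [w a'E]] e]]].
  move: b'0; rewrite (pb_at0 hb') => b'0.
  have b'n : b'%:F != 0 :> K by rewrite tofrac_eq0 neq0_at0.
  have {e} : a * b' = a' * b.
    apply/eqP; rewrite -tofrac_eq !rmorphM; apply/eqP.
    exact: (cross_mul bn b'n e).
  move/(congr1 (pb phi)); rewrite !rmorphM a'E rmorphD !rmorphM /= pb_q mulr0 add0r pb_f => e.
  rewrite -(Gauss_dvdpl _ (coprime_Xn n b'0)) e -mulrA mulrCA -mulrA.
  exact: dvdp_mulr.
case/dvdpP => al0; rewrite mulrC => aE.
have [sa [c ca]] := hmg_red ha; have [sf [c' cf]] := hmg_red fh.
have size_fac x (y : {poly k}) m : (size ('X^x * y)%R <= m -> size y <= m)%N.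
  have [->|y0] := eqVneq y 0; first by rewrite size_poly0.
  by rewrite mulrC size_mulXn //; apply: leq_trans; rewrite leq_addl.
have sal : (size al0 <= d.*2.+1)%N by apply: (@size_fac n); rewrite -aE.
have sbe : (size be <= df.*2.+1)%N by apply: (@size_fac n); rewrite -pb_f.
pose b2 := hmg df.*2 be * l0 ^+ d.
have h2 : b2 \is (df.*2 + d).-homog.
  by rewrite dhomogM ?hmg_homog //; have := dhomogMn d l0h; rewrite mul1n.
have b20 : pb phi b2 = be by rewrite rmorphM rmorphXn /= pb_l0 expr1n mulr1 pb_hmg.
exists (df.*2 + d + d)%N, (b2 * a), (b2 * b); split.
- exact: (dhomogM h2 ha).
- exact: (dhomogM h2 hb).
- rewrite (pb_at0 (dhomogM h2 hb)) rmorphM hornerM /=; apply: mulf_neq0; last exact: b0.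
  by rewrite b20.
- exists (hmg df.*2 be * c - hmg d.*2 al0 * c'), (hmg d.*2 al0 * l0 ^+ df).
  rewrite /b2 -mulrA ca mulrDr hmgM // -(mulrA (hmg _ al0)) cf [in RHS]mulrDr hmgM //.
  rewrite addnC aE pb_f.
  have -> : be * ('X^n * al0) = al0 * ('X^n * be) by ring.
  ring.
have b2n : b2%:F != 0 :> K by rewrite tofrac_eq0 neq0_at0 // b20.
by clearbody b2; rewrite !rmorphM -mulf_div mulfV ?mul1r.
Qed.

(* [v] lists the coefficients of the Taylor expansion of [x] along the curve, up to order n *)
Definition taylor (x : K) (v : 'rV[k]_n) : Prop :=
  exists d a b, [/\ a \is d.-homog, b \is d.-homog, (pb phi b).[0] != 0, x = a%:F / b%:F &
    'X^n %| pb phi a - pb phi b * rVpoly v].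

Lemma taylor_exists x : local_ring P x -> exists v, taylor x v.
Proof.
case=> d [a [b [ha hb b0 ->]]]; rewrite (pb_at0 hb) in b0.
(* [w] is the inverse of the pulled back denominator modulo t^n. *)
have /Bezout_eq1_coprimepP[[u w] /= uw] := coprime_Xn n b0.
exists (poly_rV ((w * pb phi a) %% 'X^n)), d, a, b; split => //.
rewrite poly_rV_K; last first.
  by rewrite -ltnS -(size_polyXn k n) ltn_modp monic_neq0 // monicXn.
have e := divp_eq (w * pb phi a) 'X^n.
apply/dvdpP; exists (u * pb phi a + pb phi b * ((w * pb phi a) %/ 'X^n)).
have -> : (w * pb phi a) %% 'X^n = w * pb phi a - (w * pb phi a) %/ 'X^n * 'X^n.
  by rewrite [X in _ = X - _]e addrAC subrr add0r.
rewrite -{1}[pb phi a]mul1r -uw; ring.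
Qed.

Lemma taylor_local x v : taylor x v -> local_ring P x.
Proof. by case=> d [a [b [ha hb b0 e _]]]; exists d, a, b; rewrite (pb_at0 hb). Qed.

Lemma taylor_ideal x v : taylor x v -> local_ideal q f P x <-> v = 0.
Proof.
case=> d [a [b [ha hb b0 -> e]]]; rewrite (local_idealP ha hb b0).
have -> : ('X^n %| pb phi a) = ('X^n %| rVpoly v).
  rewrite -(Gauss_dvdpr (rVpoly v) (coprime_Xn n b0)).
  by apply/esym; rewrite -(dvdp_addr _ e) subrK.
split=> [h|->]; last by rewrite linear0 dvdp0.
apply/(can_inj (@rVpolyK _ _)); rewrite linear0; apply/eqP.
apply: contraTT h => v0; apply/negP => /(dvdp_leq v0).
by rewrite size_polyXn ltnNge size_poly.
Qed.

Lemma taylorD x y v w : taylor x v -> taylor y w -> taylor (x + y) (v + w).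
Proof.
case=> d [a [b [ha hb b0 -> e]]] [d' [a' [b' [ha' hb' b'0 -> e']]]].
exists (d + d')%N, (a * b' + a' * b), (b * b'); split.
- by apply: rpredD; [exact: dhomogM | rewrite addnC; exact: dhomogM].
- exact: dhomogM.
- by rewrite rmorphM hornerM mulf_neq0.
- by rewrite addf_div ?tofrac_eq0 ?neq0_at0 // !(rmorphM, rmorphD).
rewrite linearD !(rmorphM, rmorphD) /=.
have -> : pb phi a * pb phi b' + pb phi a' * pb phi b -
    pb phi b * pb phi b' * (rVpoly v + rVpoly w) =
   (pb phi a - pb phi b * rVpoly v) * pb phi b' +
   (pb phi a' - pb phi b' * rVpoly w) * pb phi b by ring.
by rewrite dvdp_add ?dvdp_mulr.
Qed.

Lemma taylorZ c x v : taylor x v -> taylor (c%:MP%:F * x) (c *: v).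
Proof.
case=> d [a [b [ha hb b0 -> e]]]; exists d, (c *: a), b; split => //.
- exact: rpredZ.
- by rewrite -mul_mpolyC rmorphM mulrA.
by rewrite linearZ pbZ -scalerAr -scalerBr -mul_polyC dvdp_mull.
Qed.

Lemma taylor0 : taylor 0 0.
Proof.
exists 0%N, 0, 1; split; rewrite ?rpred0 ?dhomog1 //.
- by rewrite rmorph1 hornerC oner_eq0.
- by rewrite rmorph0 mul0r.
by rewrite linear0 rmorph0 mulr0 subr0 dvdp0.
Qed.

Lemma taylor_surj v : exists x, taylor x v.
Proof.
exists ((hmg n (rVpoly v))%:F / (l0 ^+ n)%:F), n, (hmg n (rVpoly v)), (l0 ^+ n).
have sz : (size (rVpoly v) <= n.+1)%N by rewrite (leq_trans (size_poly _ _)).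
split => //.
- exact: hmg_homog.
- by have := dhomogMn n l0h; rewrite mul1n.
- by rewrite rmorphXn /= pb_l0 expr1n hornerC oner_eq0.
by rewrite pb_hmg // rmorphXn /= pb_l0 expr1n mul1r subrr dvdp0.
Qed.

Lemma taylor_comb m (x : K) v (e : 'I_m -> K) (V : 'M_(m, n)) (c : 'rV_m) :
  taylor x v -> (forall i, taylor (e i) (row i V)) ->
  taylor (x - \sum_(i < m) (c 0 i)%:MP%:F * e i) (v - c *m V).
Proof.
move=> hx he; rewrite mulmx_sum_row -!sumrN.
apply: taylorD => //; apply: (big_ind2 taylor); first exact: taylor0.
  by move=> *; exact: taylorD.
move=> i _; rewrite -mulNr -scaleNr -!rmorphN; exact: taylorZ.
Qed.

(** Taylor expansion is linear, maps onto k^n and has the local ideal as kernel. A family is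
    therefore a basis of the quotient only if the matrix of its Taylor rows is both row free and row
    full, hence square; the standard basis of k^n provides one of size n. *)
Theorem intersection_multiplicityE m : intersection_multiplicity q f P m <-> m = n.
Proof.
split=> [[e [el eu]]|->].
  have [V hV] : exists V : 'M_(m, n), forall i, taylor (e i) (row i V).
    have [g hg] := boolp.choice (fun i => taylor_exists (el i)).
    by exists (\matrix_i g i) => i; rewrite rowK.
  have uniq_comb v : exists! c : 'rV_m, v = c *m V.
    have [x hx] := taylor_surj v.
    have [c [hc uc]] := eu x (taylor_local hx).
    exists c; split=> [|c' hc'].
      apply/subr0_eq; exact/(taylor_ideal (taylor_comb c hx hV)).
    apply: uc; apply/(taylor_ideal (taylor_comb c' hx hV)).
    by rewrite {1}hc' subrr.
  have free : row_free V.
    apply: inj_row_free => c hc; have [c0 [_ u0]] := uniq_comb 0.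
    by rewrite -(u0 c) // -(u0 0) // mul0mx.
  have full : row_full V.
    rewrite -sub1mx; apply/row_subP => i.
    by have [c [-> _]] := uniq_comb (row i 1%:M); exact: submxMl.
  exact: etrans (esym (eqP free)) (eqP full).
have [e he] := boolp.choice (fun i : 'I_n => taylor_surj (row i 1%:M)).
exists e; split=> [i|x /taylor_exists[v hv]]; first exact: taylor_local (he i).
have H c := taylor_ideal (taylor_comb c hv he).
exists v; split=> [|c hc]; first by apply/H; rewrite mulmx1 subrr.
by move/H: hc; rewrite mulmx1 => /subr0_eq.
Qed.
End LocalMultiplicity.

Definition i0 : 'I_3 := @Ordinal 3 0 isT.
Definition i1 : 'I_3 := @Ordinal 3 1 isT.
Definition i2 : 'I_3 := @Ordinal 3 2 isT.

Lemma sum3 (V : nmodType) (F : 'I_3 -> V) : \sum_i F i = F i0 + F i1 + F i2.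
Proof.
rewrite !big_ord_recr big_ord0 /= add0r; congr (F _ + F _ + F _); exact: val_inj.
Qed.

Lemma all3 (P : 'I_3 -> Prop) : P i0 -> P i1 -> P i2 -> forall i, P i.
Proof.
move=> h0 h1 h2 [[|[|[|//]]] hi]; [move: h0|move: h1|move: h2];
  by congr (P _); apply: val_inj.
Qed.

Definition row3 (T : Type) (a b c : T) : 'rV[T]_3 :=
  \row_i (if val i is 0 then a else if val i is 1 then b else c)%N.

Lemma row3E T (a b c : T) :
  (row3 a b c 0 i0 = a) * (row3 a b c 0 i1 = b) * (row3 a b c 0 i2 = c).
Proof. by rewrite !mxE. Qed.

Lemma row3_eta T (v : 'rV[T]_3) : v = row3 (v 0 i0) (v 0 i1) (v 0 i2).
Proof. by apply/rowP; apply: all3; rewrite row3E. Qed.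

(** * Conics and lines in the coordinates given by a matrix *)

Section Coordinates.
Variable k : fieldType.
Implicit Types (C M g : 'M[k]_3) (f q : {mpoly k[3]}) (v x : 'rV[k]_3).

(* the coordinates with respect to the basis given by the rows of [C] *)
Definition lf C (j : 'I_3) : {mpoly k[3]} := \sum_i (invmx C) i j *: 'X_i.

Lemma lf_homog C j : lf C j \is 1.-homog.
Proof. by apply: rpred_sum => i _; apply: rpredZ; rewrite dhomogX /= mdeg1. Qed.

Lemma ev_lf C j v : ev (lf C j) v = (v *m invmx C) 0 j.
Proof.
rewrite /ev raddf_sum mxE /=; apply: eq_bigr => i _.
by rewrite mevalZ mevalXU mulrC.
Qed.

Lemma mderivXU (a i : 'I_3) : ('X_a : {mpoly k[3]})^`M(i) = (a == i)%:R.
Proof.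
rewrite mderivX mnm1E; case: eqP => [->|_]; last by rewrite scale0r.
rewrite scale1r (_ : (U_(i) - U_(i))%MM = 0%MM) ?mpolyX0 //.
by apply/mnmP => b; rewrite mnmBE mnm0E subnn.
Qed.

Lemma mderiv_lf C i j : (lf C j)^`M(i) = (invmx C i j)%:MP.
Proof.
rewrite /lf (raddf_sum (mderiv i)) (bigD1 i) //= big1 ?addr0 => [|a /negPf ai].
  by rewrite mderivZ mderivXU eqxx -mul_mpolyC mulr1.
by rewrite mderivZ mderivXU ai scaler0.
Qed.

Lemma X_lf C i : C \in unitmx -> 'X_i = \sum_j C j i *: lf C j.
Proof.
move=> uC; transitivity (\sum_l (invmx C *m C) l i *: ('X_l : {mpoly k[3]})).
  rewrite mulVmx // (bigD1 i) //= mxE eqxx scale1r big1 ?addr0 // => l li.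
  by rewrite mxE (negPf li) scale0r.
rewrite (eq_bigr (fun l => \sum_j C j i *: (invmx C l j *: 'X_l))).
  by rewrite exchange_big; apply: eq_bigr => j _; rewrite scaler_sumr.
move=> l _; rewrite mxE scaler_suml; apply: eq_bigr => j _.
by rewrite scalerA mulrC.
Qed.

Lemma lf_mul g M j : g \in unitmx -> M \in unitmx ->
  lf M j = \sum_i g i j *: lf (g *m M) i.
Proof.
move=> ug uM; rewrite (eq_bigr (fun i => \sum_l ((invmx (g *m M)) l i * g i j) *: 'X_l)).
  rewrite exchange_big; apply: eq_bigr => l _; rewrite -scaler_suml; congr (_ *: _).
  have -> : invmx M = invmx (g *m M) *m g.
    have ugM : g *m M \in unitmx by rewrite unitmx_mul ug.
    apply: (can_inj (mulmxK uM)); rewrite mulVmx // -mulmxA mulVmx //.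
  by rewrite mxE.
by move=> i _; rewrite scaler_sumr; apply: eq_bigr => l _; rewrite scalerA mulrC.
Qed.

Definition conic C : {mpoly k[3]} := lf C i1 ^+ 2 - lf C i0 * lf C i2.

Lemma conic_homog C : conic C \is 2.-homog.
Proof.
apply: rpredB; first by have := dhomogMn 2 (lf_homog C i1); rewrite mul1n.
exact: (dhomogM (lf_homog C i0) (lf_homog C i2)).
Qed.

Lemma ev_conic C v : ev (conic C) v =
  (v *m invmx C) 0 i1 ^+ 2 - (v *m invmx C) 0 i0 * (v *m invmx C) 0 i2.
Proof. by rewrite /ev rmorphB rmorphXn rmorphM /= -!/(ev _ _) !ev_lf. Qed.

(** [cpar C] is t |-> (1, t, t^2) C, which runs along [conic C]; [lpar C] is t |-> (1, t, 0) C,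
    along the line where [lf C i2] vanishes. Both pass through row 0 of [C] at t = 0. *)
Definition cpar C (i : 'I_3) : {poly k} := \sum_j C j i *: 'X^j.
Definition lpar C (i : 'I_3) : {poly k} := (C i0 i)%:P + (C i1 i) *: 'X.

Lemma pb_lin (phi : 'I_3 -> {poly k}) C j :
  pb phi (lf C j) = \sum_i invmx C i j *: phi i.
Proof. by rewrite raddf_sum /=; apply: eq_bigr => i _; rewrite pbZ pbX. Qed.

Lemma pb_cpar g M j : M \in unitmx -> pb (cpar (g *m M)) (lf M j) = \sum_i g i j *: 'X^i.
Proof.
move=> uM; rewrite pb_lin (eq_bigr (fun i => \sum_l ((g *m M) l i * invmx M i j) *: 'X^l)).
  rewrite exchange_big; apply: eq_bigr => l _; rewrite -scaler_suml; congr (_ *: _).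
  by rewrite -[in RHS](mulmxK uM g) mxE.
by move=> i _; rewrite scaler_sumr; apply: eq_bigr => l _; rewrite scalerA mulrC.
Qed.

Lemma pb_lpar g M j : M \in unitmx ->
  pb (lpar (g *m M)) (lf M j) = (g i0 j)%:P + g i1 j *: 'X.
Proof.
move=> uM.
have e l : g l j = \sum_i (g *m M) l i * invmx M i j.
  by rewrite -{1}(mulmxK uM g) mxE.
rewrite pb_lin !e rmorph_sum scaler_suml -big_split; apply: eq_bigr => i _ /=.
by rewrite /lpar scalerDr -mul_polyC -polyCM scalerA mulrC (mulrC (invmx M i j)).
Qed.

Lemma coordsP (phi : 'I_3 -> {poly k}) C : C \in unitmx ->
  (forall i, (phi i).[0] = C i0 i) ->
  exists2 c, c != 0 & forall i, coords (pt (row i0 C)) i = c * (phi i).[0].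
Proof.
move=> uC h; have [|c c0 e] := @co_pt _ (row i0 C).
  apply: contraTneq uC => /rowP r0; rewrite unitmxE unitfE negbK.
  by rewrite (expand_det_row _ i0) big1 // => j _; have := r0 j; rewrite !mxE => ->; rewrite mul0r.
by exists c => // i; rewrite h /coords -/(co _) e !mxE.
Qed.

Theorem conic_multiplicity C a f d n (be : {poly k}) m :
  C \in unitmx -> a != 0 -> f \is d.-homog -> pb (cpar C) f = 'X^n * be -> be.[0] != 0 ->
  intersection_multiplicity (a *: conic C) f (pt (row i0 C)) m <-> m = n.
Proof.
move=> uC a0 fh fE be0.
have pl j : pb (cpar C) (lf C j) = 'X^j.
  rewrite -{1}[C]mul1mx pb_cpar // (bigD1 j) //= mxE eqxx scale1r big1 ?addr0 // => i ij.
  by rewrite mxE (negPf ij) scale0r.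
apply: (@intersection_multiplicityE _ _ (lf C i0) (lf C i1) (cpar C) (lf_homog _ _)
   (lf_homog _ _) _ _ _ _ _ _ _ f d n be fh fE be0); rewrite ?pl ?expr0 ?expr1 //.
- by rewrite pbZ rmorphB rmorphXn rmorphM /= !pl expr0 mul1r expr1 subrr scaler0.
- move=> i; rewrite /cpar sum3; apply/leq_sizeP => j hj.
  by rewrite !coefD !coefZ !coefXn; move: j hj => [|[|[|j]]] //= _; rewrite !mulr0 !addr0.
(* In the coordinates y of [C], the product y0 y2 equals y1^2 minus [a^-1] times the equation of the
   conic, and only the y2 part of the variable needs this. *)
- move=> i; exists (- ((C i2 i)%:MP * (a^-1)%:MP)).
  rewrite /hmg sum3 [in LHS](X_lf i uC) sum3 /cpar sum3 !coefD !coefZ !coefXn /=.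
  rewrite !mulr0 !mulr1 !addr0 !add0r -!mul_mpolyC.
  have e : (a^-1)%:MP * a%:MP = 1 :> {mpoly k[3]} by rewrite -rmorphM mulVf.
  rewrite /conic; transitivity ((C i0 i)%:MP * (lf C i0 ^+2) + (C i1 i)%:MP * (lf C i1 * lf C i0) +
    (C i2 i)%:MP * lf C i1 ^+ 2 - (C i2 i)%:MP * ((a^-1)%:MP * a%:MP) * (lf C i1 ^+ 2 - lf C i0 * lf C i2)).
    rewrite e; ring.
  ring.
by apply: coordsP => // i; rewrite /cpar sum3 !hornerE /= ?expr0n /= ?mulr0 ?addr0 ?mulr1.
Qed.

Theorem line_multiplicity C a f d n (be : {poly k}) m :
  C \in unitmx -> a != 0 -> f \is d.-homog -> pb (lpar C) f = 'X^n * be -> be.[0] != 0 ->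
  intersection_multiplicity (a *: lf C i2) f (pt (row i0 C)) m <-> m = n.
Proof.
move=> uC a0 fh fE be0.
have pl j : pb (lpar C) (lf C j) = ((1%:M : 'M[k]_3) i0 j)%:P + (1%:M : 'M[k]_3) i1 j *: 'X.
  by rewrite -{1}[C]mul1mx pb_lpar.
apply: (@intersection_multiplicityE _ _ (lf C i0) (lf C i1) (lpar C) (lf_homog _ _)
   (lf_homog _ _) _ _ _ _ _ _ _ f d n be fh fE be0).
- by rewrite pl !mxE /= scale0r addr0.
- by rewrite pl !mxE /= scale1r add0r.
- by rewrite pbZ pl !mxE /= scale0r addr0 scaler0.
- move=> i; rewrite /lpar; apply/leq_sizeP => j hj.
  by rewrite !coefD !coefZ !coefC !coefX; move: j hj => [|[|j]] //= _; rewrite !mulr0 !addr0.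
- move=> i; exists ((C i2 i)%:MP * (a^-1)%:MP * lf C i0).
  rewrite /hmg sum3 [in LHS](X_lf i uC) sum3 /lpar !coefD !coefZ !coefC !coefX /=.
  rewrite !mulr0 !mulr1 !addr0 !add0r -!mul_mpolyC.
  have e : (a^-1)%:MP * a%:MP = 1 :> {mpoly k[3]} by rewrite -rmorphM mulVf.
  transitivity ((C i0 i)%:MP * (lf C i0 ^+2) + (C i1 i)%:MP * (lf C i1 * lf C i0) +
      (C i2 i)%:MP * ((a^-1)%:MP * a%:MP) * (lf C i0 * lf C i2)).
    rewrite e; ring.
  ring.
by apply: coordsP => // i; rewrite /lpar !hornerE ?mulr0 ?addr0.
Qed.

End Coordinates.

(** * The Hermitian form *)

Section Char5.
Variable R : comNzRingType.
Hypothesis char_R : 5%N \in [pchar R].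

Lemma five0 : 5%:R = 0 :> R.
Proof. by case/andP: char_R => _ /eqP. Qed.

(** Reduces an identity that holds only modulo 5 to one over the integers, which [ring] decides: [z]
    is the difference of the two sides divided by 5. *)
Lemma eq_mod5 (x y z : R) : x = y + 5%:R * z -> x = y.
Proof. by rewrite five0 mul0r addr0. Qed.

Lemma exp5D (x y : R) : (x + y) ^+ 5 = x ^+ 5 + y ^+ 5.
Proof. by rewrite -!(pFrobenius_autE char_R) rmorphD. Qed.

Lemma exp5N (x : R) : (- x) ^+ 5 = - x ^+ 5.
Proof. by rewrite -!(pFrobenius_autE char_R) rmorphN. Qed.

Definition hm (x y z : R) : R := x * z ^+ 5 + x ^+ 5 * z - 2%:R * y ^+ 6.
End Char5.

Lemma mpoly_rmorph_ext (n : nat) (k A : comNzRingType) (F G : {rmorphism {mpoly k[n]} -> A}) :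
  (forall c, F c%:MP = G c%:MP) -> (forall i, F 'X_i = G 'X_i) -> F =1 G.
Proof.
move=> hC hX p; elim/mpolyind: p => [|c m p _ _ IH]; first by rewrite !rmorph0.
rewrite !rmorphD IH -mul_mpolyC !rmorphM hC; congr (_ * _ + _).
by rewrite mpolyXE_id !rmorph_prod; apply: eq_bigr => i _; rewrite !rmorphXn hX.
Qed.

Lemma hm_morph (R S : comNzRingType) (F : {rmorphism R -> S}) x y z :
  F (hm x y z) = hm (F x) (F y) (F z).
Proof.
rewrite /hm rmorphB rmorphD (rmorphM F x) (rmorphM F (x ^+ 5)) (rmorphM F 2%:R) rmorph_nat.
by rewrite (rmorphXn F 5) (rmorphXn F 5) (rmorphXn F 6).
Qed.

(* sesquilinear expansion of [hm], with the fifth powers abstracted to primed variables *)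
Lemma hm_expand (R : comNzRingType) (a b c d e f g h i a' b' c' d' e' f' g' h' i'
    x y z x' y' z' : R) :
  let p := a * x + d * y + g * z in let q := b * x + e * y + h * z in
  let r := c * x + f * y + i * z in
  let p' := a' * x' + d' * y' + g' * z' in let q' := b' * x' + e' * y' + h' * z' in
  let r' := c' * x' + f' * y' + i' * z' in
  let H u v w s t o := u * o + w * s - 2%:R * (v * t) in
  p * r' + p' * r - 2%:R * (q' * q) =
    H a b c a' b' c' * (x * x') + H a b c d' e' f' * (x * y') + H a b c g' h' i' * (x * z') +
    (H d e f a' b' c' * (y * x') + H d e f d' e' f' * (y * y') + H d e f g' h' i' * (y * z')) +
    (H g h i a' b' c' * (z * x') + H g h i d' e' f' * (z * y') + H g h i g' h' i' * (z * z')).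
Proof. by move=> /=; ring. Qed.

(** * The unitary group of the form *)

Section Unitary.
Variable k : fieldType.
Hypothesis char_k : 5%N \in [pchar k].
Implicit Types (C M g : 'M[k]_3) (f q : {mpoly k[3]}) (v x : 'rV[k]_3).

Local Notation Fr := (pFrobenius_aut char_k).

Definition Bm : 'M[k]_3 :=
  \matrix_(i, j) (if (i + j == 2)%N then if val i is 1%N then - 2%:R else 1 else 0).

(* the Gram matrix of the rows of [g], for the Hermitian form with matrix [Bm] *)
Definition gram g : 'M[k]_3 := g *m Bm *m (map_mx Fr g)^T.

Lemma gramE g i j : gram g i j =
  g i i0 * g j i2 ^+ 5 + g i i2 * g j i0 ^+ 5 - 2%:R * (g i i1 * g j i1 ^+ 5).
Proof.
rewrite mxE sum3 !mxE !sum3 !mxE /= !pFrobenius_autE; ring.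
Qed.

(** [hm] is sesquilinear because the fifth power is additive. The target ring is arbitrary so that
    the same expansion serves ternary forms and polynomials in t. *)
Lemma hm_lin (R : comNzRingType) (c : {rmorphism k -> R}) g (x y : 'I_3 -> R) :
  (forall j, x j = \sum_i c (g i j) * y i) ->
  hm (x i0) (x i1) (x i2) = \sum_i \sum_j c (gram g i j) * (y i * y j ^+ 5).
Proof.
have cR : 5%N \in [pchar R] by rewrite (rmorph_pchar c).
move=> e; rewrite /hm [_ ^+ 6]exprSr !e !sum3 !(exp5D cR) !exprMn hm_expand /=.
have cE i j : c (gram g i j) = c (g i i0) * c (g j i2) ^+ 5 + c (g i i2) * c (g j i0) ^+ 5
    - 2%:R * (c (g i i1) * c (g j i1) ^+ 5).
  have cM a b : c (a * b ^+ 5) = c a * c b ^+ 5 by rewrite rmorphM rmorphXn.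
  by rewrite gramE rmorphB rmorphD (rmorphM c 2%:R) rmorph_nat !cM.
by rewrite !cE.
Qed.

Lemma sum_Bm (R : comNzRingType) (c : {rmorphism k -> R}) (y : 'I_3 -> R) :
  \sum_i \sum_j c (Bm i j) * (y i * y j ^+ 5) = hm (y i0) (y i1) (y i2).
Proof.
rewrite !sum3 !mxE /= rmorph0 rmorph1 rmorphN rmorph_nat /hm; ring.
Qed.

Definition U g : Prop := gram g = Bm.

Lemma gramM g h : gram (g *m h) = g *m gram h *m (map_mx Fr g)^T.
Proof. by rewrite /gram map_mxM trmx_mul !mulmxA. Qed.

Lemma U1 : U 1%:M.
Proof. by rewrite /U /gram map_mx1 trmx1 mulmx1 mul1mx. Qed.

Lemma UM g h : U g -> U h -> U (g *m h).
Proof. move=> ug uh; rewrite /U gramM uh; exact: ug. Qed.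

(** The inverse of [Bm]: modulo 5, the middle entries satisfy (-2) * 2 = 1. *)
Definition Bi : 'M[k]_3 :=
  \matrix_(i, j) (if (i + j == 2)%N then if val i is 1%N then 2%:R else 1 else 0).

Lemma BmBi : Bm *m Bi = 1%:M.
Proof.
apply/matrixP => i j; rewrite !mxE sum3 !mxE; move: i j.
apply: all3; apply: all3 => /=; rewrite ?mulr0 ?mul0r ?addr0 ?add0r ?mulr1 //.
by apply: (eq_mod5 char_k (z := -1)); rewrite /=; ring.
Qed.

Lemma Bm_unit : Bm \in unitmx.
Proof. by have [] := mulmx1_unit BmBi. Qed.

Lemma U_unit g : U g -> g \in unitmx.
Proof.
move=> ug; have : gram g *m Bi = 1%:M by rewrite ug BmBi.
by rewrite /gram -!mulmxA => /mulmx1_unit[].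
Qed.

Definition uinv g : 'M[k]_3 := Bm *m (map_mx Fr g)^T *m Bi.

Lemma U_uinv g : U g -> g *m uinv g = 1%:M.
Proof. by move=> ug; rewrite /uinv !mulmxA -/(gram g) ug BmBi. Qed.

Lemma U_invE g : U g -> invmx g = uinv g.
Proof.
move=> ug; apply: (can_inj (mulKmx (U_unit ug))).
by rewrite U_uinv // mulmxV // U_unit.
Qed.

Lemma UV g : U g -> U (invmx g).
Proof.
move=> ug; have := gramM (invmx g) g; rewrite (mulVmx (U_unit ug)) (_ : gram g = Bm) //.
by move=> h; exact: etrans (esym h) U1.
Qed.

Definition hform M : {mpoly k[3]} := hm (lf M i0) (lf M i1) (lf M i2).

Lemma hform_homog M : hform M \is 6.-homog.
Proof.
have h n j : lf M j ^+ n \is n.-homog by have := dhomogMn n (lf_homog M j); rewrite mul1n.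
apply: rpredB; first apply: rpredD.
- exact: (dhomogM (lf_homog M i0) (h 5%N i2)).
- exact: (dhomogM (h 5%N i0) (lf_homog M i2)).
by rewrite mulr_natl; apply: rpredMn; exact: h.
Qed.

Lemma hform_lin (R : comNzRingType) (F : {rmorphism {mpoly k[3]} -> R}) g M (y : 'I_3 -> R) :
  (forall j, F (lf M j) = \sum_i F (g i j)%:MP * y i) ->
  F (hform M) = \sum_i \sum_j F (gram g i j)%:MP * (y i * y j ^+ 5).
Proof.
move=> e; rewrite /hform hm_morph.
by rewrite (@hm_lin _ (F \o @mpolyC 3 k) g (fun j => F (lf M j)) y).
Qed.

Lemma hform_U g M : U g -> M \in unitmx -> hform (g *m M) = hform M.
Proof.
move=> ug uM; rewrite [RHS](@hm_lin _ (@mpolyC 3 k) g (lf M) (lf (g *m M))); last first.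
  move=> j; rewrite (lf_mul j (U_unit ug) uM); apply: eq_bigr => i _.
  by rewrite -mul_mpolyC.
by rewrite (_ : gram g = Bm) // sum_Bm.
Qed.

Lemma pb_hform_cpar g M : M \in unitmx ->
  pb (cpar (g *m M)) (hform M) = \sum_i \sum_j gram g i j *: 'X^(i + 5 * j).
Proof.
move=> uM; rewrite (@hform_lin _ (pb (cpar (g *m M))) g M (fun i => 'X^i)); last first.
  by move=> j /=; rewrite pb_cpar //; apply: eq_bigr => i _; rewrite pbC mul_polyC.
apply: eq_bigr => i _; apply: eq_bigr => j _.
by rewrite /= pbC mul_polyC -exprM -exprD mulnC.
Qed.

Lemma pb_hform_lpar g M : M \in unitmx ->
  pb (lpar (g *m M)) (hform M) =
  (gram g i0 i0)%:P + gram g i1 i0 *: 'X + gram g i0 i1 *: 'X^5 + gram g i1 i1 *: 'X^6.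
Proof.
move=> uM; rewrite (@hform_lin _ (pb (lpar (g *m M))) g M
    (fun i => if val i is 0%N then 1 else if val i is 1%N then 'X else 0)); last first.
  by move=> j /=; rewrite pb_lpar // sum3 !pbC !mul_polyC /= scaler0 addr0 alg_polyC.
rewrite !sum3 /= !pbC -!mul_polyC; ring.
Qed.

Lemma ev_hform M v (y := v *m invmx M) :
  ev (hform M) v = hm (y 0 i0) (y 0 i1) (y 0 i2).
Proof.
by rewrite /hform /ev hm_morph /= -!/(ev _ _) !ev_lf.
Qed.
End Unitary.

(* an explicit change of coordinates from [hm] to the Fermat form *)
Lemma hm_Fermat (k R : comNzRingType) (char_k : 5%N \in [pchar k]) (c : {rmorphism k -> R})
    (w : k) (x y z : R) : w ^+ 2 = 2%:R ->
  hm x y z = (c 1 * x + c 0 * y + c 3%:R * z) ^+ 6 + (c 2%:R * x + c 0 * y + c 4%:R * z) ^+ 6 +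
    (c 0 * x + c w * y + c 0 * z) ^+ 6.
Proof.
move=> wE; have cR : 5%N \in [pchar R] by rewrite (rmorph_pchar c).
have S6 (u v : R) : (u + v) ^+ 6 = (u + v) * (u ^+ 5 + v ^+ 5) by rewrite exprS (exp5D cR).
rewrite !rmorph0 rmorph1 !rmorph_nat !mul0r !addr0 !add0r mul1r !S6.
have -> : (c w * y) ^+ 6 = 2%:R ^+ 3 * y ^+ 6.
  by rewrite exprMn -(rmorphXn c 6) (exprM w 2 3) wE (rmorphXn c 3) rmorph_nat.
rewrite /hm; apply/esym/(eq_mod5 cR (z := 13%:R * x ^+ 6 + 458%:R * x * z ^+ 5 +
  26%:R * z * x ^+ 5 + 965%:R * z ^+ 6 + 2%:R * y ^+ 6)).
ring.
Qed.

(** * Bringing the Fermat form to the shape [hm] *)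

Section Existence.
Variable k : closedFieldType.
Hypothesis char_k : 5%N \in [pchar k].

Lemma root_exists n (c : k) : (0 < n)%N -> exists x, x ^+ n = c.
Proof.
move=> n0; have [x xE] := @solve_monicpoly k n (fun i => if i is 0%N then c else 0) n0.
exists x; rewrite xE (bigD1 (Ordinal n0)) //= expr0 mulr1 big1 ?addr0 // => i.
by case: i => [[|i] hi] //= _; rewrite mul0r.
Qed.

Lemma Hermitian_hform (f : {mpoly k[3]}) : is_Hermitian_curve f ->
  exists2 M : 'M[k]_3, M \in unitmx & f = hform M.
Proof.
case=> _ [N [c [uN c0 e]]].
have [d dE] := root_exists c (isT : 0 < 6)%N.
have d0 : d != 0 by apply: contraNneq c0 => d0; rewrite -dE d0 expr0n.
have [w wE] := root_exists (2%:R : k) (isT : 0 < 2)%N.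
(* The transpose appears because [linear_subst] lets a matrix act on a column of variables while
   points are rows; the sixth root [d] absorbs the constant [c] into the sixth powers. *)
pose M1 := d^-1 *: N^T.
have uM1 : M1 \in unitmx by rewrite unitmxZ ?unitmx_tr // unitfE invr_eq0.
have iM1 : invmx M1 = d *: (invmx N)^T.
  apply: (can_inj (mulmxK uM1)); rewrite mulVmx // -scalemxAl -scalemxAr scalerA mulfV //.
  by rewrite scale1r -trmx_mul mulmxV // trmx1.
have fE : f = \sum_j lf M1 j ^+ 6.
  have lE (P : 'M[k]_3) i : linear_subst P 'X_i = \sum_(j < 3) P i j *: 'X_j.
    by rewrite /linear_subst comp_mpolyXU -tnth_nth tnth_mktuple.
  pose T (P : 'M[k]_3) := [tuple \sum_(j < 3) P i j *: 'X_j | i < 3] : 3.-tuple {mpoly k[3]}.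
  have -> : f = linear_subst (invmx N) (linear_subst N f).
    apply/esym.
    apply: (@mpoly_rmorph_ext 3 _ _ (comp_mpoly (T (invmx N)) \o comp_mpoly (T N)) idfun) => [b|i].
      by rewrite /= !comp_mpolyC.
    rewrite /= (lE N i : 'X_i \mPo T N = _) raddf_sum /=.
    rewrite (eq_bigr (fun j => \sum_l (N i j * invmx N j l) *: 'X_l)).
      rewrite exchange_big; transitivity (\sum_l (1%:M : 'M[k]_3) i l *: ('X_l : {mpoly k[3]})).
        by apply: eq_bigr => l _; rewrite -scaler_suml -(mulmxV uN) mxE.
      rewrite (bigD1 i) //= mxE eqxx scale1r big1 ?addr0 // => l li.
      by rewrite mxE eq_sym (negPf li) scale0r.
    move=> j _; rewrite comp_mpolyZ (lE (invmx N) j : 'X_j \mPo T (invmx N) = _).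
    by rewrite scaler_sumr; apply: eq_bigr => l _; rewrite scalerA.
  rewrite e /linear_subst comp_mpolyZ /fermat_sextic (raddf_sum (comp_mpoly (T (invmx N)))).
  rewrite scaler_sumr; apply: eq_bigr => j _.
  rewrite /= rmorphXn /= (lE (invmx N) j : 'X_j \mPo T (invmx N) = _) -dE -exprZn; congr (_ ^+ 6).
  rewrite scaler_sumr; apply: eq_bigr => i _.
  by rewrite iM1 !mxE scalerA.
(* The columns of [W] are the three linear forms of [hm_Fermat]. *)
pose W : 'M[k]_3 := \matrix_i (if val i is 0%N then row3 1 2%:R 0 else
   if val i is 1%N then row3 0 0 w else row3 3%:R 4%:R 0).
have uW : W \in unitmx.
  have : W *m (\matrix_i (if val i is 0%N then row3 3%:R 0 1 else
   if val i is 1%N then row3 4%:R 0 2%:R else row3 0 w^-1 0)) = 1%:M.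
  have w0 : w != 0.
    apply/negP => /eqP w0; move: wE; rewrite w0 expr0n /= => h.
    have e1 : 1 = - (2%:R * 2%:R) :> k by apply: (eq_mod5 char_k (z := 1)); ring.
    by have := oner_neq0 k; rewrite e1 -h mul0r oppr0 eqxx.
    apply/matrixP => i j; rewrite !mxE sum3 !mxE; move: i j.
    have z5 (x y z : k) : x = y + 5%:R * z -> x = y by exact: eq_mod5.
    apply: all3; apply: all3; rewrite /= !row3E ?(mulr0, mul0r, addr0, add0r, mulr1, mul1r) ?mulfV //.
    - by apply: (z5 _ _ 2%:R); ring.
    - by apply: (z5 _ _ 1); ring.
    - by apply: (z5 _ _ 5%:R); ring.
    - by apply: (z5 _ _ 2%:R); ring.
  by case/mulmx1_unit.
exists (W *m M1); first by rewrite unitmx_mul uW.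
have cR : 5%N \in [pchar {mpoly k[3]}] by rewrite (rmorph_pchar (@mpolyC 3 k)).
rewrite fE sum3 !(lf_mul _ uW uM1) !sum3 !mxE /= ?row3E.
set y0 := lf _ _; set y1 := lf _ _; set y2 := lf _ _.
rewrite -!mul_mpolyC; exact/esym/(hm_Fermat char_k (@mpolyC 3 k) y0 y1 y2 wE).
Qed.
End Existence.

Lemma row_neq0 (k : fieldType) (M : 'M[k]_3) (v : 'rV[k]_3) :
  M \in unitmx -> v != 0 -> v *m M != 0.
Proof. by move=> uM; apply: contraNneq => h; rewrite -(mulmxK uM v) h mul0mx. Qed.

(** Being an equivalence in [n], this also excludes every other cardinality, so the cardinality
    conditions in the definitions turn into equations between numbers. *)
Lemma card_image_seq (T : Type) (I : eqType) (F : I -> T) (s : seq I) (A : set T) :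
  uniq s -> {in s &, injective F} -> (forall x, A x <-> exists2 i, i \in s & x = F i) ->
  forall n, A #= `I_n <-> n = size s.
Proof.
move=> us inj hA n.
have cs : A #= `I_(size s).
  case: s us inj hA => [|x0 s] us inj hA.
    rewrite (_ : A = set0) ?II0 ?card_eq00 //; apply/seteqP; split=> x // /hA[i].
    by rewrite in_nil.
  pose G i := F (nth x0 (x0 :: s) i).
  rewrite (_ : A = G @` `I_(size (x0 :: s))).
    apply: inj_card_eq => i j; rewrite !inE /= => hi hj /inj h.
    apply/eqP; rewrite -(@nth_uniq _ x0 (x0 :: s)) //; apply/eqP.
    by apply: h; rewrite mem_nth.
  apply/seteqP; split=> x.
    move=> /hA[y ys ->]; exists (index y (x0 :: s)); first by rewrite -index_mem in ys.
    by rewrite /G nth_index.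
  by case=> i /= hi <-; apply/hA; exists (nth x0 (x0 :: s) i) => //; rewrite mem_nth.
split=> [h|->] //; apply/card_eq_II.
exact: card_eq_trans (card_esym h) cs.
Qed.

(** * Totally tangent conics *)

Section Conics.
Variable k : closedFieldType.
Hypothesis char_k : 5%N \in [pchar k].
Implicit Types (C M g : 'M[k]_3) (v : 'rV[k]_3) (o : option k).

(* [option k] is the projective line, with [None] the point at infinity *)
Definition npt o : 'rV[k]_3 := if o is Some a then row3 1 a (a ^+ 2) else row3 0 0 1.

Lemma npt_neq0 o : npt o != 0.
Proof.
apply/eqP => /rowP h; move/eqP: (h i0); move/eqP: (h i2).
by case: o h => [a|] h; rewrite /npt !row3E !mxE ?oner_eq0.
Qed.

Lemma npt_prop o o' (c : k) : npt o = c *: npt o' -> o = o'.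
Proof.
move=> /rowP h; move: (h i0) (h i1) (h i2); rewrite /npt.
case: o {h} => [a|]; case: o' => [b|]; rewrite !mxE /= ?mulr1 ?mulr0 //.
- by move=> <-; rewrite mul1r => ->.
- by move=> /eqP; rewrite oner_eq0.
- by move=> <- _; rewrite mul0r => /eqP; rewrite oner_eq0.
Qed.

Definition Qs M : set (P2 k) := [set P | exists o, P = pt (npt o *m M)].

Lemma pt_mul_eq M v w : M \in unitmx -> v != 0 -> w != 0 ->
  pt (v *m M) = pt (w *m M) <-> pt v = pt w.
Proof.
move=> uM v0 w0; split.
  move/(pt_eq (row_neq0 uM v0) (row_neq0 uM w0)) => [c c0 e].
  by apply/(pt_eq v0 w0); exists c => //; apply: (can_inj (mulmxK uM)); rewrite -scalemxAl.
case/(pt_eq v0 w0) => c c0 ->; rewrite -scalemxAl ptZ //; exact: row_neq0.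
Qed.

Lemma Qs_inj M o o' : M \in unitmx -> pt (npt o *m M) = pt (npt o' *m M) -> o = o'.
Proof.
move=> uM /(pt_mul_eq uM (npt_neq0 o) (npt_neq0 o')) /(pt_eq (npt_neq0 o) (npt_neq0 o')).
by case=> c _; exact: npt_prop.
Qed.

Definition q0 v : k := v 0 i1 ^+ 2 - v 0 i0 * v 0 i2.

Lemma q0_npt o : q0 (npt o) = 0.
Proof. by rewrite /q0 /npt; case: o => [a|]; rewrite !row3E ?mul1r ?subrr // expr0n mul0r subr0. Qed.

Lemma q0Z c v : q0 (c *: v) = c ^+ 2 * q0 v.
Proof. by rewrite /q0 !mxE; ring. Qed.

Lemma q0P v : v != 0 -> q0 v = 0 -> exists o, exists2 c, c != 0 & v = c *: npt o.
Proof.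
move=> v0 /eqP; rewrite subr_eq0 => /eqP e.
have [v00|v00] := eqVneq (v 0 i0) 0.
  have v01 : v 0 i1 = 0 by apply/eqP; move/eqP: e; rewrite v00 mul0r expf_eq0 => /andP[].
  exists None, (v 0 i2); last first.
    by rewrite [LHS]row3_eta v00 v01; apply/rowP; apply: all3; rewrite !mxE /= ?mulr0 ?mulr1.
  by apply: contraNneq v0 => v02; rewrite [v]row3_eta v00 v01 v02; apply/eqP/rowP; apply: all3; rewrite !mxE.
exists (Some (v 0 i1 / v 0 i0)), (v 0 i0) => //.
rewrite [LHS]row3_eta; apply/rowP; apply: all3; rewrite !mxE /= ?mulr1 //.
  by rewrite mulrCA mulfV ?mulr1.
by rewrite expr_div_n e exprSr expr1; field.
Qed.

Lemma Qs_ptE M v : M \in unitmx -> v != 0 -> Qs M (pt (v *m M)) <-> q0 v = 0.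
Proof.
move=> uM v0; split.
  case=> o /(pt_mul_eq uM v0 (npt_neq0 o)) /(pt_eq v0 (npt_neq0 o)) [c _ ->].
  by rewrite q0Z q0_npt mulr0.
by move=> /(q0P v0)[o [c c0 ->]]; exists o; rewrite -scalemxAl ptZ // row_neq0 // npt_neq0.
Qed.

Lemma zeros_conic M c : M \in unitmx -> c != 0 -> zeros (c *: conic M) = Qs M.
Proof.
move=> uM c0; apply/seteqP; split=> P; rewrite (ptE P) -[co P](mulmxKV uM);
  set v := co P *m invmx M; have v0 : v != 0 by rewrite row_neq0 ?unitmx_inv ?co_neq0.
  move=> /(zeros_pt (rpredZ c (conic_homog M)) (row_neq0 uM v0)).
  rewrite /ev mevalZ -/(ev _ _) ev_conic mulmxK // -/(q0 v) => /eqP.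
  by rewrite mulf_eq0 (negPf c0) => /eqP h; apply/Qs_ptE.
move=> /(Qs_ptE uM v0) h; apply/(zeros_pt (rpredZ c (conic_homog M)) (row_neq0 uM v0)).
by rewrite /ev mevalZ -/(ev _ _) ev_conic mulmxK // -/(q0 v) h mulr0.
Qed.

(* reparametrisations of the conic carrying the parameter [Some 0] to [o] *)
Definition tr o : 'M[k]_3 :=
  \matrix_i (if o is Some a then
      if val i is 0%N then row3 1 a (a ^+ 2) else if val i is 1%N then row3 0 1 (2%:R * a)
      else row3 0 0 1
    else row3 (val i == 2%N)%:R (val i == 1%N)%:R (val i == 0%N)%:R).

Lemma row_tr o : row i0 (tr o) = npt o.
Proof. by rewrite rowK; case: o. Qed.

Lemma q0_tr o v : q0 (v *m tr o) = q0 v.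
Proof. rewrite /q0 !mxE !sum3 !mxE.
by case: o => [a|] /=; rewrite !row3E; ring. Qed.

Lemma tr_unit o : tr o \in unitmx.
Proof.
case: o => [a|].
  suff : tr (Some a) *m tr (Some (- a)) = 1%:M by case/mulmx1_unit.
  by apply/matrixP => i j; rewrite !mxE !sum3 !mxE; move: i j;
    apply: all3; apply: all3; rewrite /= ?row3E; ring.
suff : tr None *m tr None = 1%:M by case/mulmx1_unit.
by apply/matrixP => i j; rewrite !mxE !sum3 !mxE; move: i j;
    apply: all3; apply: all3; rewrite /= ?row3E; ring.
Qed.

Lemma Qs_tr o M : M \in unitmx -> Qs (tr o *m M) = Qs M.
Proof.
move=> uM; have ut := tr_unit o; have uoM : tr o *m M \in unitmx by rewrite unitmx_mul ut.
apply/seteqP; split=> P; rewrite (ptE P) -[co P](mulmxKV uoM);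
  set v := co P *m _; have v0 : v != 0 by rewrite row_neq0 ?unitmx_inv ?co_neq0.
  by move/(Qs_ptE uoM v0) => h; rewrite mulmxA; apply/(Qs_ptE uM (row_neq0 ut v0)); rewrite q0_tr.
rewrite {1}mulmxA => /(Qs_ptE uM (row_neq0 ut v0)); rewrite q0_tr => h.
exact/Qs_ptE.
Qed.

Lemma QsZ c M : M \in unitmx -> c != 0 -> Qs (c *: M) = Qs M.
Proof.
move=> uM c0; apply/seteqP; split=> P [o ->]; exists o.
  by rewrite -scalemxAr ptZ // row_neq0 ?npt_neq0.
by rewrite -scalemxAr ptZ // row_neq0 ?npt_neq0.
Qed.

Lemma conic_tr o M : M \in unitmx -> conic (tr o *m M) = conic M.
Proof.
move=> uM; rewrite /conic !(lf_mul _ (tr_unit o) uM) !sum3 !mxE.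
case: o => [a|] /=; rewrite !row3E -!mul_mpolyC ?(rmorphM, rmorphXn, rmorph0, rmorph1, rmorph_nat); ring.
Qed.

End Conics.

(** * The pulled back Hermitian form and its double roots *)

Section Square.
Variable k : fieldType.
Hypothesis char_k : 5%N \in [pchar k].
Local Notation Bm := (Bm k).

(* the pullback of the Hermitian form with Gram matrix [G] to the conic *)
Definition Fp (G : 'M[k]_3) : {poly k} := \sum_i \sum_j G i j *: 'X^(i + 5 * j).

Lemma coef_Fp G (n : nat) : (Fp G)`_n =
  if (n < 15)%N && (n %% 5 < 3)%N then G (inord (n %% 5)) (inord (n %/ 5)) else 0.
Proof.
have i0E : inord 0 = i0 by apply: val_inj; rewrite /= inordK.
have i1E : inord 1 = i1 by apply: val_inj; rewrite /= inordK.
have i2E : inord 2 = i2 by apply: val_inj; rewrite /= inordK.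
rewrite /Fp !sum3 !coefD !coefZ !coefXn /=.
do 15?[case: n => [|n]; first by rewrite /= ?i0E ?i1E ?i2E !(mulr0, mulr1, addr0, add0r)].
by rewrite /= !(mulr0, addr0).
Qed.

Lemma Fp_derivn3 G : (Fp G)^`(3) = 0.
Proof.
apply/polyP => m; rewrite coef_derivn coef0 coef_Fp; set n := (3 + m)%N.
case: ifP => [/andP[_ n5]|_]; last by rewrite mul0rn.
rewrite -mulr_natr; suff -> : (n ^_ 3)%:R = 0 :> k by rewrite mulr0.
apply/eqP; rewrite -(dvdn_pcharf char_k) ffactnS ffactnS ffactn1 (divn_eq n 5).
move: (n %/ 5)%N (n %% 5)%N n5 => q [|[|[|//]]] _; rewrite ?addn0.
- by rewrite dvdn_mulr // dvdn_mull.
- by rewrite addn1 /= dvdn_mull // dvdn_mulr // dvdn_mull.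
- by rewrite addn2 /= dvdn_mull // dvdn_mull // dvdn_mull.
Qed.

Lemma Fp_neq0 (G : 'M[k]_3) : G != 0 -> Fp G != 0.
Proof.
apply: contraNneq => F0; apply/eqP/matrixP => i j; rewrite mxE.
have := coef_Fp G (i + 5 * j); rewrite F0 coef0 mulnC addnC.
have lt5 : (i < 5)%N by apply: ltn_trans (ltn_ord i) _.
rewrite modnMDl modn_small // divnMDl // divn_small // addn0.
have -> : (j * 5 + i < 15)%N.
  by case: j => [[|[|[|//]]] hj] /=; rewrite ?mul0n ?mul1n ?add0n; case: i lt5 => [[|[|[|//]]]].
by rewrite ltn_ord /= !inord_val => <-.
Qed.

(** [G i1 i2] and [G i2 i2] are the coefficients of t^11 and t^12: their vanishing is the double
    root at infinity and leaves degree at most 10, so five finite double roots make the form a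
    constant times g^2. *)
Lemma Fp_square (G : 'M[k]_3) (s : seq k) : uniq s -> size s = 5%N -> 0 \in s -> 1 \in s ->
  G != 0 -> G i1 i2 = 0 -> G i2 i2 = 0 ->
  (forall a, a \in s -> root (Fp G) a /\ root (Fp G)^`() a) ->
  exists2 c, c != 0 & G = c *: Bm.
Proof.
move=> us ss s0 s1 G0 G12 G22 hs; have F0 := Fp_neq0 G0; set F := Fp G in hs F0 *.
have sF : (size F <= 11)%N.
  apply/leq_sizeP => n hn; rewrite coef_Fp.
  have i1E : inord 1 = i1 by apply: val_inj; rewrite /= inordK.
  have i2E : inord 2 = i2 by apply: val_inj; rewrite /= inordK.
  do 11?[case: n hn => [//|n] hn].
  case: n {hn} => [|n]; first by rewrite /= i1E i2E G12.
  case: n => [|n]; first by rewrite /= i2E G22.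
  by case: n => [|[|n]].
pose g := \prod_(a <- s) ('X - a%:P).
have sg : size g = 6%N by rewrite size_prod_XsubC ss.
have mg : g \is monic by apply: monic_prod_XsubC.
have g0 : g != 0 := monic_neq0 mg.
have rg a : root g a = (a \in s) by rewrite root_prod_XsubC.
have sep : coprimep g g^`() by have := separable_prod_XsubC s; rewrite us separable_poly.unlock.
have us' : uniq_roots s by rewrite uniq_rootsE.
have g_dvd p : (forall a, a \in s -> root p a) -> g %| p.
  by move=> h; apply: uniq_roots_dvdp => //; apply/allP.
have /dvdpP[h FE] : g %| F by apply: g_dvd => a /hs[].
have /dvdpP[h2 hE] : g %| h.
  apply: g_dvd => a sa; have [_ rF'] := hs a sa.
  move: rF'; rewrite FE derivM rootE hornerD !hornerM.
  have /eqP-> : g.[a] == 0 by rewrite -[_ == _]/(root g a) rg.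
  rewrite mulr0 add0r mulf_eq0 => /orP[//|g'a].
  by have := coprimep_root sep (etrans (rg a) sa); rewrite (eqP g'a) eqxx.
have FE2 : F = h2 * g ^+ 2 by rewrite FE hE -mulrA expr2.
have h20 : h2 != 0 by apply: contraNneq F0 => h0; rewrite FE2 h0 mul0r.
have /size_poly1P[c c0 h2E] : size h2 == 1%N.
  move: sF; rewrite FE2 expr2 size_mul ?mulf_neq0 // size_mul // sg eqn_leq lt0n size_poly_eq0 h20.
  by rewrite andbT addnS /= addnC; rewrite (leq_add2l 10 _ 1).
have FE3 : F = c *: g ^+ 2 by rewrite FE2 h2E mul_polyC.
(* Modulo 5 the factor 6 is 1, so g divides g' g''. As g is separable it divides g'', whose degree
   is smaller. *)
have d3 : g * g^`(3) *+ 2 + g^`() * g^`(2) *+ 6 = 0.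
  have := Fp_derivn3 G; rewrite -/F FE3 derivnZ => /eqP; rewrite scaler_eq0 (negPf c0) /= => /eqP <-.
  by rewrite /= expr2 !derivE; ring.
have g2 : g^`(2) = 0.
  apply/eqP/negPn/negP => gn0.
  have : g %| g^`(2).
    rewrite -(Gauss_dvdpr _ sep).
    have -> : g^`() * g^`(2) = g * (- (g^`(3) *+ 2)) + 5%:R *  - (g^`() * g^`(2)).
      by rewrite -[LHS]subr0 -d3; ring.
    by rewrite (five0 _) ?mul0r ?addr0 ?dvdp_mulr // (rmorph_pchar (@polyC k)).
  move/(dvdp_leq gn0); rewrite sg leqNgt; move/negP; apply.
  have g'0 : g^`() != 0 by apply: contraNneq gn0 => e'; rewrite derivnS derivn1 e' deriv0.
  have h1 := lt_size_deriv g0; rewrite sg in h1.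
  by rewrite derivnS derivn1; exact: ltn_trans (lt_size_deriv g'0) h1.
(* The equation g'' = 0 kills the coefficients of t^2, t^3 and t^4 and spares that of t^5, since 5 *
   4 = 0. The roots 0 and 1 then determine the other two. *)
have gn n : g`_n.+2 *+ n.+2 *+ n.+1 = 0.
  by have := congr1 (fun p : {poly k} => p`_n) g2; rewrite derivnS derivn1 !coef_deriv coef0.
have unit_nat m x : (m%:R != 0 :> k) -> x *+ m = 0 -> x = 0 :> k.
  by move=> m0 /eqP; rewrite -mulr_natr mulf_eq0 (negPf m0) orbF => /eqP.
have nz m : ~~ (5 %| m)%N -> m%:R != 0 :> k by rewrite -(dvdn_pcharf char_k).
have g2' : g`_2 = 0 by have := gn 0%N; rewrite mulr1n; apply: unit_nat; exact: nz.
have g3' : g`_3 = 0 by have := gn 1%N; rewrite -mulrnA; apply: unit_nat; exact: nz.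
have g4' : g`_4 = 0 by have := gn 2%N; rewrite -mulrnA; apply: unit_nat; exact: nz.
have g5' : g`_5 = 1 by have := monicP mg; rewrite lead_coefE sg.
have g0' : g`_0 = 0 by rewrite -horner_coef0; apply/eqP; have := rg 0; rewrite s0.
have g1' : g`_1 = -1.
  have : root g 1 by rewrite rg.
  rewrite rootE (horner_coef_wide _ (eq_leq sg)) !big_ord_recr big_ord0 /=.
  by rewrite g0' g2' g3' g4' g5' !expr1n !mulr1 !(addr0, add0r) addr_eq0 => /eqP.
have gE : g = 'X^5 - 'X.
  apply/polyP => n; rewrite coefB coefXn coefX.
  do 6?[case: n => [|n]; first by rewrite /= ?g0' ?g1' ?g2' ?g3' ?g4' ?g5' ?subr0 ?sub0r].
  by rewrite nth_default ?sg //= subr0.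
exists c => //; apply/matrixP => i j.
have FE4 : F = c *: ('X^10 - 2%:R *: 'X^6 + 'X^2).
  by rewrite FE3 gE -!mul_polyC; congr (_ * _); rewrite rmorph_nat; ring.
have e n : F`_n = c * ((n == 10)%:R - 2%:R * (n == 6)%:R + (n == 2)%:R).
  by rewrite FE4 coefZ coefD coefB coefZ !coefXn.
have := e (i + 5 * j)%N; rewrite /F /Fp !sum3 !coefD !coefZ !coefXn !mxE.
by move: i j; apply: all3; apply: all3 => /= eqn; apply: etrans _ (etrans eqn _); ring.
Qed.
End Square.

(** * Normal form of a nonsingular conic with three marked points *)

Section QuadraticForms.
Variable k : closedFieldType.
Hypothesis two0 : (2%:R : k) != 0.
Implicit Types (q : {mpoly k[3]}) (S C : 'M[k]_3) (v w : 'rV[k]_3).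

Lemma mdegS_split n (m : 'X_{1..n}) d : mdeg m = d.+1 ->
  exists i m', m = (U_(i) + m')%MM /\ mdeg m' = d.
Proof.
move=> dm; have [i mi] : exists i, m i != 0%N.
  apply: contra_eqP dm => h; rewrite mdegE big1 // => i _.
  by apply/eqP; apply: contrapT => /negP hi; apply: h; exists i.
have le : (U_(i) <= m)%MM.
  by apply/mnm_lepP => j; rewrite mnm1E; case: eqP => // <-; rewrite lt0n.
exists i, (m - U_(i))%MM; rewrite addmC submK //; split=> //.
by apply/eqP; rewrite -eqSS -dm -{2}(submK le) mdegD mdeg1 addn1.
Qed.

Lemma quadratic_form q : q \is 2.-homog -> exists2 S, S^T = S &
  q = \sum_i \sum_j S i j *: ('X_i * 'X_j).
Proof.
move=> hq; pose R q := exists2 S, S^T = S & q = \sum_i \sum_j S i j *: ('X_i * 'X_j).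
have RD p1 p2 : R p1 -> R p2 -> R (p1 + p2).
  move=> [S1 s1 ->] [S2 s2 ->]; exists (S1 + S2); first by rewrite linearD /= s1 s2.
  rewrite -big_split; apply: eq_bigr => i _; rewrite -big_split; apply: eq_bigr => j _ /=.
  by rewrite mxE scalerDl.
have RZ c p : R p -> R (c *: p).
  move=> [S s ->]; exists (c *: S); first by rewrite linearZ /= s.
  rewrite scaler_sumr; apply: eq_bigr => i _; rewrite scaler_sumr; apply: eq_bigr => j _ /=.
  by rewrite mxE scalerA.
have R0 : R 0.
  exists 0; first by rewrite trmx0.
  by rewrite big1 // => i _; rewrite big1 // => j _; rewrite mxE scale0r.
have RX i j : R ('X_i * 'X_j).
  exists (2%:R^-1 *: (delta_mx i j + delta_mx j i)).
    by rewrite linearZ linearD /= !trmx_delta addrC.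
  apply: (scalerI two0).
  rewrite scaler_sumr; under eq_bigr => a _ do rewrite scaler_sumr.
  under eq_bigr => a _ do under eq_bigr => b _ do
    rewrite !mxE scalerA mulrA mulfV // mul1r scalerDl.
  under eq_bigr => a _ do rewrite big_split /=.
  rewrite big_split /=.
  have D (x y : 'I_3) : \sum_(a < 3) \sum_(b < 3) ((a == x) && (b == y))%:R *: ('X_a * 'X_b)
     = 'X_x * 'X_y :> {mpoly k[3]}.
    rewrite (bigD1 x) //= [X in _ + X]big1 ?addr0; last first.
      by move=> a /negPf h; rewrite big1 // => b _; rewrite h scale0r.
    rewrite (bigD1 y) //= !eqxx scale1r big1 ?addr0 // => b /negPf h.
    by rewrite h scale0r.
  by rewrite !D scaler_nat mulr2n (mulrC 'X_j).
rewrite [q]mpolyE big_seq -/(R _); apply: (big_ind R) => [||m]; [exact: R0|exact: RD|].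
move/dhomogP: hq => hq /hq /= /mdegS_split[i [m1 [-> /mdegS_split[j [m2 [-> /eqP]]]]]].
rewrite mdeg_eq0 => /eqP ->; apply: RZ; rewrite addm0 mpolyXD; exact: RX.
Qed.

Definition bil S v w : k := (v *m S *m w^T) 0 0.

Lemma bilC S v w : S^T = S -> bil S v w = bil S w v.
Proof.
move=> sS; rewrite /bil (_ : v *m S *m w^T = (w *m S *m v^T)^T) ?mxE //.
by rewrite !trmx_mul trmxK sS mulmxA.
Qed.

Lemma bilDl S v w u : bil S (v + w) u = bil S v u + bil S w u.
Proof. by rewrite /bil !mulmxDl mxE. Qed.
Lemma bilZl S c v w : bil S (c *: v) w = c * bil S v w.
Proof. by rewrite /bil -!scalemxAl mxE. Qed.
Lemma bilZr S c v w : bil S v (c *: w) = c * bil S v w.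
Proof. by rewrite /bil linearZ -!scalemxAr mxE. Qed.

Lemma bilE S v w : bil S v w = \sum_i \sum_j S i j * (v 0 i * w 0 j).
Proof.
rewrite /bil mxE exchange_big; apply: eq_bigr => j _; rewrite !mxE mulr_suml.
by apply: eq_bigr => i _; ring.
Qed.

Lemma form_change C S : C \in unitmx ->
  \sum_i \sum_j S i j *: ('X_i * 'X_j) =
  \sum_a \sum_b bil S (row a C) (row b C) *: (lf C a * lf C b) :> {mpoly k[3]}.
Proof.
move=> uC.
transitivity (\sum_i \sum_j \sum_a \sum_b
  (S i j * (C a i * C b j)) *: (lf C a * lf C b)).
  apply: eq_bigr => i _; apply: eq_bigr => j _.
  rewrite [X in X * _](X_lf i uC) [X in _ * X](X_lf j uC) mulr_suml scaler_sumr.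
  apply: eq_bigr => a _; rewrite mulr_sumr scaler_sumr; apply: eq_bigr => b _.
  by rewrite -scalerAl -scalerAr !scalerA mulrA.
under eq_bigr => i _ do rewrite exchange_big /=.
rewrite exchange_big /=; apply: eq_bigr => a _.
under eq_bigr => i _ do rewrite exchange_big /=.
rewrite exchange_big /=; apply: eq_bigr => b _.
rewrite bilE scaler_suml; apply: eq_bigr => i _; rewrite scaler_suml.
by apply: eq_bigr => j _; rewrite !mxE.
Qed.

Lemma ev_form S v : ev (\sum_i \sum_j S i j *: ('X_i * 'X_j)) v = bil S v v.
Proof.
rewrite bilE /ev raddf_sum; apply: eq_bigr => i _; rewrite raddf_sum; apply: eq_bigr => j _ /=.
by rewrite mevalZ mevalM !mevalXU.
Qed.

Lemma deriv_form S v l : S^T = S ->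
  ev ((\sum_i \sum_j S i j *: ('X_i * 'X_j))^`M(l)) v = 2%:R * (v *m S) 0 l.
Proof.
move=> sS; have S_sym i j : S i j = S j i by rewrite -{1}sS mxE.
rewrite /ev (raddf_sum (mderiv l)) (raddf_sum (meval _)).
transitivity (\sum_i \sum_j S i j * ((i == l)%:R * v 0 j + v 0 i * (j == l)%:R)).
  apply: eq_bigr => i _; rewrite (raddf_sum (mderiv l)) (raddf_sum (meval _)); apply: eq_bigr => j _ /=.
  by rewrite mderivZ mevalZ mderivM !mderivXU mevalD !mevalM !mevalXU !rmorph_nat.
under eq_bigr => i _ do under eq_bigr => j _ do rewrite mulrDr.
under eq_bigr => i _ do rewrite big_split /=.
rewrite big_split /= (bigD1 l) //= [X in _ + X + _]big1 ?addr0 => [|i /negPf il]; last first.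
  by rewrite big1 // => j _; rewrite il mul0r mulr0.
rewrite mulr2n mulrDl mul1r mxE; congr (_ + _); apply: eq_bigr => i _.
  by rewrite eqxx mul1r mulrC S_sym.
rewrite (bigD1 l) //= eqxx mulr1 big1 ?addr0 1?mulrC // => j /negPf jl.
by rewrite jl mulr0 mulr0.
Qed.

(** A nonzero kernel vector of [S] would be a point of the conic, and the partial derivatives there,
    twice the entries of [v *m S], would all vanish. *)
Lemma nonsingular_unit S : S^T = S ->
  nonsingular (\sum_i \sum_j S i j *: ('X_i * 'X_j)) -> S \in unitmx.
Proof.
move=> sS ns; rewrite -row_free_unit; apply: inj_row_free => v vS; apply/eqP; apply: contraT => v0.
have hq : (\sum_i \sum_j S i j *: ('X_i * 'X_j) : {mpoly k[3]}) \is 2.-homog.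
  apply: rpred_sum => i _; apply: rpred_sum => j _; apply: rpredZ.
  by apply: (dhomogM (d := 1) (e := 1)); rewrite dhomogX /= mdeg1.
have [|l] := ns (pt v).
  by apply/(zeros_pt hq v0); rewrite ev_form /bil vS mul0mx mxE.
have [c c0 e] := co_pt v0.
rewrite -[X in X != 0]/(ev _ (co (pt v))) e deriv_form // -scalemxAl vS scaler0 mxE mulr0.
by rewrite eqxx.
Qed.

(** The first two points give isotropic vectors [v0], [v1] spanning a hyperbolic plane, and [w]
    spans its orthogonal. In the basis [v0], [w], [v1] the form is a y1^2 + b y0 y2; scaling the
    basis so that the third point becomes (1 : 1 : 1) forces b = -a. *)
Lemma conic_through q Pa Pb Pc : q \is 2.-homog -> nonsingular q ->
  zeros q Pa -> zeros q Pb -> zeros q Pc -> Pa <> Pb -> Pa <> Pc -> Pb <> Pc ->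
  exists C a, [/\ C \in unitmx, a != 0, q = a *: conic C &
   [/\ Pa = pt (npt (Some 0) *m C), Pb = pt (npt None *m C) & Pc = pt (npt (Some 1) *m C)]].
Proof.
move=> hq; have [S sS qE] := quadratic_form hq; rewrite qE => ns.
have uS := nonsingular_unit sS ns.
have zE P : zeros (\sum_i \sum_j S i j *: ('X_i * 'X_j)) P -> bil S (co P) (co P) = 0.
  by rewrite -ev_form.
move=> /zE h0 /zE h1 /zE h2 n01 n02 n12.
set v0 := co Pa in h0; set v1 := co Pb in h1; set v2 := co Pc in h2.
have npr (P P' : P2 k) (c : k) : P <> P' -> c *: co P' <> co P.
  move=> nP e; apply: nP; rewrite (ptE P) -e ptZ ?co_neq0 -?ptE //.
  by apply: contraTneq (co_neq0 P) => c0; rewrite -e c0 scale0r eqxx.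
have comb0 a b : a *: v0 + b *: v1 = 0 -> a = 0 /\ b = 0.
  move=> e; have [a0|a0] := eqVneq a 0.
    move: e; rewrite a0 scale0r add0r => /eqP.
    by rewrite scaler_eq0 (negPf (co_neq0 _)) orbF => /eqP.
  case: (npr Pa Pb (- (b / a)) n01); apply: (scalerI a0).
  by rewrite scalerA mulrN mulrCA mulfV // mulr1 scaleNr; apply/esym/eqP; rewrite -addr_eq0 e.
pose V := col_mx v0 v1.
have rV : \rank V = 2%N.
  apply/eqP; rewrite -/(row_free _); apply: inj_row_free => x.
  rewrite -[x]hsubmxK mul_row_col [lsubmx x]mx11_scalar [rsubmx x]mx11_scalar !mul_scalar_mx.
  by case/comb0 => -> ->; rewrite !raddf0 row_mx0.
(* Otherwise [v0] and [v1] span a totally isotropic plane of a nondegenerate form in dimension 3,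
   and the rank bound would give 2 + 2 <= 3. *)
have b01 : bil S v0 v1 != 0.
  apply/eqP => b0; have : V *m S *m V^T = 0.
    rewrite mul_col_mx tr_col_mx mul_col_row.
    have bz u w : bil S u w = 0 -> u *m S *m w^T = 0.
      by move=> e; rewrite [LHS]mx11_scalar -/(bil S u w) e raddf0.
    by rewrite !bz ?(bilC v1 v0 sS) // block_mx0.
  move/mulmx0_rank_max; rewrite mxrank_tr mxrankMfree ?row_free_unit // rV.
  by [].
have [w [w0 wv0 wv1]] : exists w, [/\ w != 0, bil S w v0 = 0 & bil S w v1 = 0].
  have : kermx (S *m V^T) != 0.
    rewrite -mxrank_eq0 mxrank_ker subn_eq0 -ltnNge.
    by apply: leq_ltn_trans (mxrankM_maxr _ _) _; rewrite mxrank_tr rV.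
  case/rowV0Pn => w /sub_kermxP; rewrite mulmxA /V tr_col_mx mul_mx_row => /eqP.
  rewrite row_mx_eq0 => /andP[/eqP e0 /eqP e1] w0; exists w.
  by rewrite /bil e0 e1 !mxE.
pose T : 'M[k]_3 := \matrix_i (if val i is 0%N then v0 else if val i is 1%N then w else v1).
have TE x : x *m T = x 0 i0 *: v0 + x 0 i1 *: w + x 0 i2 *: v1.
  by rewrite mulmx_sum_row sum3 !rowK.
have uT : T \in unitmx.
  rewrite -row_free_unit; apply: inj_row_free => x; rewrite TE => e.
  have x2 : x 0 i2 = 0.
    have := congr1 (fun u => bil S u v0) e; rewrite !bilDl !bilZl h0 wv0 !mulr0 !add0r.
    rewrite (bilC v1 v0 sS) [bil S 0 _]/bil !mul0mx mxE => /eqP.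
    by rewrite mulf_eq0 (negPf b01) orbF => /eqP.
  have x0 : x 0 i0 = 0.
    have := congr1 (fun u => bil S u v1) e; rewrite !bilDl !bilZl h1 wv1 !mulr0 !addr0.
    rewrite [bil S 0 _]/bil !mul0mx mxE => /eqP.
    by rewrite mulf_eq0 (negPf b01) orbF => /eqP.
  move/eqP: e; rewrite x0 x2 !scale0r add0r addr0 scaler_eq0 (negPf w0) orbF => /eqP x1.
  by rewrite [x]row3_eta x0 x1 x2; apply/rowP; apply: all3; rewrite !mxE.
have ww : bil S w w != 0.
  apply/eqP => bw; have : w *m S *m T^T = 0.
    apply/rowP => i; transitivity (bil S w (row i T)).
      by rewrite /bil mxE [RHS]mxE; apply: eq_bigr => j _; congr (_ * _); rewrite !mxE.
    by rewrite mxE; move: i; apply: all3; rewrite rowK.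
  move/(congr1 (mulmx^~ (invmx T^T))); rewrite mulmxK ?unitmx_tr // mul0mx.
  move/(congr1 (mulmx^~ (invmx S))); rewrite mulmxK // mul0mx => e.
  by rewrite e eqxx in w0.
set x := v2 *m invmx T; have v2E : v2 = x 0 i0 *: v0 + x 0 i1 *: w + x 0 i2 *: v1.
  by rewrite -TE mulmxKV.
have q2 : x 0 i1 ^+ 2 * bil S w w + 2%:R * x 0 i0 * x 0 i2 * bil S v0 v1 = 0.
  have bCw a := bilC w a sS; have b10 := bilC v1 v0 sS.
  have bDr u a b : bil S u (a + b) = bil S u a + bil S u b.
    by rewrite (bilC u _ sS) bilDl (bilC a u sS) (bilC b u sS).
  move: h2; rewrite v2E !bilDl !bDr !bilZl !bilZr h0 h1 -!bCw wv0 wv1 b10 => <-; ring.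
(* If this coordinate vanished, the third point would lie on the line joining the first two and so
   coincide with one of them. *)
have x1 : x 0 i1 != 0.
  apply/eqP => e; move: q2; rewrite e expr0n mul0r add0r => /eqP.
  rewrite !mulf_eq0 (negPf two0) (negPf b01) orbF /= => /orP[/eqP e0|/eqP e2].
    by apply: (npr Pc Pb (x 0 i2)); [exact: nesym|rewrite -/v2 v2E e e0 !scale0r !add0r].
  by apply: (npr Pc Pa (x 0 i0)); [exact: nesym|rewrite -/v2 v2E e e2 !scale0r !addr0].
have ac : x 0 i0 * x 0 i2 != 0.
  apply: contraNneq ww => e; move/eqP: q2; rewrite -[2%:R * _ * _]mulrA e mulr0 mul0r addr0.
  by rewrite mulf_eq0 expf_eq0 (negPf x1).
have [x0 x2] : x 0 i0 != 0 /\ x 0 i2 != 0 by apply/andP; rewrite -negb_or -mulf_eq0.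
pose C : 'M[k]_3 := diag_mx x *m T.
have rC i : row i C = x 0 i *: row i T by rewrite row_mul row_diag_mx -scalemxAl -rowE.
have uC : C \in unitmx.
  rewrite unitmx_mul uT andbT unitmxE det_diag unitfE; apply/prodf_neq0 => i _.
  by move: i; apply: all3.
exists C, (x 0 i1 ^+ 2 * bil S w w); split=> //.
- by rewrite mulf_neq0 // expf_neq0.
- rewrite (form_change S uC) !sum3 !rC !rowK /=.
  rewrite !bilZl !bilZr h0 h1 !(bilC _ w sS) wv0 wv1 (bilC v1 v0 sS) !mulr0 !scale0r.
  rewrite !add0r !addr0 /conic -!mul_mpolyC.
  have -> : x 0 i1 * (x 0 i1 * bil S w w) = x 0 i1 ^+ 2 * bil S w w by ring.
  have e2 : x 0 i1 ^+ 2 * bil S w w = - (2%:R * (x 0 i0 * (x 0 i2 * bil S v0 v1))).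
    by apply/eqP; rewrite -addr_eq0 -q2 !mulrA.
  have -> : x 0 i2 * (x 0 i0 * bil S v0 v1) = x 0 i0 * (x 0 i2 * bil S v0 v1) by ring.
  rewrite mulrBr e2 rmorphN (rmorphM (@mpolyC 3 k) 2%:R) rmorph_nat /=.
  set u := (_ * (x 0 i2 * _))%:MP; set y0 := lf C i0; set y2 := lf C i2; set y1 := lf C i1.
  by clearbody u y0 y1 y2; ring.
have nE o : npt o *m C = \sum_i (npt o) 0 i *: (x 0 i *: row i T).
  by rewrite mulmx_sum_row; apply: eq_bigr => i _; rewrite rC.
split; rewrite nE sum3 !rowK /npt /= !row3E.
- by rewrite expr0n !scale0r !addr0 scale1r ptZ ?co_neq0 -?ptE.
- by rewrite !scale0r !add0r scale1r ptZ ?co_neq0 -?ptE.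
by rewrite expr1n !scale1r -v2E -ptE.
Qed.
End QuadraticForms.

(** * Frames of the curve and the orbit of totally tangent conics *)

Section Frames.
Variable k : closedFieldType.
Hypothesis char_k : 5%N \in [pchar k].
Variable f : {mpoly k[3]}.
Implicit Types (M g : 'M[k]_3) (v : 'rV[k]_3) (P : P2 k) (o : option k).
Local Notation U := (U char_k).
Local Notation gram := (gram char_k).
Local Notation Bm := (Bm k).
Local Notation tr := (@tr k).
Local Notation Fr := (pFrobenius_aut char_k).

(* [M] provides coordinates in which the curve has the equation [hm] = 0 *)
Definition frame M : Prop := M \in unitmx /\ f = hform M.

Lemma frame_U g M : U g -> frame M -> frame (g *m M).
Proof.
by move=> ug [uM fE]; split; [rewrite unitmx_mul uM (U_unit ug)|rewrite (hform_U ug uM)].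
Qed.

Lemma frame_homog M : frame M -> f \is 6.-homog.
Proof. by case=> _ ->; exact: hform_homog. Qed.

(* P^1(F_5): the parameters of the points of tangency *)
Definition params : seq (option k) := None :: [seq Some (i%:R : k) | i <- iota 0 5].

Lemma nat5_inj i j : (i < 5)%N -> (j < 5)%N -> i%:R = j%:R :> k -> i = j.
Proof.
wlog le : i j / (i <= j)%N => [H|] hi hj.
  by case/orP: (leq_total i j) => h e; [exact: H|apply/esym/H].
move/eqP; rewrite eq_sym -subr_eq0 -natrB // -(dvdn_pcharf char_k) => /dvdnP[[|q]] e.
  by apply/eqP; rewrite eqn_leq le /= -subn_eq0 e.
by have := leq_ltn_trans (leq_subr i j) hj; rewrite e mulSn ltnNge leq_addr.
Qed.

Lemma params_uniq : uniq params.
Proof.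
rewrite /params cons_uniq; apply/andP; split; first by apply/mapP => -[].
rewrite map_inj_in_uniq ?iota_uniq // => i j; rewrite !mem_iota => hi hj [].
exact: nat5_inj.
Qed.

Lemma fixed5 (x : k) : x ^+ 5 = x -> exists2 i, (i < 5)%N & x = i%:R.
Proof.
move=> h; have : x * (x - 1) * (x - 2%:R) * (x - 3%:R) * (x - 4%:R) = 0.
  transitivity (x ^+ 5 - x); last by rewrite h subrr.
  by apply: (eq_mod5 char_k (z := - 2%:R * x ^+ 4 + 7%:R * x ^+ 3 - 10%:R * x ^+ 2 + 5%:R * x)); ring.
move/eqP; rewrite !mulf_eq0 !subr_eq0 -!orbA.
by case/or4P=> [/eqP e|/eqP e|/eqP e|/orP[/eqP e|/eqP e]];
  [exists 0%N|exists 1%N|exists 2%N|exists 3%N|exists 4%N].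
Qed.

Lemma nat_fixed5 i : (i%:R : k) ^+ 5 = i%:R.
Proof. by rewrite -(pFrobenius_autE char_k) rmorph_nat. Qed.

Lemma params_Some a : (Some a \in params) <-> a ^+ 5 = a.
Proof.
split; first by rewrite in_cons => /orP[//|/mapP[i _ [->]]]; exact: nat_fixed5.
case/fixed5 => i hi ->; rewrite in_cons; apply/orP; right; apply/mapP.
by exists i; rewrite ?mem_iota.
Qed.

Lemma zeros_frame M v : frame M -> v != 0 ->
  zeros f (pt (v *m M)) <-> hm (v 0 i0) (v 0 i1) (v 0 i2) = 0.
Proof.
move=> [uM ->] v0; have vM := row_neq0 uM v0.
have -> : hm (v 0 i0) (v 0 i1) (v 0 i2) = ev (hform M) (v *m M) by rewrite ev_hform mulmxK.
exact: zeros_pt (hform_homog M) vM.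
Qed.

Lemma Qs_zeros M P : frame M ->
  (Qs M `&` zeros f) P <-> exists2 o, o \in params & P = pt (npt o *m M).
Proof.
move=> fM; split.
  case=> -[o ->] /(zeros_frame fM (npt_neq0 o)) h; exists o => //.
  case: o h => [a|]; last by rewrite in_cons.
  rewrite /npt !row3E => h; apply/params_Some/eqP; rewrite -subr_eq0 -sqrf_eq0.
  by apply/eqP; rewrite -[RHS]h /hm; ring.
case=> o ho ->; split; first by exists o.
apply/(zeros_frame fM (npt_neq0 o)); case: o ho => [a|_]; last first.
  by rewrite /npt !row3E /hm; ring.
move/params_Some => h; rewrite /npt !row3E.
transitivity ((a ^+ 5 - a) ^+ 2); first by rewrite /hm; ring.
by rewrite h subrr expr0n.
Qed.

Lemma Qs_zeros_card M : frame M -> Qs M `&` zeros f #= `I_6.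
Proof.
move=> fM; have inj : {in params &, injective (fun o => pt (npt o *m M))}.
  by move=> o o' _ _; apply: Qs_inj; case: fM.
by apply/(card_image_seq params_uniq inj) => // P; exact: Qs_zeros.
Qed.

(** For a parameter in P^1(F_5) the matrix is fixed by Frobenius, so being unitary is the same as
    being orthogonal for [Bm], which up to sign is the polar form of y1^2 - y0 y2. *)
Lemma U_tr o : o \in params -> U (tr o).
Proof.
move=> ho; have e : map_mx Fr (tr o) = tr o.
  apply/matrixP => i j; rewrite !mxE pFrobenius_autE; case: o ho => [a|_].
    move/params_Some => ha; move: i j; apply: all3; apply: all3;
    by rewrite /= !row3E ?expr1n ?expr0n //= ?exprMn ?(nat_fixed5 2) ?ha // -!exprM mulnC exprM ha.
  by move: i j; apply: all3; apply: all3; rewrite /= !row3E ?expr1n ?expr0n.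
apply/matrixP => i j; rewrite /gram e mxE !sum3 !mxE !sum3 !mxE; case: o {ho e} => [a|].
  by move: i j; apply: all3; apply: all3; rewrite /= !row3E; ring.
by move: i j; apply: all3; apply: all3; rewrite /= !row3E; ring.
Qed.

Lemma gram1 : gram 1%:M = Bm.
Proof. exact: U1. Qed.

Lemma conic_nonsingular M : M \in unitmx -> nonsingular (conic M).
Proof.
move=> uM P; rewrite (ptE P); set v := co P => /(zeros_pt (conic_homog M) (co_neq0 P)) _.
have two0 := nat5_inj (isT : 2 < 5)%N (isT : 0 < 5)%N.
apply: contrapT => H.
have H' i : ev ((conic M)^`M(i)) v = 0.
  by apply/eqP; apply: contrapT => /negP hi; apply: H; exists i; rewrite -ptE.
set y := v *m invmx M.
(* The gradient of y1^2 - y0 y2 at [y]; by the chain rule the vanishing gradient of [conic M] is its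
   image under an invertible matrix. *)
pose z : 'rV[k]_3 := row3 (- y 0 i2) (2%:R * y 0 i1) (- y 0 i0).
have zM : z *m (invmx M)^T = 0.
  apply/rowP => i; rewrite mxE sum3 ![_^T _ _]mxE /z !row3E [RHS]mxE -[RHS](H' i).
  rewrite /conic expr2 mderivB !mderivM !mderiv_lf /ev mevalB !mevalD !mevalM !mevalC -!/(ev _ _) !ev_lf -/y.
  ring.
have z0 : z = 0.
  by rewrite -(mulmxK (_ : (invmx M)^T \in unitmx) z) ?zM ?mul0mx // unitmx_tr unitmx_inv.
have y0 : y = 0.
  have zz j : (0 : 'rV[k]_3) 0 j = 0 by rewrite mxE.
  move/rowP: z0 => z0; move: (z0 i0) (z0 i1) (z0 i2); rewrite !row3E !zz.
  move=> /eqP; rewrite oppr_eq0 => /eqP y2 /eqP; rewrite mulf_eq0 => /orP[/eqP /two0 //|/eqP y1].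
  move=> /eqP; rewrite oppr_eq0 => /eqP y0.
  by rewrite [y]row3_eta y0 y1 y2; apply/rowP; apply: all3; rewrite row3E zz.
by have := co_neq0 P; rewrite -/v -(mulmxKV uM v) -/y y0 mul0mx eqxx.
Qed.

Lemma frame_tr M o : frame M -> o \in params -> frame (tr o *m M).
Proof. by move=> fM ho; apply: frame_U => //; exact: U_tr. Qed.

Theorem frame_tangent M : frame M -> tangent_conics f (Qs M).
Proof.
move=> fM; have [uM fE] := fM; exists (conic M); split.
- exact: conic_homog.
- exact: conic_nonsingular.
- by rewrite -[conic M]scale1r zeros_conic ?oner_eq0.
- exact: Qs_zeros_card.
move=> P /(Qs_zeros P fM)[o ho ->].
have [utM fE'] := frame_tr fM ho.
rewrite -(conic_tr o uM) -[conic _]scale1r -row_tr -row_mul.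
(* (1 - t^4)^2, the cofactor of t^2 in (t^5 - t)^2. The point of tangency has been moved to t = 0 by
   [tr o], which keeps the matrix a frame. *)
pose be : {poly k} := 1 - 2%:R * 'X^4 + 'X^8.
have pE : pb (cpar (tr o *m M)) f = 'X^2 * be.
  rewrite fE' -{1}[tr o *m M]mul1mx (pb_hform_cpar char_k) // gram1.
  by rewrite !sum3 !mxE /= !scale0r !scale1r -mul_polyC rmorphN rmorph_nat /be; ring.
have b0 : be.[0] != 0 by rewrite !hornerE /= !expr0n /= ?mulr0 ?subr0 ?addr0 oner_eq0.
by apply/(conic_multiplicity 2 utM (oner_neq0 _) (frame_homog fM) pE b0).
Qed.

Lemma gramZ c g : gram (c *: g) = c ^+ 6 *: gram g.
Proof.
rewrite /gram map_mxZ linearZ -!scalemxAl -scalemxAr scalerA /= pFrobenius_autE.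
by rewrite -exprS.
Qed.

Lemma gram_unit g : g \in unitmx -> gram g \in unitmx.
Proof. by move=> ug; rewrite !unitmx_mul ug (Bm_unit char_k) unitmx_tr map_unitmx. Qed.

Lemma Fp_gram g M : frame M -> pb (cpar (g *m M)) f = Fp (gram g).
Proof. by case=> uM ->; rewrite pb_hform_cpar. Qed.

(* a conic meeting the curve with multiplicity 2 at the point of parameter [o] *)
Lemma multiplicity2_gram g M a o : g \in unitmx -> frame M -> a != 0 ->
  intersection_multiplicity (a *: conic (g *m M)) f (pt (npt o *m (g *m M))) 2 ->
  gram (tr o *m g) i0 i0 = 0 /\ gram (tr o *m g) i1 i0 = 0.
Proof.
move=> ug fM a0; have [uM fE] := fM; have ugM : g *m M \in unitmx by rewrite unitmx_mul ug.
rewrite -(conic_tr o ugM) -row_tr -row_mul mulmxA.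
have utg : tr o *m g \in unitmx by rewrite unitmx_mul tr_unit.
have utM : tr o *m g *m M \in unitmx by rewrite unitmx_mul utg.
have G0 : gram (tr o *m g) != 0.
  apply: contraTneq (Bm_unit char_k) => G0.
  have : gram (tr o *m g) \in unitmx.
    exact: gram_unit.
  by rewrite G0 !unitmxE !det0 ?unitr0.
have [n [be nr FE]] := multiplicity_XsubC (Fp (gram (tr o *m g))) 0.
rewrite Fp_neq0 // subr0 /= in nr FE.
have pE : pb (cpar (tr o *m g *m M)) f = 'X^n * be by rewrite Fp_gram // FE mulrC.
move=> /(conic_multiplicity 2 utM a0 (frame_homog fM) pE nr) n2.
rewrite -n2 in FE.
have c0 := coef_Fp (gram (tr o *m g)) 0; have c1 := coef_Fp (gram (tr o *m g)) 1.
have i0E : inord 0 = i0 by apply: val_inj; rewrite /= inordK.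
have i1E : inord 1 = i1 by apply: val_inj; rewrite /= inordK.
by rewrite FE !coefMXn /= i0E ?i1E in c0 c1.
Qed.

Lemma Fp_horner (G : 'M[k]_3) a : (Fp G).[a] = \sum_i \sum_j G i j * (a ^+ i * (a ^+ 5) ^+ j).
Proof.
rewrite horner_sum; apply: eq_bigr => i _; rewrite horner_sum; apply: eq_bigr => j _.
by rewrite hornerZ hornerXn exprD exprM.
Qed.

(** A first-order Taylor expansion at [a]: rows 0 and 1 of [tr (Some a)] are (1, a, a^2) and its
    derivative, while the conjugate factor, made of powers of a^5, has derivative 0. *)
Lemma gram_tr_Some g a :
  gram (tr (Some a) *m g) i0 i0 = (Fp (gram g)).[a] /\
  gram (tr (Some a) *m g) i1 i0 = (Fp (gram g))^`().[a].
Proof.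
have -> : gram (tr (Some a) *m g) =
    tr (Some a) *m gram g *m (map_mx Fr (tr (Some a)))^T by rewrite gramM.
set G := gram g; clearbody G; split.
  rewrite Fp_horner !sum3 !mxE !sum3 !mxE !sum3 !mxE /= !pFrobenius_autE ?row3E.
  by rewrite -exprM; ring.
have -> : (Fp G)^`().[a] = \sum_i \sum_j G i j * (a ^+ (i + 5 * j).-1 *+ (i + 5 * j)).
  rewrite (raddf_sum (@deriv k)) horner_sum; apply: eq_bigr => i _.
  rewrite (raddf_sum (@deriv k)) horner_sum; apply: eq_bigr => j _ /=.
  by rewrite derivZ derivXn hornerZ hornerMn hornerXn.
rewrite !sum3 !mxE !sum3 !mxE !sum3 !mxE /= !pFrobenius_autE ?row3E.
apply: (eq_mod5 char_k (z := - (G i0 i1 * a ^+ 4 + 2%:R * G i0 i2 * a ^+ 9 + G i1 i1 * a ^+ 5 +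
  2%:R * G i1 i2 * a ^+ 10 + G i2 i1 * a ^+ 6 + 2%:R * G i2 i2 * a ^+ 11))).
ring.
Qed.

Lemma gram_tr_None g :
  gram (tr None *m g) i0 i0 = gram g i2 i2 /\ gram (tr None *m g) i1 i0 = gram g i1 i2.
Proof.
have -> : gram (tr None *m g) = tr None *m gram g *m (map_mx Fr (tr None))^T by rewrite gramM.
set G := gram g; clearbody G.
by split; rewrite !mxE !sum3 !mxE !sum3 !mxE /= !pFrobenius_autE ?row3E; ring.
Qed.

Theorem tangent_frame M Q : frame M -> tangent_conics f Q ->
  exists2 g, U g & Q = Qs (g *m M).
Proof.
move=> fM [q [hq ns QE Q6 Qm]]; have [uM fE] := fM.
have [e [eQ e_inj]] : exists e : nat -> P2 k,
    (forall i, (i < 6)%N -> (Q `&` zeros f) (e i)) /\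
    (forall i j, (i < 6)%N -> (j < 6)%N -> e i = e j -> i = j).
  have /card_set_bijP[c [_ _ c_surj]] := Q6.
  have [x _ _] := c_surj 0%N isT.
  have he i : exists P, (i < 6)%N -> (Q `&` zeros f) P /\ c P = i.
    have [hi|hi] := boolP (i < 6)%N; last by exists x.
    by have [P hP e] := c_surj i hi; exists P.
  have [e eP] := boolp.choice he.
  exists e; split=> [i /eP[]//|i j /eP[_ ei] /eP[_ ej] eij].
  by rewrite -ei -ej eij.
have zq i : (i < 6)%N -> zeros q (e i) by move/eQ => -[]; rewrite QE.
have ne i j : (i < 6)%N -> (j < 6)%N -> i != j -> e i <> e j.
  by move=> hi hj /eqP ij /e_inj h; apply: ij; exact: h.
have two0 : (2%:R : k) != 0.
  by apply/eqP => /(@nat5_inj 2 0 isT isT).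
have [C [a [uC a0 qE [P0E P1E P2E]]]] :=
  conic_through two0 hq ns (zq 0%N isT) (zq 1%N isT) (zq 2%N isT)
    (ne 0%N 1%N isT isT isT) (ne 0%N 2%N isT isT isT) (ne 1%N 2%N isT isT isT).
have Qz : Q = Qs C by rewrite QE qE zeros_conic.
pose g := C *m invmx M; have CE : C = g *m M by rewrite mulmxKV.
have ug : g \in unitmx by rewrite unitmx_mul uC unitmx_inv.
have [t tE] : exists t : nat -> option k, forall i, (i < 6)%N -> e i = pt (npt (t i) *m C).
  have ht i : exists o, (i < 6)%N -> e i = pt (npt o *m C).
    have [hi|hi] := boolP (i < 6)%N; last by exists None.
    by have [] := eQ i hi; rewrite Qz => -[o oE] _; exists o.
  by have [t tE] := boolp.choice ht; exists t.
have G2 i : (i < 6)%N -> gram (tr (t i) *m g) i0 i0 = 0 /\ gram (tr (t i) *m g) i1 i0 = 0.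
  move=> hi; apply: (multiplicity2_gram (a := a) ug fM a0).
  by rewrite -CE -qE -tE //; apply: Qm; exact: eQ.
have tinj i j : (i < 6)%N -> (j < 6)%N -> t i = t j -> i = j.
  by move=> hi hj h; apply: e_inj => //; rewrite !tE // h.
have t0 : t 0%N = Some 0 by apply: (Qs_inj uC); rewrite -tE.
have t1 : t 1%N = None by apply: (Qs_inj uC); rewrite -tE.
have t2 : t 2%N = Some 1 by apply: (Qs_inj uC); rewrite -tE.
pose u i := odflt 0 (t i).
have uE i : (i < 6)%N -> i != 1%N -> t i = Some (u i).
  move=> hi; rewrite /u; case ti: (t i) => [//|] /eqP; case; apply: tinj => //.
  by rewrite ti t1.
(* The index 1 is left out: its parameter is infinity, where the double contact is expressed by two
   entries of the Gram matrix instead of a root. *)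
pose s := [seq u i | i <- [:: 0; 2; 3; 4; 5]%N].
have [c c0 Gc] : exists2 c, c != 0 & gram g = c *: Bm.
  apply: (Fp_square char_k (s := s)) => //.
  - rewrite map_inj_in_uniq // => i j hi hj h.
    have H n : n \in [:: 0; 2; 3; 4; 5]%N -> (n < 6)%N /\ n != 1%N.
      by rewrite !inE => /or4P[/eqP->|/eqP->|/eqP->|/orP[/eqP->|/eqP->]].
    have [hi6 hi1] := H i hi; have [hj6 hj1] := H j hj.
    by apply: tinj => //; rewrite !uE // h.
  - by rewrite /s /= {1}/u t0 inE eqxx.
  - by rewrite /s /= {2}/u t2 /= !inE eqxx orbT.
  - by apply: contraTneq (gram_unit ug) => ->; rewrite unitmxE det0 unitr0.
  - by have [_] := G2 1%N isT; rewrite t1; have [_ ->] := gram_tr_None g.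
  - by have [] := G2 1%N isT; rewrite t1; have [-> _] := gram_tr_None g.
  move=> b /mapP[i hi ->].
  have [hi6 hi1] : (i < 6)%N /\ i != 1%N.
    by move: hi; rewrite !inE => /or4P[/eqP->|/eqP->|/eqP->|/orP[/eqP->|/eqP->]].
  have [E0 E1] := G2 i hi6; rewrite uE // in E0 E1.
  have [F0 F1] := gram_tr_Some g (u i).
  by split; apply/rootP; rewrite -?F0 -?F1.
(* Scaling [g] by [l] multiplies its Gram matrix by l^6 and does not move the conic. *)
have [l lE] := root_exists c^-1 (isT : 0 < 6)%N.
have l0 : l != 0 by apply: contraNneq c0 => l0; rewrite -invr_eq0 -lE l0 expr0n.
exists (l *: g).
  by apply: (etrans (gramZ l g)); rewrite Gc scalerA lE mulVf // scale1r.
by rewrite Qz -scalemxAl -CE QsZ.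
Qed.
End Frames.

(** * Special secants and intersections of conics *)

Fixpoint pairs (T : Type) (s : seq T) : seq (T * T) :=
  if s is x :: s' then [seq (x, y) | y <- s'] ++ pairs s' else [::].

Lemma pairs_map (T S : Type) (h : T -> S) s :
  pairs [seq h x | x <- s] = [seq (h p.1, h p.2) | p <- pairs s].
Proof. by elim: s => //= x s ->; rewrite map_cat -!map_comp. Qed.

Section Pairs.
Variable T : eqType.
Implicit Types (s : seq T) (x y : T).

Lemma mem_pairs s x y : uniq s -> (x, y) \in pairs s ->
  [/\ x \in s, y \in s & (index x s < index y s)%N].
Proof.
elim: s => //= z s IH /andP[zs us]; rewrite mem_cat => /orP[/mapP[t ts [-> ->]]|/(IH us)[xs ys lt]].
  rewrite !inE eqxx ts orbT; split=> //.
  by have /negPf-> : z != t by apply: contraNneq zs => ->.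
have /negPf-> : z != x by apply: contraNneq zs => ->.
have /negPf-> : z != y by apply: contraNneq zs => ->.
by rewrite !inE xs ys !orbT.
Qed.

Lemma pairs_uniq s : uniq s -> uniq (pairs s).
Proof.
elim: s => //= z s IH /andP[zs us]; rewrite cat_uniq IH // andbT map_inj_uniq; last by move=> ? ? [].
rewrite us /=; apply/hasPn => -[x y] /(mem_pairs us)[xs _ _].
by apply: contraNN zs => /mapP[t _ [<- _]].
Qed.

Lemma pairs_complete s x y : x \in s -> y \in s -> x != y ->
  (x, y) \in pairs s \/ (y, x) \in pairs s.
Proof.
elim: s => //= z s IH; rewrite !inE !mem_cat.
have [->|xz] := eqVneq x z => /= [_ /orP[/eqP->|ys _]|xs].
- by rewrite eqxx.
- by left; rewrite map_f.
have [->|yz] := eqVneq y z => /= [_ _|ys xy]; first by right; rewrite map_f.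
by case: (IH xs ys xy) => ->; rewrite orbT; [left|right].
Qed.

Lemma count_gt1P (a : pred T) s : uniq s ->
  (1 < count a s)%N <-> exists x y, [/\ x \in s, y \in s, x <> y, a x & a y].
Proof.
move=> us; rewrite -size_filter; have uf : uniq (filter a s) by apply: filter_uniq.
split.
  case e: (filter a s) uf => [|x [|y t]] //= uf _.
  have mem z : z \in [:: x, y & t] -> (z \in s) /\ a z by rewrite -e mem_filter => /andP[].
  have [xs ax] := mem x (mem_head _ _).
  have [ys ay] : (y \in s) /\ a y by apply: mem; rewrite !inE eqxx orbT.
  exists x, y; split=> //; move: uf; rewrite /= inE negb_or => /andP[/andP[/eqP //]].
case=> x [y [xs ys xy ax ay]].
have hx : x \in filter a s by rewrite mem_filter ax.
have hy : y \in filter a s by rewrite mem_filter ay.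
by case: (filter a s) hx hy => [|z [|z' t]] //=; rewrite !inE => /eqP ex /eqP ey; case: xy; rewrite ex ey.
Qed.
End Pairs.

(** * Hyperflexes, chords of a conic and common secants *)

Section Secants.
Variable k : closedFieldType.
Hypothesis char_k : 5%N \in [pchar k].
Variable f : {mpoly k[3]}.
Implicit Types (M g : 'M[k]_3) (v : 'rV[k]_3) (P : P2 k) (o : option k) (l : P2_line k).
Local Notation frame := (frame f).

Lemma mderiv_exp n i (p : {mpoly k[3]}) : (p ^+ n.+1)^`M(i) = n.+1%:R * (p ^+ n * p^`M(i)).
Proof.
elim: n => [|n IH]; first by rewrite expr1 expr0 mul1r mul1r.
rewrite exprS mderivM IH -(natr1 n.+1) (exprS p n).
by set m := (n.+1)%:R; set r := p ^+ n; clearbody m r; ring.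
Qed.

Lemma tangent_form_frame M : frame M ->
  exists2 c, c != 0 & tangent_form f (pt (row i0 M)) = c *: lf M i2.
Proof.
move=> [uM fE].
have r0 : row i0 M != 0 by rewrite rowE row_neq0 //; apply/eqP => /rowP/(_ i0)/eqP; rewrite !mxE /= oner_eq0.
(* The chosen coordinates of the point are [c] times row 0. There only the term x^5 z of [hm] has a
   nonzero derivative, which gives the factor c^5. *)
have [c c0 ce] := co_pt r0; exists (c ^+ 5); first by rewrite expf_neq0.
have cR : 5%N \in [pchar {mpoly k[3]}] by rewrite (rmorph_pchar (@mpolyC 3 k)).
rewrite /tangent_form /lf scaler_sumr; apply: eq_bigr => i _; rewrite scalerA; congr (_ *: _).
have -> : f^`M(i) = lf M i2 ^+ 5 * (lf M i0)^`M(i) + lf M i0 ^+ 5 * (lf M i2)^`M(i)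
    - 2%:R * lf M i1 ^+ 5 * (lf M i1)^`M(i).
  rewrite fE /hform /hm mderivB mderivD (mderivM i (lf M i0)) (mderivM i (lf M i0 ^+ 5))
    (mderivM i 2%:R) !mderiv_exp.
  have -> : (2%:R : {mpoly k[3]})^`M(i) = 0 by rewrite -mpolyC_nat mderivC.
  apply: (eq_mod5 cR (z := lf M i0 * (lf M i2 ^+ 4 * (lf M i2)^`M(i)) +
    lf M i0 ^+ 4 * (lf M i0)^`M(i) * lf M i2 - 2%:R * lf M i1 ^+ 5 * (lf M i1)^`M(i))); ring.
rewrite !mderiv_lf -[LHS]/(ev _ (co (pt (row i0 M)))) ce.
have lE j : ev (lf M j) (c *: row i0 M) = c * (1%:M : 'M[k]_3) i0 j.
  by rewrite ev_lf -scalemxAl -row_mul mulmxV // !mxE.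
rewrite /ev rmorphB rmorphD /= !(mevalM, rmorphXn) /= !mevalC -!/(ev _ _) !lE !mxE /=.
by ring.
Qed.

(** The tangent line at (1 : 0 : 0) is z = 0; along its points (1 : t : 0) the form [hm] is -2
    t^6. *)
Lemma weierstrass_frame M : frame M -> weierstrass_points f (pt (row i0 M)).
Proof.
move=> fM; have [uM fE] := fM.
have [|_ z] := (Qs_zeros char_k (pt (row i0 M)) fM).2.
  exists (Some 0); first by apply/(params_Some char_k); rewrite expr0n.
  congr pt; apply/rowP => j; rewrite !mxE sum3 /npt !row3E expr0n /=.
  by rewrite !mul0r mul1r !addr0.
split=> //; have [c c0 ->] := tangent_form_frame fM.
pose be : {poly k} := (- 2%:R)%:P.
have pE : pb (lpar M) f = 'X^6 * be.
  rewrite fE -{1}[M]mul1mx (pb_hform_lpar char_k) // (gram1 char_k) !mxE /=.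
  by rewrite !scale0r !addr0 add0r /be -mul_polyC mulrC.
have b0 : be.[0] != 0.
  by rewrite hornerC oppr_eq0; apply/eqP => /(@nat5_inj _ char_k 2 0 isT isT).
by apply/(line_multiplicity 6 uM c0 (frame_homog fM) pE b0).
Qed.

Lemma weierstrass_Qs M P : frame M -> (Qs M `&` zeros f) P -> weierstrass_points f P.
Proof.
move=> fM /(Qs_zeros char_k P fM)[o ho ->].
by rewrite -row_tr -row_mul; apply/weierstrass_frame/frame_tr.
Qed.

(* vanishes on the line through the points of parameters [o] and [o'] of the conic *)
Definition lineform o o' v : k :=
  match o, o' with
  | Some a, Some b => v 0 i2 - (a + b) * v 0 i1 + a * b * v 0 i0
  | Some a, None | None, Some a => v 0 i1 - a * v 0 i0
  | None, None => 0
  end.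

Lemma lineformP o o' v : o <> o' ->
  (exists x y, v = x *: npt o + y *: npt o') <-> lineform o o' v = 0.
Proof.
have H (a b : k) : a <> b -> b - a != 0 by move=> ab; rewrite subr_eq0; apply/eqP => e; apply: ab.
case: o => [a|]; case: o' => [b|] // oo'; split.
- by case=> x [y ->]; rewrite /lineform /npt !mxE /=; ring.
- rewrite /lineform => h; have ab : b - a != 0 by apply: H => e; apply: oo'; rewrite e.
  exists ((b * v 0 i0 - v 0 i1) / (b - a)), ((v 0 i1 - a * v 0 i0) / (b - a)).
  rewrite [LHS]row3_eta; apply/rowP; apply: all3; rewrite !mxE /=; [by field|by field|].
  have -> : v 0 i2 = (a + b) * v 0 i1 - a * b * v 0 i0.
    by apply/eqP; rewrite -subr_eq0 -[X in _ == X]h; apply/eqP; ring.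
  by field.
- by case=> x [y ->]; rewrite /lineform /npt !mxE /=; ring.
- rewrite /lineform => /eqP; rewrite subr_eq0 => /eqP h; exists (v 0 i0), (v 0 i2 - v 0 i0 * a ^+ 2).
  by rewrite [LHS]row3_eta h; apply/rowP; apply: all3; rewrite !mxE /=; ring.
- by case=> x [y ->]; rewrite /lineform /npt !mxE /=; ring.
rewrite /lineform => /eqP; rewrite subr_eq0 => /eqP h; exists (v 0 i2 - v 0 i0 * b ^+ 2), (v 0 i0).
by rewrite [LHS]row3_eta h; apply/rowP; apply: all3; rewrite !mxE /=; ring.
Qed.

Lemma lineform_npt o o' p : o <> o' -> lineform o o' (npt p) = 0 -> p = o \/ p = o'.
Proof.
case: o => [a|]; case: o' => [b|] //; case: p => [c|] _; rewrite /lineform /npt !row3E.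
- move=> h; have : (c - a) * (c - b) = 0 by rewrite -h; ring.
  by move/eqP; rewrite mulf_eq0 !subr_eq0 => /orP[/eqP->|/eqP->]; [left|right].
- by rewrite !mulr0 addr0 subr0 => /eqP; rewrite oner_eq0.
- by rewrite mulr1 => /eqP; rewrite subr_eq0 => /eqP->; left.
- by right.
- by rewrite mulr1 => /eqP; rewrite subr_eq0 => /eqP->; right.
- by left.
Qed.

Lemma delta_free : \dim <<[:: delta_mx 0%R i0; delta_mx 0%R i1 : 'rV[k]_3]>>%VS == 2%N.
Proof.
rewrite -[2%N]/(size [:: delta_mx 0%R i0; delta_mx 0%R i1 : 'rV[k]_3]) -/(free _).
rewrite free_cons seq1_free span_seq1; apply/andP; split; last first.
  by apply/eqP => /rowP/(_ i1)/eqP; rewrite !mxE /= oner_eq0.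
apply/vlineP => -[c /rowP/(_ i0)/eqP]; by rewrite !mxE /= mulr0 oner_eq0.
Qed.

(* junk unless the two points are distinct *)
Definition chord M o o' : P2_line k :=
  insubd (exist (fun L : {vspace 'rV[k]_3} => \dim L == 2%N) _ delta_free)
    <<[:: npt o *m M; npt o' *m M]>>%VS.

Lemma val_chord M o o' : M \in unitmx -> o <> o' ->
  val (chord M o o') = <<[:: npt o *m M; npt o' *m M]>>%VS.
Proof.
move=> uM oo'; rewrite insubdK // -[2%N]/(size [:: npt o *m M; npt o' *m M]) -/(free _).
change (free [:: npt o *m M; npt o' *m M]).
rewrite free_cons seq1_free span_seq1 row_neq0 ?npt_neq0 // andbT.
apply/vlineP => -[c]; rewrite scalemxAl => /(can_inj (mulmxK uM)) /npt_prop.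
exact: oo'.
Qed.

Lemma on_chord M o o' v : M \in unitmx -> o <> o' -> v != 0 ->
  on_line (pt (v *m M)) (chord M o o') <-> lineform o o' v = 0.
Proof.
move=> uM oo' v0; rewrite -(lineformP v oo') /on_line val_pt ?row_neq0 // val_chord //.
rewrite -memvE span_cons span_seq1; split.
  case/memv_addP => _ /vlineP[x ->] [_ /vlineP[y ->] e]; exists x, y.
  by apply: (can_inj (mulmxK uM)); rewrite e mulmxDl !scalemxAl.
case=> x [y ->]; rewrite mulmxDl -!scalemxAl; apply: memv_add; exact: memvZ (memv_line _).
Qed.

Lemma chord_unique M o o' l : M \in unitmx -> o <> o' ->
  on_line (pt (npt o *m M)) l -> on_line (pt (npt o' *m M)) l -> l = chord M o o'.
Proof.
move=> uM oo'; rewrite /on_line !val_pt ?row_neq0 ?npt_neq0 // => h h'.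
apply: val_inj; apply/esym/eqP; rewrite eqEdim (eqP (valP (chord M o o'))) (eqP (valP l)) leqnn andbT.
by rewrite val_chord // span_cons span_seq1 subv_add h h'.
Qed.

Lemma secants_Qs M l : frame M -> secants_of f (Qs M) l <->
  exists o o', [/\ o \in params k, o' \in params k, o <> o' &
    on_line (pt (npt o *m M)) l /\ on_line (pt (npt o' *m M)) l].
Proof.
move=> fM; split.
  case=> _ [P [P' [/(Qs_zeros char_k _ fM)[o ho ->] /(Qs_zeros char_k _ fM)[o' ho' ->] ne h h']]].
  by exists o, o'; split=> // e; apply: ne; rewrite e.
case=> o [o' [ho ho' oo' [h h']]].
have Q1 : (Qs M `&` zeros f) (pt (npt o *m M)) by apply/(Qs_zeros char_k _ fM); exists o.
have Q2 : (Qs M `&` zeros f) (pt (npt o' *m M)) by apply/(Qs_zeros char_k _ fM); exists o'.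
have ne : pt (npt o *m M) <> pt (npt o' *m M) by move=> /(Qs_inj (proj1 fM)).
split; exists (pt (npt o *m M)), (pt (npt o' *m M)); split=> //; exact: (weierstrass_Qs fM).
Qed.

(* the secant of [Qs M] with the pair of parameters [p] is also a secant of [Qs (g *m M)] *)
Definition shares g (p : option k * option k) : bool :=
  (1 < count (fun o => lineform p.1 p.2 (npt o *m g) == 0%R) (params k))%N.

(** A common secant carries two of the six tangency points of each conic. It determines its pair on
    [Qs M], because a line meets a conic in at most two points; it remains to ask which chords
    contain at least two of the six points of the other conic. *)
Theorem shared_secants_card M g n : frame M -> U char_k g ->
  secants_of f (Qs M) `&` secants_of f (Qs (g *m M)) #= `I_n <->
  n = count (shares g) (pairs (params k)).
Proof.
move=> fM ug; have fgM := frame_U ug fM; have [uM _] := fM.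
have up := params_uniq char_k.
have gn r : npt r *m g != 0 by rewrite row_neq0 ?npt_neq0 // (U_unit ug).
rewrite -size_filter.
apply: (card_image_seq (F := fun p => chord M p.1 p.2)).
- exact/filter_uniq/pairs_uniq.
- move=> [o o'] [p p']; rewrite !mem_filter => /andP[_ /(mem_pairs up)[ho ho' lt]].
  move=> /andP[_ /(mem_pairs up)[hp hp' ltp]] /= e.
  have oo' : o <> o' by move=> h; rewrite h ltnn in lt.
  have pp' : p <> p' by move=> h; rewrite h ltnn in ltp.
  have onp r : r = p \/ r = p' -> r = o \/ r = o'.
    move=> hr; apply: (lineform_npt oo'); apply/(on_chord uM oo' (npt_neq0 r)).
    rewrite e; apply/(on_chord uM pp' (npt_neq0 r))/(lineformP _ pp').
    by case: hr => ->; [exists 1, 0|exists 0, 1]; rewrite scale0r scale1r ?addr0 ?add0r.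
  case: (onp p (or_introl erefl)) => ep; case: (onp p' (or_intror erefl)) => ep'; subst => //.
  by rewrite ltnNge ltnW in ltp.
move=> l; split.
  case=> /(secants_Qs _ fM)[o [o' [ho ho' oo' [h h']]]].
  move=> /(secants_Qs _ fgM)[p [p' [hp hp' pp' [q q']]]].
  have key r r' : (r, r') \in pairs (params k) -> r <> r' -> l = chord M r r' ->
     exists2 i, i \in [seq x <- pairs (params k) | shares g x] & l = chord M i.1 i.2.
    move=> hr rr' lE; exists (r, r') => //; rewrite mem_filter hr andbT.
    apply/(count_gt1P _ up); exists p, p'; split=> //; apply/eqP.
      by apply/(on_chord uM rr' (gn p)); rewrite -lE -mulmxA.
    by apply/(on_chord uM rr' (gn p')); rewrite -lE -mulmxA.
  have /eqP oo'b := oo'.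
  case: (pairs_complete ho ho' oo'b) => hin.
    by apply: (key o o') => //; exact: chord_unique.
  by apply: (key o' o) => //; [exact: nesym|apply: chord_unique => //; exact: nesym].
case=> -[o o']; rewrite mem_filter => /andP[/(count_gt1P _ up)[p [p' [hp hp' pp' /= /eqP q /eqP q']]]].
move=> /(mem_pairs up)[ho ho' lt] /= ->.
have oo' : o <> o' by move=> h; rewrite h ltnn in lt.
split.
  apply/(secants_Qs _ fM); exists o, o'; split=> //; split.
    apply/(on_chord uM oo' (npt_neq0 _))/(lineformP _ oo').
    by exists 1, 0; rewrite scale0r scale1r addr0.
  apply/(on_chord uM oo' (npt_neq0 _))/(lineformP _ oo').
  by exists 0, 1; rewrite scale0r scale1r add0r.
apply/(secants_Qs _ fgM); exists p, p'; split=> //; rewrite !mulmxA; split.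
  exact/(on_chord uM oo' (gn p)).
exact/(on_chord uM oo' (gn p')).
Qed.
End Secants.

(** * Common points of two conics as roots of a quartic *)

Section ConicIntersection.
Variable k : closedFieldType.
Implicit Types (M g : 'M[k]_3) (v : 'rV[k]_3) (P : P2 k) (o : option k).

Definition pcol (A : 'M[k]_3) (j : 'I_3) : {poly k} :=
  (A i0 j)%:P + A i1 j *: 'X + A i2 j *: 'X^2.

(* the equation of the conic [Qs (invmx A *m M)] in the parameter of [Qs M] *)
Definition quart (A : 'M[k]_3) : {poly k} := pcol A i1 ^+ 2 - pcol A i0 * pcol A i2.

Lemma quart_horner A t : (quart A).[t] = q0 (npt (Some t) *m A).
Proof.
rewrite /quart /q0 /pcol !mxE !sum3 /npt !row3E !hornerE /=; ring.
Qed.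

Lemma quart_size A : (size (quart A) <= 5)%N.
Proof.
have sp j : (size (pcol A j) <= 3)%N.
  apply/leq_sizeP => n; rewrite !coefD !coefZ coefC coefX coefXn.
  by case: n => [|[|[|n]]] //= _; rewrite !mulr0 !addr0.
apply: leq_trans (size_polyD _ _) _; rewrite size_polyN geq_max expr2.
by rewrite !(@size_polyM_leS _ _ _ 2 2).
Qed.

Lemma quart_lead A : (quart A)`_4 = q0 (npt None *m A).
Proof.
have c j n : (pcol A j)`_n =
    match n with O => A i0 j | S O => A i1 j | S (S O) => A i2 j | _ => 0 end.
  rewrite !coefD !coefZ coefC coefX coefXn.
  by case: n => [|[|[|n]]] //=; rewrite !(mulr0, mulr1, addr0, add0r).
rewrite /quart coefB expr2 !coefM !big_ord_recr !big_ord0 /= !c /= /q0 !mxE !sum3 /npt !row3E.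
ring.
Qed.

(** The derivative is the polar form of [q0] at (1, t, t^2) and its derivative (0, 1, 2t). Written
    through values of [q0], it can be tested with the evaluation already available over F_25. *)
Lemma quart_deriv A t : (quart A)^`().[t] =
  q0 ((npt (Some t) + row3 0 1 (2%:R * t)) *m A) - q0 (npt (Some t) *m A)
  - q0 (row3 0 1 (2%:R * t) *m A).
Proof.
rewrite /quart /pcol !derivE !hornerE /= mulmxDl /q0 !mxE !sum3 /npt !row3E.
ring.
Qed.

Lemma Qs_inter M g P : M \in unitmx -> g \in unitmx ->
  (Qs M `&` Qs (g *m M)) P <->
  exists2 o, q0 (npt o *m invmx g) = 0 & P = pt (npt o *m M).
Proof.
move=> uM ug; have ugM : g *m M \in unitmx by rewrite unitmx_mul ug.
have e o : npt o *m M = npt o *m invmx g *m (g *m M) by rewrite mulmxA mulmxKV.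
have n0 o : npt o *m invmx g != 0 by rewrite row_neq0 ?npt_neq0 // unitmx_inv.
split.
  by case=> -[o ->]; rewrite e => /(Qs_ptE ugM (n0 o)) h; exists o => //; rewrite -e.
by case=> o h ->; split; [exists o|rewrite e; apply/(Qs_ptE ugM (n0 o))].
Qed.

(** Since infinity is not a common point, the quartic is nonzero, so four known roots exhaust its
    roots over all of k. *)
Lemma inter4 M g (s : seq k) : M \in unitmx -> g \in unitmx ->
  uniq s -> size s = 4%N -> (forall a, a \in s -> q0 (npt (Some a) *m invmx g) = 0) ->
  q0 (npt None *m invmx g) != 0 -> Qs M `&` Qs (g *m M) #= `I_4.
Proof.
move=> uM ug us ss hs hN.
apply/(card_image_seq (F := fun o => pt (npt o *m M)) (s := [seq Some a | a <- s])).
- by rewrite map_inj_uniq // => ? ? [].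
- by move=> o o' _ _; exact: Qs_inj.
- move=> P; split; last first.
    by case=> o /mapP[a /hs h ->] ->; apply/Qs_inter => //; exists (Some a).
  case/Qs_inter=> // -[a|] h ->; last by rewrite h eqxx in hN.
  exists (Some a) => //; apply: map_f; apply: contraT => as_.
  have r0 : quart (invmx g) != 0 by apply: contraNneq hN => r0; rewrite -quart_lead r0 coef0.
  have := max_poly_roots (rs := a :: s) r0 _ _; rewrite /= as_ us ss.
  move=> /(_ _ isT); rewrite rootE quart_horner h eqxx => /(_ _).
  have -> : all (root (quart (invmx g))) s by apply/allP => b /hs hb; rewrite rootE quart_horner hb.
  by move=> /(_ isT); rewrite ltnNge quart_size.
by rewrite size_map.
Qed.

(** After division by (X - a)^2 a form of degree 2 is left, so besides [a] there are at most two
    common points, infinity included. The list [t] collects the finite ones other than [a]. *)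
Lemma inter_double M g (a : k) : M \in unitmx -> g \in unitmx ->
  quart (invmx g) != 0 -> root (quart (invmx g)) a -> root (quart (invmx g))^`() a ->
  ~ (Qs M `&` Qs (g *m M) #= `I_4).
Proof.
move=> uM ug; set r := quart _ => r0 ra r'a /card_set_bijP[c [_ _ c_surj]].
have he (i : nat) : exists o, (i < 4)%N -> q0 (npt o *m invmx g) = 0 /\ c (pt (npt o *m M)) = i.
  have [hi|hi] := boolP (i < 4)%N; last by exists None.
  by have [P /(Qs_inter _ uM ug)[o h ->] <-] := c_surj i hi; exists o.
have [e eP] := boolp.choice he.
pose s := [seq e i | i <- iota 0 4].
have us : uniq s.
  rewrite map_inj_in_uniq ?iota_uniq // => i j; rewrite !mem_iota !add0n => hi hj eij.
  by rewrite -[LHS](proj2 (eP i hi)) -[RHS](proj2 (eP j hj)) eij.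
have hs o : o \in s -> q0 (npt o *m invmx g) = 0.
  by case/mapP => i; rewrite mem_iota add0n => /eP[h _] ->.
have /factor_theorem[r1 rE] := ra.
have r1a : root r1 a.
  by move: r'a; rewrite rE derivM derivXsubC mulr1 !rootE !hornerE subrr mulr0 add0r.
have /factor_theorem[r2 r1E] := r1a.
have rE2 : r = r2 * ('X - a%:P) ^+ 2 by rewrite rE r1E -mulrA expr2.
have r20 : r2 != 0 by apply: contraNneq r0 => h; rewrite rE2 h mul0r.
have sz : size r = (size r2 + 2)%N.
  by rewrite rE2 size_Mmonic ?monic_exp ?monicXsubC // size_exp_XsubC addnS.
pose t := pmap id [seq o <- s | o != Some a].
have ht b : b \in t -> root r2 b.
  rewrite mem_pmap => /mapP[o]; rewrite mem_filter => /andP[oa os] bo; subst o.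
  have := hs _ os; rewrite -quart_horner -/r rE2 hornerM horner_exp hornerXsubC => /eqP.
  rewrite mulf_eq0 expf_eq0 /= subr_eq0 => /orP[h|/eqP ba]; first by rewrite rootE.
  by rewrite ba eqxx in oa.
have ut : uniq t by apply: (@pmap_uniq _ _ id Some) => [[]//|]; exact: filter_uniq.
have st : (size [seq o <- s | o != Some a] >= 3)%N.
  rewrite size_filter; have := count_predC (pred1 (Some a)) s.
  rewrite size_map size_iota count_uniq_mem // -/(predC (pred1 (Some a))).
  set m := count _ s; change (count [predC pred1 (Some a)] s) with m.
  by move=> e4; rewrite -(leq_add2l (Some a \in s)) e4; case: (_ \in s).
have := max_poly_roots r20 (introT allP ht) ut; rewrite -(ltn_add2r 2) -sz => lt.
(* When infinity is a common point the leading coefficient vanishes and the degree bound drops by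
   one, so the total count of points is unaffected. *)
have sr : (size r <= 4 + (None \notin s))%N.
  case: (boolP (None \in s)) => [/hs|_]; last exact: quart_size.
  rewrite -quart_lead => c4; rewrite addn0; apply/leq_sizeP => n; rewrite leq_eqVlt.
  by case/orP=> [/eqP <-|h] //; apply: (leq_sizeP _ _ (quart_size _)).
have stt : (size [seq o <- s | o != Some a] <= size t + (None \in s))%N.
  rewrite size_pmap -(count_predC (fun o => isSome (id o))) leq_add2l.
  rewrite count_filter.
  apply: leq_trans (_ : count (pred1 None) s <= _)%N; last by rewrite count_uniq_mem.
  by apply: sub_count => -[] //= ? /andP[].
move: (leq_trans lt sr) (leq_trans st stt); case: (None \in s) => /=; rewrite ?addn0 ?addn1 ?addn2.
  by rewrite !ltnS => h1 h2; have := leq_trans h2 h1.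
by rewrite !ltnS => h1 h2; have := leq_trans h2 h1.
Qed.
End ConicIntersection.

(** * Unitary matrices over F_25 *)

Inductive F5 := n0 | n1 | n2 | n3 | n4.

Definition v5 (a : F5) : nat := match a with n0 => 0 | n1 => 1 | n2 => 2 | n3 => 3 | n4 => 4 end.
Definition suc5 x := match x with n0 => n1 | n1 => n2 | n2 => n3 | n3 => n4 | n4 => n0 end.
Definition pre5 x := match x with n0 => n4 | n1 => n0 | n2 => n1 | n3 => n2 | n4 => n3 end.
Definition opp5 x := match x with n0 => n0 | n1 => n4 | n2 => n3 | n3 => n2 | n4 => n1 end.
Definition inv5 x := match x with n0 => n0 | n1 => n1 | n2 => n3 | n3 => n2 | n4 => n4 end.
Definition dbl5 x := match x with n0 => n0 | n1 => n2 | n2 => n4 | n3 => n1 | n4 => n3 end.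
Definition add5 x y :=
  match x with
  | n0 => y | n1 => suc5 y | n2 => suc5 (suc5 y) | n3 => pre5 (pre5 y) | n4 => pre5 y
  end.
Definition mul5 x y :=
  match x with
  | n0 => n0 | n1 => y | n2 => dbl5 y | n3 => opp5 (dbl5 y) | n4 => opp5 y
  end.
Definition is0 x := if x is n0 then true else false.

(* [(a, b)] stands for a + b sqrt 2; 2 is not a square modulo 5 *)
Definition F25 := (F5 * F5)%type.
Definition add25 (x y : F25) : F25 :=
  let: (a, b) := x in let: (c, d) := y in (add5 a c, add5 b d).
Definition mul25 (x y : F25) : F25 :=
  let: (a, b) := x in let: (c, d) := y in
  (add5 (mul5 a c) (dbl5 (mul5 b d)), add5 (mul5 a d) (mul5 b c)).
Definition opp25 (x : F25) : F25 := let: (a, b) := x in (opp5 a, opp5 b).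
Definition conj25 (x : F25) : F25 := let: (a, b) := x in (a, opp5 b).
Definition scal25 (c : F5) (x : F25) : F25 := let: (a, b) := x in (mul5 c a, mul5 c b).
Definition inv25 (x : F25) : F25 :=
  let: (a, b) := x in
  scal25 (inv5 (add5 (mul5 a a) (opp5 (dbl5 (mul5 b b))))) (a, opp5 b).
Definition isz (x : F25) := let: (a, b) := x in is0 a && is0 b.
Definition eq25 x y := isz (add25 x (opp25 y)).
Definition zero25 : F25 := (n0, n0).
Definition one25 : F25 := (n1, n0).
Definition all5 : seq F5 := [:: n0; n1; n2; n3; n4].
Definition all25 : seq F25 := [seq (a, b) | a <- all5, b <- all5].

Fixpoint of_nat5 (n : nat) : F5 := if n is n'.+1 then suc5 (of_nat5 n') else n0.
Lemma v5K : cancel v5 of_nat5. Proof. by case. Qed.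
HB.instance Definition _ := Equality.copy F5 (can_type v5K).

(* [dec (a + 5 b)] is a + b sqrt 2 *)
Fixpoint dec (n : nat) : F25 :=
  match n with
  | (((((m.+1).+1).+1).+1).+1) => let: (a, b) := dec m in (a, suc5 b)
  | _ => (of_nat5 n, n0)
  end.

Definition vec := (F25 * F25 * F25)%type.
Definition mat := (vec * vec * vec)%type.
Definition vadd (u v : vec) : vec :=
  let: (a, b, c) := u in let: (d, e, f) := v in (add25 a d, add25 b e, add25 c f).
Definition vscal (x : F25) (v : vec) : vec :=
  let: (a, b, c) := v in (mul25 x a, mul25 x b, mul25 x c).
Definition vmul (v : vec) (A : mat) : vec :=
  let: (x, y, z) := v in let: (r, s, t) := A in
  vadd (vscal x r) (vadd (vscal y s) (vscal z t)).
Definition mmul (A B : mat) : mat :=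
  let: (r, s, t) := A in (vmul r B, vmul s B, vmul t B).
Definition fst_row (A : mat) : vec := let: (r, s, t) := A in r.
(** Over F_25, conjugation is the fifth power, and [n3] stands for -2, the middle entry of [Bm]. *)
Definition herm (u v : vec) : F25 :=
  let: (a, b, c) := u in let: (d, e, f) := v in
  add25 (mul25 a (conj25 f)) (add25 (mul25 c (conj25 d)) (scal25 n3 (mul25 b (conj25 e)))).
Definition isU (A : mat) : bool :=
  let: (r, s, t) := A in
  [&& isz (herm r r), isz (herm r s), eq25 (herm r t) one25,
      isz (herm s r), eq25 (herm s s) (n3, n0), isz (herm s t),
      eq25 (herm t r) one25, isz (herm t s) & isz (herm t t)].
(* the inverse of a unitary matrix *)
Definition uinv25 (A : mat) : mat :=
  let: ((a, b, c), (d, e, f), (g, h, i)) := A in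
  ((conj25 i, scal25 n2 (conj25 f), conj25 c),
   (scal25 n3 (conj25 h), conj25 e, scal25 n3 (conj25 b)),
   (conj25 g, scal25 n2 (conj25 d), conj25 a)).

Definition params5 : seq (option F5) := None :: [seq Some a | a <- all5].
Definition npt5 (o : option F5) : vec :=
  if o is Some a then (one25, (a, n0), (mul5 a a, n0)) else (zero25, zero25, one25).
Definition lineform5 (o o' : option F5) (v : vec) : F25 :=
  let: (x, y, z) := v in
  match o, o' with
  | Some a, Some b => add25 z (add25 (scal25 (opp5 (add5 a b)) y) (scal25 (mul5 a b) x))
  | Some a, None | None, Some a => add25 y (scal25 (opp5 a) x)
  | None, None => zero25
  end.
Definition shared_count (six : seq vec) : nat :=
  count (fun p => (1 < count (fun v => isz (lineform5 p.1 p.2 v)) six)%N) (pairs params5).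

Definition qcoef := (F25 * F25 * F25 * F25 * F25 * F25)%type.
(* the coefficients of [v |-> q0 (v *m A^-1)] *)
Definition qform (A : mat) : qcoef :=
  let: ((a, b, c), (d, e, f), (g, h, i)) := uinv25 A in
  let m x y := opp25 (mul25 x y) in
  let dd x y := scal25 n2 (mul25 x y) in
  (add25 (mul25 b b) (m a c), add25 (mul25 e e) (m d f), add25 (mul25 h h) (m g i),
   add25 (dd b e) (add25 (m a f) (m d c)),
   add25 (dd b h) (add25 (m a i) (m g c)),
   add25 (dd e h) (add25 (m d i) (m g f))).
Definition qeval (S : qcoef) (v : vec) : F25 :=
  let: (s00, s11, s22, s01, s02, s12) := S in let: (x, y, z) := v in
  add25 (mul25 x (add25 (mul25 s00 x) (add25 (mul25 s01 y) (mul25 s02 z))))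
     (add25 (mul25 y (add25 (mul25 s11 y) (mul25 s12 z))) (mul25 s22 (mul25 z z))).
Definition nz (x y : F25) : F25 := if isz x then y else x.
(* division by the first nonzero coefficient *)
Definition qnorm (S : qcoef) : qcoef :=
  let: (a, b, c, d, e, f) := S in
  let i := inv25 (nz a (nz b (nz c (nz d (nz e (nz f one25)))))) in
  (mul25 i a, mul25 i b, mul25 i c, mul25 i d, mul25 i e, mul25 i f).
Definition eqQ (S T : qcoef) : bool :=
  let: (a, b, c, d, e, f) := S in let: (a', b', c', d', e', f') := T in
  [&& eq25 a a', eq25 b b', eq25 c c', eq25 d d', eq25 e e' & eq25 f f'].
(** Equal normalised forms serve as a certificate that two conics are equal; that two conics differ
    is certified by a point instead. *)
Definition cform (A : mat) := qnorm (qform A).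
Definition oncon (S : qcoef) (v : vec) := isz (qeval S v).

(* tests on the quartic which [qform A] induces on the conic [Qs 1%:M] *)
Definition nonzero_quartic (A : mat) : bool :=
  let S := qform A in has (fun o => ~~ oncon S (npt5 o)) params5.
Definition double_root (A : mat) : bool :=
  let S := qform A in
  has (fun x =>
    let n : vec := (one25, x, mul25 x x) in let n' : vec := (zero25, one25, scal25 n2 x) in
    isz (qeval S n) && eq25 (qeval S (vadd n n')) (qeval S n')) all25.
Definition four_roots (A : mat) : bool :=
  let S := qform A in
  (count (fun x => oncon S (one25, x, mul25 x x)) all25 == 4%N) && ~~ oncon S (npt5 None).

(* a lower triangular unitary matrix and a matrix with first row (1, y, z) *)
Definition low (a u w : F25) : mat :=
  let n := inv25 (conj25 a) in
  ((a, zero25, zero25), (u, one25, zero25), (w, scal25 n3 (mul25 (conj25 u) n), n)).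
Definition upp (y z : F25) : mat :=
  ((one25, y, z), (zero25, one25, scal25 n2 (conj25 y)), (zero25, zero25, one25)).
Definition anti : mat :=
  ((zero25, zero25, one25), (zero25, (n4, n0), zero25), (one25, zero25, zero25)).
(* the matrices [p] move the base point to each of the 126 special points *)
Definition all_movers (P : mat -> bool) : bool :=
  P anti && all (fun y => all (fun z =>
    if isz (herm (one25, y, z) (one25, y, z)) then P (upp y z) else true) all25) all25.
Definition one_mat : mat := low one25 zero25 zero25.

Definition dec_mat (r : nat * nat * nat * (nat * nat * nat) * (nat * nat * nat)) : mat :=
  let: (a, b, c, (d, e, f), (g, h, i)) := r in
  ((dec a, dec b, dec c), (dec d, dec e, dec f), (dec g, dec h, dec i)).

(* matrices taking the conic [Qs M] to the 21 conics of its component; the conics 1 to 10 are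
   the neighbours of the first one *)
Definition H21 : seq mat := [seq dec_mat r | r <- [::
  ((1, 0, 0), (0, 1, 0), (0, 0, 1));
  ((5, 0, 1), (0, 4, 0), (4, 0, 20));
  ((4, 0, 5), (0, 4, 0), (20, 0, 1));
  ((9, 3, 1), (4, 4, 0), (9, 10, 20));
  ((24, 15, 5), (4, 4, 0), (24, 3, 1));
  ((6, 1, 1), (3, 4, 0), (24, 20, 20));
  ((9, 5, 5), (3, 4, 0), (21, 1, 1));
  ((6, 4, 1), (2, 4, 0), (24, 5, 20));
  ((9, 20, 5), (2, 4, 0), (21, 4, 1));
  ((9, 2, 1), (1, 4, 0), (9, 15, 20));
  ((24, 10, 5), (1, 4, 0), (24, 2, 1));
  ((18, 10, 22), (20, 1, 4), (22, 2, 19));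
  ((17, 20, 7), (15, 1, 3), (7, 4, 16));
  ((17, 5, 7), (10, 1, 2), (7, 1, 16));
  ((18, 15, 22), (5, 1, 1), (22, 3, 19));
  ((6, 21, 22), (22, 3, 4), (5, 24, 19));
  ((5, 11, 7), (18, 0, 3), (15, 22, 16));
  ((15, 21, 7), (14, 2, 2), (17, 24, 16));
  ((5, 7, 22), (21, 0, 4), (10, 16, 19));
  ((9, 12, 7), (14, 3, 2), (20, 17, 16));
  ((15, 18, 22), (22, 2, 4), (12, 13, 19))]].
Definition E10 : seq mat := take 10 (behead H21).
(* for each conic from the first: a neighbour earlier in the list *)
Definition parents : seq (nat * nat) := [::
  (0, 0); (1, 0); (2, 0); (3, 0); (4, 0); (5, 0); (6, 0); (7, 0); (8, 0); (9, 0);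
  (3, 1); (5, 1); (7, 1); (9, 1); (3, 3); (5, 3); (7, 3); (3, 5); (7, 5); (3, 7)].

(* The matrices in [T150] take [Qs M] to the 150 conics through the base point, one in each
   component of G; the three blocks give the three components of H. *)
Definition T50 : seq mat :=
  [seq (let: (a, u, w) := r in low (dec a) (dec u) (dec w)) | r <- [::
  (1, 0, 0); (1, 0, 5); (1, 0, 20); (5, 0, 0); (5, 1, 15); (5, 2, 10); (5, 3, 10); (5, 4, 15);
  (1, 0, 10); (5, 0, 4); (5, 1, 19); (5, 2, 14); (5, 3, 14); (5, 4, 19); (1, 0, 15); (5, 0, 1);
  (5, 1, 16); (5, 2, 11); (5, 3, 11); (5, 4, 16); (5, 0, 2); (5, 0, 3); (1, 5, 2); (1, 10, 3);
  (1, 15, 3); (1, 20, 2); (5, 1, 17); (5, 1, 18); (1, 5, 22); (1, 10, 18); (1, 15, 13); (1, 20, 7);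
  (5, 2, 12); (5, 2, 13); (1, 5, 17); (1, 10, 8); (1, 15, 23); (1, 20, 12); (5, 3, 12); (5, 3, 13);
  (1, 5, 12); (1, 10, 23); (1, 15, 8); (1, 20, 17); (5, 4, 17); (5, 4, 18); (1, 5, 7); (1, 10, 13);
  (1, 15, 18); (1, 20, 22)]].
(** A diagonal matrix whose determinant has order 3: it represents a generator of PGU_3(5) /
    PSU_3(5), which permutes the three components of H. *)
Definition delta : mat := low (dec 6) zero25 zero25.
Definition T150 : seq mat :=
  T50 ++ [seq mmul t delta | t <- T50] ++ [seq mmul (mmul t delta) delta | t <- T50].

(* entry [l - 1] of row [j]: the component of [mmul (t150 l) (t150 j)], for 0 < l < 8 *)
Definition Adj50 : seq (seq nat) := [::
  [:: 1; 2; 3; 4; 5; 6; 7]; [:: 8; 0; 9; 10; 11; 12; 13]; [:: 0; 14; 15; 16; 17; 18; 19];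
  [:: 20; 21; 0; 22; 23; 24; 25]; [:: 26; 27; 0; 28; 29; 30; 31]; [:: 32; 33; 0; 34; 35; 36; 37];
  [:: 38; 39; 0; 40; 41; 42; 43]; [:: 44; 45; 0; 46; 47; 48; 49]; [:: 14; 1; 21; 27; 33; 39; 45];
  [:: 15; 20; 1; 46; 35; 42; 31]; [:: 16; 26; 1; 22; 41; 48; 37]; [:: 17; 32; 1; 28; 47; 24; 43];
  [:: 18; 38; 1; 34; 23; 30; 49]; [:: 19; 44; 1; 40; 29; 36; 25]; [:: 2; 8; 20; 26; 32; 38; 44];
  [:: 21; 9; 2; 28; 41; 36; 49]; [:: 27; 10; 2; 34; 47; 42; 25]; [:: 33; 11; 2; 40; 23; 48; 31];
  [:: 39; 12; 2; 46; 29; 24; 37]; [:: 45; 13; 2; 22; 35; 30; 43]; [:: 9; 3; 14; 34; 29; 48; 43];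
  [:: 3; 15; 8; 40; 47; 30; 37]; [:: 46; 28; 3; 10; 33; 38; 19]; [:: 35; 41; 3; 27; 17; 12; 44];
  [:: 42; 36; 3; 26; 11; 18; 45]; [:: 31; 49; 3; 16; 32; 39; 13]; [:: 10; 4; 14; 40; 35; 24; 49];
  [:: 4; 16; 8; 46; 23; 36; 43]; [:: 22; 34; 15; 4; 11; 39; 44]; [:: 41; 47; 20; 4; 33; 18; 13];
  [:: 48; 42; 21; 4; 32; 12; 19]; [:: 37; 25; 9; 4; 17; 38; 45]; [:: 11; 5; 14; 46; 41; 30; 25];
  [:: 5; 17; 8; 22; 29; 42; 49]; [:: 28; 40; 20; 16; 5; 12; 45]; [:: 47; 23; 9; 26; 5; 39; 19];
  [:: 24; 48; 15; 27; 5; 38; 13]; [:: 43; 31; 21; 10; 5; 18; 44]; [:: 12; 6; 14; 22; 47; 36; 31];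
  [:: 6; 18; 8; 28; 35; 48; 25]; [:: 34; 46; 21; 26; 17; 6; 13]; [:: 23; 29; 15; 10; 32; 6; 45];
  [:: 30; 24; 9; 16; 33; 6; 44]; [:: 49; 37; 20; 27; 11; 6; 19]; [:: 13; 7; 14; 28; 23; 42; 37];
  [:: 7; 19; 8; 34; 41; 24; 31]; [:: 40; 22; 9; 27; 32; 18; 7]; [:: 29; 35; 21; 16; 11; 38; 7];
  [:: 36; 30; 20; 10; 17; 39; 7]; [:: 25; 43; 15; 26; 33; 12; 7]].

Definition h21 j := nth one_mat H21 j.
Definition t150 i := nth one_mat T150 i.

(** * The finite verifications *)

Definition check_unitary : bool :=
  [&& all isU H21, all isU T150, isU delta & all_movers isU].
Definition check_low : bool :=
  let L := [seq cform t | t <- T150] in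
  all (fun a => isz a || all (fun u => all (fun w =>
    let g := low a u w in
    let: (_, _, r) := g in
    if isz (herm r r) then let c := cform g in has (eqQ c) L else true) all25) all25) all25.
Definition six (A : mat) : seq vec := [seq vmul (npt5 o) A | o <- params5].
Definition check_neighbours : bool :=
  let L := [seq cform e | e <- E10] in
  all (fun t => all_movers (fun p =>
      let g := mmul t p in
      if shared_count (six g) == 3%N then
        (nonzero_quartic g && double_root g) || has (eqQ (cform g)) L
      else true)) T150.
Definition check_E10 : bool := all (fun e => (shared_count (six e) == 3%N) && four_roots e) E10.
(** Closure of the list under neighbours; [check_parents] gives the converse, that every listed
    conic is reached from the first. *)
Definition check_H21 : bool :=
  let L := [seq cform h | h <- H21] in
  all (fun h => all (fun e => has (eqQ (cform (mmul e h))) L) E10) H21.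
Definition check_parents : bool :=
  all (fun j => let: (l, i) := nth (0, 0)%N parents j in
    [&& (l < 10)%N, (i <= j)%N &
      eqQ (cform (mmul (nth one_mat E10 l) (h21 i))) (cform (h21 j.+1))]) (iota 0 20).
Definition check_cover : bool :=
  let L := [seq qform h | h <- H21] in
  all_movers (fun p => count (fun q => oncon q (fst_row p)) L == 1%N).
(** A point v lies on the conic of [h *m t] exactly when v t^-1 lies on the conic of h, so the
    points are moved and the forms in [L] are computed once. *)
Definition common_counts (L : seq qcoef) (s : seq vec) (ti : mat) : seq nat :=
  let s' := [seq vmul v ti | v <- s] in [seq count (oncon q) s' | q <- L].
Definition profileb (cs : seq nat) (ty : conic_type) : bool :=
  all (fun m => count (pred1 m) cs == conic_profile ty m) (iota 0 7).
Definition hadj (L : seq qcoef) (ss : seq (seq vec)) (t : mat) : bool :=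
  let ti := uinv25 t in let css := [seq common_counts L s ti | s <- ss] in
  all (fun ty => count (fun cs => profileb cs ty) css == component_profile Alpha15Gamma6 ty)
    [:: Alpha; Beta; Gamma].
Definition check_hadj : bool :=
  let L := [seq qform h | h <- H21] in let ss := [seq six h | h <- H21] in
  [seq hadj L ss t | t <- T150] == [seq (0 < i < 8)%N | i <- iota 0 150].
Definition check_adj50 : bool :=
  all (fun j => all2 (fun l i => let g := mmul (t150 l) (t150 j) in
      let c := cform (t150 i) in has (fun h => eqQ (cform (mmul h g)) c) H21)
    (iota 1 7) (nth [::] Adj50 j)) (iota 0 50).
Definition check_base : bool := all (fun t => oncon (qform t) (npt5 (Some n0))) T150.
Definition check_distinct : bool :=
  pairwise (fun t t' => let q := qform t in has (fun v => ~~ oncon q v) (six t')) T150.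

Lemma check_unitary_true : check_unitary. Proof. by vm_compute. Qed.
Lemma check_low_true : check_low. Proof. by vm_compute. Qed.
Lemma check_neighbours_true : check_neighbours. Proof. by vm_compute. Qed.
Lemma check_E10_true : check_E10. Proof. by vm_compute. Qed.
Lemma check_H21_true : check_H21. Proof. by vm_compute. Qed.
Lemma check_parents_true : check_parents. Proof. by vm_compute. Qed.
Lemma check_cover_true : check_cover. Proof. by vm_compute. Qed.
Lemma check_hadj_true : check_hadj. Proof. by vm_compute. Qed.
Lemma check_adj50_true : check_adj50. Proof. by vm_compute. Qed.
Lemma check_base_true : check_base. Proof. by vm_compute. Qed.
Lemma check_distinct_true : check_distinct. Proof. by vm_compute. Qed.

Lemma all25P (P : F25 -> bool) : all P all25 -> forall x, P x.
Proof.
by rewrite /all25 /= => h; move: h; do 25![case/andP => ?] => _ [[] []].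
Qed.

(** * The embedding of F_25 in k and correctness of the tests *)

Section Embedding.
Variable k : closedFieldType.
Hypothesis char_k : 5%N \in [pchar k].
Variable w : k.
Hypothesis w2 : w ^+ 2 = 2%:R.
Implicit Types (x y : F25) (A B : mat) (v : vec).
Local Notation U := (U char_k).
Local Notation gram := (gram char_k).
Local Notation Fr := (pFrobenius_aut char_k).

Definition iota5 (a : F5) : k := (v5 a)%:R.
Definition iota (x : F25) : k := iota5 x.1 + iota5 x.2 * w.

Lemma natr_mod5 m n : m = n %[mod 5] -> m%:R = n%:R :> k.
Proof. by move=> e; rewrite -(GRing.natr_mod_pchar char_k m) e (GRing.natr_mod_pchar char_k). Qed.

Lemma iota5D a b : iota5 (add5 a b) = iota5 a + iota5 b.
Proof. by rewrite -natrD; apply: natr_mod5; case: a; case: b. Qed.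
Lemma iota5M a b : iota5 (mul5 a b) = iota5 a * iota5 b.
Proof. by rewrite -natrM; apply: natr_mod5; case: a; case: b. Qed.
Lemma iota5N a : iota5 (opp5 a) = - iota5 a.
Proof.
apply/eqP; rewrite -addr_eq0 -natrD; apply/eqP.
by rewrite -[RHS]/(0%:R); apply: natr_mod5; case: a.
Qed.
Lemma iota5_dbl a : iota5 (dbl5 a) = 2%:R * iota5 a.
Proof. by rewrite -natrM; apply: natr_mod5; case: a. Qed.
Lemma iota5_fixed a : iota5 a ^+ 5 = iota5 a.
Proof. exact: nat_fixed5. Qed.

Lemma iotaD x y : iota (add25 x y) = iota x + iota y.
Proof. by case: x y => [a b] [c d]; rewrite /iota /= !iota5D; ring. Qed.
Lemma iotaM x y : iota (mul25 x y) = iota x * iota y.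
Proof.
case: x y => [a b] [c d]; rewrite /iota /= !iota5D !iota5_dbl !iota5M.
rewrite -w2; ring.
Qed.
Lemma iotaN x : iota (opp25 x) = - iota x.
Proof. by case: x => [a b]; rewrite /iota /= !iota5N; ring. Qed.
Lemma w5 : w ^+ 5 = - w.
Proof.
apply: (eq_mod5 char_k (z := w)).
by rewrite exprS (exprM w 2 2) w2; ring.
Qed.
Lemma iota_conj x : iota (conj25 x) = iota x ^+ 5.
Proof.
by case: x => [a b]; rewrite /iota (exp5D char_k) exprMn !iota5_fixed w5 /= iota5N; ring.
Qed.
Lemma iota_scal c x : iota (scal25 c x) = iota5 c * iota x.
Proof. by case: x => [a b]; rewrite /iota /= !iota5M; ring. Qed.
Lemma iota0 : iota zero25 = 0.
Proof. by rewrite /iota /iota5 /= mul0r addr0. Qed.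
Lemma iota1 : iota one25 = 1.
Proof. by rewrite /iota /iota5 /= mul0r addr0. Qed.
Lemma iota_n a : iota (a, n0) = iota5 a.
Proof. by rewrite /iota /iota5 /= mul0r addr0. Qed.

Lemma isz_spec x : isz x -> x = zero25.
Proof. by case: x => -[] []. Qed.

(** Injectivity at zero: an element that fails the test has an inverse, checked on all 25 elements,
    so its image cannot be 0. *)
Lemma iszE x : isz x = (iota x == 0).
Proof.
have [/isz_spec->|nx] := boolP (isz x); first by rewrite iota0 eqxx.
apply/esym/eqP => x0.
have : all (fun x => isz x || isz (add25 (mul25 x (inv25 x)) (opp25 one25))) all25 by [].
move/all25P/(_ x); rewrite (negPf nx) => /isz_spec/(congr1 iota).
rewrite iotaD iotaM x0 mul0r iotaN iota1 iota0 add0r => /eqP.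
by rewrite oppr_eq0 oner_eq0.
Qed.

Lemma eq25E x y : eq25 x y = (iota x == iota y).
Proof. by rewrite /eq25 iszE iotaD iotaN subr_eq0. Qed.

Lemma iota_inv x : iota (inv25 x) = (iota x)^-1.
Proof.
have [x0|nx] := boolP (isz x).
  by rewrite (isz_spec x0) /inv25 /= -/zero25 iota0 invr0.
have : all (fun x => isz x || eq25 (mul25 x (inv25 x)) one25) all25 by [].
move/all25P/(_ x); rewrite (negPf nx) eq25E iotaM iota1 => /eqP e.
have x0 : iota x != 0 by rewrite -iszE.
by apply: (mulfI x0); rewrite e mulfV.
Qed.

(** z and z^5 are conjugate over F_5: half their sum, and half their difference divided by [w], are
    fixed by Frobenius and hence lie in F_5. *)
Lemma iota_surj (z : k) : z ^+ 25 = z -> exists x, z = iota x.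
Proof.
have five n : (n < 5)%N -> exists a, (n%:R : k) = iota5 a.
  by case: n => [|[|[|[|[|//]]]]] _; [exists n0|exists n1|exists n2|exists n3|exists n4].
move=> z25; have z55 : (z ^+ 5) ^+ 5 = z by rewrite -exprM.
have two0 : (2%:R : k) != 0 by apply/eqP => /(@nat5_inj _ char_k 2 0 isT isT).
have w0 : w != 0 by apply: contraNneq two0 => h; rewrite -w2 h expr0n.
have [|i hi ei] := @fixed5 _ char_k ((z + z ^+ 5) / 2%:R).
  by rewrite exprMn (exp5D char_k) z55 exprVn (nat_fixed5 char_k) addrC.
have [|j hj ej] := @fixed5 _ char_k ((z - z ^+ 5) / (2%:R * w)).
  rewrite exprMn (exp5D char_k) (exp5N char_k) z55 exprVn exprMn (nat_fixed5 char_k) w5.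
  by rewrite mulrN invrN mulrN -mulNr opprD opprK addrC.
have [a ea] := five i hi; have [b eb] := five j hj.
exists (a, b); rewrite /iota /= -ea -eb -ei -ej; field.
by rewrite two0 w0.
Qed.

Definition iotav v : 'rV[k]_3 := let: (a, b, c) := v in row3 (iota a) (iota b) (iota c).
Definition iotam A : 'M[k]_3 :=
  let: (r, s, t) := A in
  \matrix_i (if val i is 0%N then iotav r else if val i is 1%N then iotav s else iotav t).

Lemma iotav_vadd u v : iotav (vadd u v) = iotav u + iotav v.
Proof.
case: u v => [[a b] c] [[d e] h]; apply/rowP; by apply: all3; rewrite [RHS]mxE !row3E iotaD.
Qed.

Lemma iotav_vscal x v : iotav (vscal x v) = iota x *: iotav v.
Proof.
case: v => [[a b] c]; apply/rowP; by apply: all3; rewrite [RHS]mxE !row3E iotaM.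
Qed.

Lemma iotav_vmul v A : iotav (vmul v A) = iotav v *m iotam A.
Proof.
case: v A => [[x y] z] [[r s] t]; rewrite /vmul !iotav_vadd !iotav_vscal.
by rewrite mulmx_sum_row sum3 !rowK !row3E addrA.
Qed.

Lemma iotam_mmul A B : iotam (mmul A B) = iotam A *m iotam B.
Proof.
case: A => [[r s] t]; apply/row_matrixP; apply: all3; rewrite row_mul !rowK;
by rewrite -iotav_vmul.
Qed.

Lemma iotam_one : iotam one_mat = 1%:M.
Proof.
apply/matrixP => i j; rewrite !mxE; move: i j; apply: all3; apply: all3;
by rewrite /= row3E ?iota1 ?iota0.
Qed.

Lemma fst_rowE A : iotav (fst_row A) = row i0 (iotam A).
Proof. by case: A => [[r s] t]; rewrite rowK. Qed.

Lemma iotam_uinv A : iotam (uinv25 A) = uinv char_k (iotam A).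
Proof.
case: A => [[[[a b] c] [[d e] h]] [[g p] i]]; apply/matrixP => x y.
rewrite /uinv [RHS]mxE sum3 ![(Bm k *m _) _ _]mxE !sum3 ![(_^T) _ _]mxE ![(map_mx _ _) _ _]mxE !mxE.
move: x y; apply: all3; apply: all3;
rewrite /= !row3E ?iota_scal !iota_conj !pFrobenius_autE /iota5 /=.
- ring.
- ring.
- ring.
- by apply: (eq_mod5 char_k (z := iota p ^+ 5)); ring.
- by apply: (eq_mod5 char_k (z := iota e ^+ 5)); ring.
- by apply: (eq_mod5 char_k (z := iota b ^+ 5)); ring.
- ring.
- ring.
- ring.
Qed.

Lemma hermE A i j r : 
  row i (iotam A) = iotav r -> forall s, row j (iotam A) = iotav s ->
  gram (iotam A) i j = iota (herm r s).
Proof.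
move=> /rowP hr s /rowP hs; rewrite gramE; move: (hr i0) (hr i1) (hr i2) (hs i0) (hs i1) (hs i2).
case: r s {hr hs} => [[a b] c] [[d e] h]; rewrite !row3E ![row _ _ _ _]mxE => -> -> -> -> -> ->.
rewrite !iotaD iota_scal !iotaM !iota_conj.
by apply: (eq_mod5 char_k (z := - (iota b * iota e ^+ 5))); rewrite /iota5 /=; ring.
Qed.

Lemma U_isU A : isU A -> U (iotam A).
Proof.
case: A => [[r s] t]; set A : mat := (r, s, t).
have er : row i0 (iotam A) = iotav r by rewrite rowK.
have es : row i1 (iotam A) = iotav s by rewrite rowK.
have et : row i2 (iotam A) = iotav t by rewrite rowK.
rewrite [isU A]/([&& isz (herm r r), isz (herm r s), eq25 (herm r t) one25,
      isz (herm s r), eq25 (herm s s) (n3, n0), isz (herm s t),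
      eq25 (herm t r) one25, isz (herm t s) & isz (herm t t)]).
rewrite !eq25E !iszE => /and5P[/eqP h00 /eqP h01 /eqP h02 /eqP h10].
move=> /and5P[/eqP h11 /eqP h12 /eqP h20 /eqP h21 /eqP h22].
have e3 : iota (n3, n0) = - 2%:R.
  by rewrite iota_n; apply: (eq_mod5 char_k (z := 1)); rewrite /iota5 /=; ring.
apply/matrixP; apply: all3; apply: all3; rewrite [RHS]mxE /=.
- by rewrite (hermE er er).
- by rewrite (hermE er es).
- by rewrite (hermE er et) h02 iota1.
- by rewrite (hermE es er).
- by rewrite (hermE es es) h11.
- by rewrite (hermE es et).
- by rewrite (hermE et er) h20 iota1.
- by rewrite (hermE et es).
- by rewrite (hermE et et).
Qed.

Lemma isU_U A : U (iotam A) -> isU A.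
Proof.
case: A => [[r s] t]; set A : mat := (r, s, t) => ug.
have G i j : gram (iotam A) i j = Bm k i j by rewrite ug.
have er : row i0 (iotam A) = iotav r by rewrite rowK.
have es : row i1 (iotam A) = iotav s by rewrite rowK.
have et : row i2 (iotam A) = iotav t by rewrite rowK.
rewrite [isU A]/([&& isz (herm r r), isz (herm r s), eq25 (herm r t) one25,
      isz (herm s r), eq25 (herm s s) (n3, n0), isz (herm s t),
      eq25 (herm t r) one25, isz (herm t s) & isz (herm t t)]) !eq25E !iszE.
rewrite -(hermE er er) -(hermE er es) -(hermE er et) -(hermE es er) -(hermE es es).
rewrite -(hermE es et) -(hermE et er) -(hermE et es) -(hermE et et) !G !mxE /= iota1 !eqxx /=.
rewrite ?andbT iota_n [in X in if X then _ else _](_ : - 2%:R = iota5 n3) ?eqxx //.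
apply/esym/(eq_mod5 char_k (z := 1)); rewrite /iota5 /=; ring.
Qed.

Lemma isU_mmul A B : isU A -> isU B -> isU (mmul A B).
Proof. by move=> uA uB; apply: isU_U; rewrite iotam_mmul; apply: UM; exact: U_isU. Qed.

Definition qevalk (S : qcoef) (z : 'rV[k]_3) : k :=
  let: (s00, s11, s22, s01, s02, s12) := S in let: (x, y, z) := (z 0 i0, z 0 i1, z 0 i2) in
  iota s00 * x ^+ 2 + iota s11 * y ^+ 2 + iota s22 * z ^+ 2 +
  iota s01 * (x * y) + iota s02 * (x * z) + iota s12 * (y * z).

Lemma qeval_iota S v : iota (qeval S v) = qevalk S (iotav v).
Proof.
case: S => [[[[[a b] c] d] e] h]; case: v => [[x y] z].
by rewrite /qevalk !row3E /= !(iotaD, iotaM); ring.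
Qed.

Lemma qevalkE A (z : 'rV[k]_3) : qevalk (qform A) z = q0 (z *m uinv char_k (iotam A)).
Proof.
rewrite -iotam_uinv /qform.
case: (uinv25 A) => [[[[a b] c] [[d e] h]] [[g p] i]].
rewrite /q0 !mxE !sum3 !mxE /= ?row3E /qevalk /=.
rewrite !(iotaD, iotaM, iotaN, iota_scal) /iota5 /=; ring.
Qed.

Lemma qevalE A v : iota (qeval (qform A) v) = q0 (iotav v *m uinv char_k (iotam A)).
Proof. by rewrite qeval_iota qevalkE. Qed.

Lemma qevalU A v : isU A -> iota (qeval (qform A) v) = q0 (iotav v *m invmx (iotam A)).
Proof. by move=> uA; rewrite qevalE U_invE //; exact: U_isU. Qed.

Lemma onconE A v : isU A -> oncon (qform A) v = (q0 (iotav v *m invmx (iotam A)) == 0).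
Proof. by move=> uA; rewrite /oncon iszE qevalU. Qed.

Lemma nz_neq0 x y : ~~ isz y -> ~~ isz (nz x y).
Proof. by rewrite /nz; case: ifP => // ->. Qed.

Lemma qnormE S : exists2 c, c != 0 & forall z, qevalk (qnorm S) z = c * qevalk S z.
Proof.
case: S => [[[[[a b] c] d] e] h]; rewrite /qnorm.
set l := nz a _; exists (iota l)^-1.
  by rewrite invr_eq0 -iszE /l; do 6!apply: nz_neq0.
by move=> z; rewrite /qevalk /= !iotaM iota_inv; ring.
Qed.

Lemma eqQ_qevalk S T z : eqQ S T -> qevalk S z = qevalk T z.
Proof.
case: S T => [[[[[a b] c] d] e] h] [[[[[a' b'] c'] d'] e'] h'] /=; rewrite !eq25E.
by move=> /and5P[/eqP-> /eqP-> /eqP-> /eqP-> /andP[/eqP-> /eqP->]].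
Qed.

(** Conjugating and transposing the unitary relation replaces its left factor [g] by the double
    Frobenius conjugate; cancelling the common right factor shows that each entry satisfies z^25 =
    z. *)
Lemma U_iota g : U g -> exists A, g = iotam A.
Proof.
move=> ug; have gg : map_mx Fr (map_mx Fr g) = g.
  have BF : map_mx Fr (Bm k) = Bm k.
    apply/matrixP => i j; rewrite !mxE; move: i j; apply: all3; apply: all3;
    by rewrite /= ?rmorph0 ?rmorph1 ?rmorphN ?rmorph_nat.
  have BT : (Bm k)^T = Bm k.
    by apply/matrixP => i j; rewrite !mxE; move: i j; apply: all3; apply: all3.
  have := congr1 (fun X => (map_mx Fr X)^T) ug.
  rewrite /gram !map_mxM BF BT -map_trmx !trmx_mul trmxK BT mulmxA => e.
  have uBF : Bm k *m (map_mx Fr g)^T \in unitmx.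
    by rewrite unitmx_mul (Bm_unit char_k) unitmx_tr map_unitmx (U_unit ug).
  apply: (can_inj (mulmxK uBF)); rewrite mulmxA e -[LHS]ug /gram mulmxA //.
have ex i j : exists x, g i j = iota x.
  apply: iota_surj; rewrite -{2}gg !mxE !pFrobenius_autE -exprM //.
have [F hF] := boolp.choice (fun p : 'I_3 * 'I_3 => ex p.1 p.2).
exists ((F (i0, i0), F (i0, i1), F (i0, i2)), (F (i1, i0), F (i1, i1), F (i1, i2)),
   (F (i2, i0), F (i2, i1), F (i2, i2))).
by apply/matrixP; apply: all3; apply: all3; rewrite [RHS]mxE /= row3E -hF.
Qed.

Lemma npt_iota o : npt (omap iota5 o) = iotav (npt5 o).
Proof.
by case: o => [a|] /=; rewrite /npt ?iota1 ?iota0 // !iota_n iota5M -expr2.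
Qed.

Lemma params_iota : params k = [seq omap iota5 o | o <- params5].
Proof. by []. Qed.

Lemma lineform_iota o o' v :
  lineform (omap iota5 o) (omap iota5 o') (iotav v) = iota (lineform5 o o' v).
Proof.
case: v => [[x y] z]; case: o => [a|]; case: o' => [b|] /=; rewrite ?iota0 // !row3E.
- by rewrite !iotaD !iota_scal iota5N iota5D iota5M; ring.
- by rewrite !iotaD !iota_scal iota5N; ring.
- by rewrite !iotaD !iota_scal iota5N; ring.
Qed.

Lemma shared_count_iota A :
  count (shares (iotam A)) (pairs (params k)) = shared_count (six A).
Proof.
have H o o' : shares (iotam A) (omap iota5 o, omap iota5 o') =
    (1 < count (fun v => isz (lineform5 o o' v)) (six A))%N.
  rewrite /shares params_iota /six !count_map; congr (_ < _)%N; apply: eq_count => p /=.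
  by rewrite npt_iota -iotav_vmul lineform_iota iszE.
by rewrite params_iota pairs_map count_map; apply: eq_count => -[o o']; exact: H.
Qed.

Lemma cform_Qs A B M : isU A -> isU B -> M \in unitmx -> eqQ (cform A) (cform B) ->
  Qs (iotam A *m M) = Qs (iotam B *m M).
Proof.
move=> uA uB uM eAB.
have [a a0 ha] := qnormE (qform A); have [b b0 hb] := qnormE (qform B).
have eq0 (z : 'rV[k]_3) : (q0 (z *m invmx (iotam A)) == 0) = (q0 (z *m invmx (iotam B)) == 0).
  rewrite !(U_invE (U_isU _)) // -!qevalkE -[LHS](mulrI_eq0 _ (mulfI a0)) -ha.
  by rewrite (eqQ_qevalk z eAB) hb mulf_eq0 (negPf b0).
suff H (X Y : mat) : isU X -> isU Y ->
    (forall z : 'rV[k]_3, (q0 (z *m invmx (iotam X)) == 0) = (q0 (z *m invmx (iotam Y)) == 0)) ->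
    Qs (iotam X *m M) `<=` Qs (iotam Y *m M).
  by apply/seteqP; split; apply: H => // z; rewrite eq0.
move=> /U_isU/U_unit uX /U_isU/U_unit uY eXY P.
rewrite (ptE P) -[co P](mulmxKV uM); set z := co P *m _.
have z0 : z != 0 by rewrite row_neq0 ?unitmx_inv ?co_neq0.
have zE C : C \in unitmx -> z *m M = z *m invmx C *m (C *m M).
  by move=> uC; rewrite mulmxA (mulmxKV uC).
have nz C : C \in unitmx -> z *m invmx C != 0 by move=> uC; rewrite row_neq0 ?unitmx_inv.
have uCM C : C \in unitmx -> C *m M \in unitmx by move=> uC; rewrite unitmx_mul uC.
rewrite {1}(zE _ uX) (zE _ uY) => /(Qs_ptE (uCM _ uX) (nz _ uX))/eqP.
by rewrite eXY => /eqP h; apply/(Qs_ptE (uCM _ uY) (nz _ uY)).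
Qed.
End Embedding.

Definition mover (p : mat) : Prop :=
  p = anti \/ exists y z, isz (herm (one25, y, z) (one25, y, z)) /\ p = upp y z.

Lemma all_moversP P p : all_movers P -> mover p -> P p.
Proof.
case/andP=> ha hu [->//|[y [z [iyz ->]]]].
by have := all25P (all25P hu y) z; rewrite iyz.
Qed.

Lemma has_cform (L : seq mat) c : has (eqQ c) [seq cform t | t <- L] ->
  exists2 i, (i < size L)%N & eqQ c (cform (nth one_mat L i)).
Proof. by rewrite has_map => /(has_nthP one_mat). Qed.

Lemma low_listed a u b (r := (b, scal25 n3 (mul25 (conj25 u) (inv25 (conj25 a))),
    inv25 (conj25 a))) :
  ~~ isz a -> isz (herm r r) ->
  exists2 i, (i < 150)%N & eqQ (cform (low a u b)) (cform (t150 i)).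
Proof.
move=> na hr; have [L LE] : {L | L = [seq cform t | t <- T150]} by eexists.
have h := check_low_true; rewrite /check_low -LE in h.
have {h} := all25P h a; rewrite (negPf na) orFb => /all25P/(_ u)/all25P/(_ b) h.
have {h} : if isz (herm r r) then has (eqQ (cform (low a u b))) L else true := h.
rewrite hr LE => /has_cform[i hi e].
by exists i.
Qed.

Lemma nth_E10 l : (l < 10)%N -> nth one_mat E10 l = h21 l.+1.
Proof. by move=> hl; rewrite /E10 nth_take // nth_behead. Qed.

(** * Enumeration of the conics and of the neighbours of one conic *)

Section Orbits.
Variable k : closedFieldType.
Hypothesis char_k : 5%N \in [pchar k].
Variable w : k.
Hypothesis w2 : w ^+ 2 = 2%:R.
Variable f : {mpoly k[3]}.
Implicit Types (M g : 'M[k]_3) (A B : mat).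
Local Notation U := (U char_k).
Local Notation gram := (gram char_k).
Local Notation frame := (frame f).
Local Notation iota := (iota w).
Local Notation iotam := (iotam w).
Local Notation iotav := (iotav w).
Local Notation iotaM := (iotaM char_k w2).
Local Notation iotaD := (iotaD char_k w).
Local Notation iota_conj := (iota_conj char_k w2).
Local Notation iota_inv := (iota_inv char_k w2).
Local Notation iszE := (iszE char_k w2).

Definition tm i : 'M[k]_3 := iotam (t150 i).
Definition hmx j : 'M[k]_3 := iotam (h21 j).

Lemma isU_t150 i : isU (t150 i).
Proof.
have /and4P[_ ht _ _] := check_unitary_true.
have [hi|hi] := ltnP i (size T150); first by have /all_nthP := ht; apply.
by rewrite /t150 nth_default.
Qed.

Lemma isU_h21 j : isU (h21 j).
Proof.
have /and4P[hh _ _ _] := check_unitary_true.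
have [hi|hi] := ltnP j (size H21); first by have /all_nthP := hh; apply.
by rewrite /h21 nth_default.
Qed.

Lemma isU_mover p : mover p -> isU p.
Proof. by have /and4P[_ _ _ h] := check_unitary_true; exact: all_moversP. Qed.

Lemma U_tm i : U (tm i). Proof. exact: (U_isU char_k w2 (isU_t150 i)). Qed.
Lemma U_hmx j : U (hmx j). Proof. exact: (U_isU char_k w2 (isU_h21 j)). Qed.

(** The first row is isotropic. If its first entry is 0, so is the second, and the point is (0 : 0 :
    1); otherwise the row scales to (1, y, z). *)
Lemma mover_row g : U g -> exists p, mover p /\ exists2 c, c != 0 & row i0 g = c *: row i0 (iotam p).
Proof.
move=> ug; have [[[[[x y] z] s] t] gE] := U_iota w2 ug.
set A : mat := (x, y, z, s, t) in gE; have r0 : row i0 g = iotav (x, y, z) by rewrite gE rowK.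
have rn0 : row i0 g != 0.
  by rewrite rowE row_neq0 ?(U_unit ug) //; apply/eqP => /rowP/(_ i0)/eqP; rewrite !mxE /= oner_eq0.
have h0 : iota x * iota z ^+ 5 + iota x ^+ 5 * iota z = 2%:R * iota y ^+ 6.
  have := congr1 (fun X : 'M_3 => X i0 i0) ug; rewrite gramE [RHS]mxE /=.
  move/rowP: r0 => r0; move: (r0 i0) (r0 i1) (r0 i2); rewrite !row3E ![row _ _ _ _]mxE => -> -> ->.
  by move=> /eqP; rewrite subr_eq0 -exprS => /eqP <-; ring.
have two0 : (2%:R : k) != 0 by apply/eqP => /(@nat5_inj _ char_k 2 0 isT isT).
have [x0|x0] := eqVneq (iota x) 0.
  have y0 : iota y = 0.
    move: h0; rewrite x0 mul0r expr0n mul0r addr0 => /esym/eqP.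
    by rewrite mulf_eq0 (negPf two0) expf_eq0 => /eqP.
  exists anti; split; first by left.
  exists (iota z).
    apply: contraNneq rn0 => z0; rewrite r0 /= x0 y0 z0.
    by apply/eqP/rowP; apply: all3; rewrite !mxE.
  rewrite r0 rowK; apply/rowP; apply: all3; rewrite [RHS]mxE !row3E ?x0 ?y0 ?iota0 ?mulr0 //.
  by rewrite iota1 mulr1.
exists (upp (mul25 (inv25 x) y) (mul25 (inv25 x) z)); split.
  right; exists (mul25 (inv25 x) y), (mul25 (inv25 x) z); split => //.
  rewrite iszE /herm !iotaD (iota_scal char_k w) !iotaM !iota_conj !iotaM iota_inv iota1.
  rewrite expr1n !mul1r mulr1 (_ : iota5 k n3 = - 2%:R); last first.
    by apply: (eq_mod5 char_k (z := 1)); rewrite /iota5 /=; ring.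
  apply/eqP; transitivity ((iota x * iota z ^+ 5 + iota x ^+ 5 * iota z - 2%:R * iota y ^+ 6) / iota x ^+ 6).
    by field.
  by rewrite h0 subrr mul0r.
exists (iota x) => //.
rewrite r0 rowK; apply/rowP; apply: all3; rewrite [RHS]mxE !row3E ?iota1 ?mulr1 //.
  by rewrite iotaM iota_inv mulrA mulfV // mul1r.
by rewrite iotaM iota_inv mulrA mulfV // mul1r.
Qed.

(** With first row (a, 0, 0), unitarity makes the whole matrix lower triangular. The middle entry
    has sixth power 1, so dividing by it keeps the matrix unitary and the conic unchanged; the last
    two entries of the bottom row are then determined, and the matrix is some [low a u b]. *)
Lemma lower_conic g : U g -> g i0 i1 = 0 -> g i0 i2 = 0 ->
  exists2 i, (i < 150)%N & forall M, M \in unitmx -> Qs (g *m M) = Qs (tm i *m M).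
Proof.
move=> ug g01 g02.
have G i j : gram g i j = Bm k i j by rewrite ug.
have a0 : g i0 i0 != 0.
  apply/eqP => g00; have := G i2 i0; rewrite gramE g00 g01 g02 mxE /=.
  rewrite expr0n /= !mulr0 addr0 subr0 => /esym/eqP; by rewrite oner_eq0.
have g12 : g i1 i2 = 0.
  have := G i1 i0; rewrite gramE g01 g02 mxE /= expr0n /= !mulr0 add0r subr0.
  by move/eqP; rewrite mulf_eq0 expf_eq0 (negPf a0) andbF orbF => /eqP.
have two0 : (2%:R : k) != 0 by apply/eqP => /(@nat5_inj _ char_k 2 0 isT isT).
have g11 : g i1 i1 ^+ 6 = 1.
  have := G i1 i1; rewrite gramE g12 expr0n /= mulr0 mul0r addr0 sub0r mxE /= => /oppr_inj.
  by rewrite -exprS -[RHS]mulr1 => /(mulfI two0).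
have m0 : g i1 i1 != 0 by apply: contra_eq_neq g11 => ->; rewrite expr0n /= eq_sym oner_eq0.
have [g' g'E] : {g' | g' = (g i1 i1)^-1 *: g} by exists ((g i1 i1)^-1 *: g).
have ug' : U g' by rewrite g'E; apply: (etrans (gramZ char_k _ g)); rewrite exprVn g11 invr1 scale1r.
have G' i j : gram g' i j = Bm k i j by rewrite ug'.
have e01 : g' i0 i1 = 0 by rewrite g'E mxE g01 mulr0.
have e02 : g' i0 i2 = 0 by rewrite g'E mxE g02 mulr0.
have e12 : g' i1 i2 = 0 by rewrite g'E mxE g12 mulr0.
have e11 : g' i1 i1 = 1 by rewrite g'E mxE mulVf.
have e00 : g' i0 i0 != 0 by rewrite g'E mxE mulf_neq0 ?invr_eq0.
have e22 : g' i2 i2 = (g' i0 i0 ^+ 5)^-1.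
  have := G' i2 i0; rewrite gramE e01 e02 mxE /= expr0n /= !mulr0 add0r subr0 => h.
  by apply: (mulIf (expf_neq0 5 e00)); rewrite h mulVf ?expf_neq0.
have F2 i j : g' i j ^+ 25 = g' i j.
  have [A ->] := U_iota w2 ug'.
  have F2' x : iota x ^+ 25 = iota x.
    rewrite (exprM _ 5 5) -!iota_conj; congr iota; case: x => [a b] /=; by case: b.
  case: A => [[[[a b] c] [[d e] h]] [[p q] l]]; rewrite mxE; move: i j.
  by apply: all3; apply: all3; rewrite /= !row3E.
have e21 : g' i2 i1 = 3%:R * (g' i1 i0 ^+ 5 * g' i2 i2).
  have := G' i1 i2; rewrite gramE e11 e12 mul0r addr0 mul1r mxE /= => /eqP.
  rewrite subr_eq0 => /eqP h.
  have h3 : g' i2 i1 ^+ 5 = 3%:R * (g' i1 i0 * g' i2 i2 ^+ 5).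
    by rewrite h; apply/esym/(eq_mod5 char_k (z := g' i2 i1 ^+ 5)); ring.
  have F55 i j : (g' i j ^+ 5) ^+ 5 = g' i j by rewrite -exprM; exact: F2.
  by rewrite -[LHS]F55 h3 exprMn (nat_fixed5 char_k 3) exprMn F55.
have [a aE] := iota_surj char_k w2 (F2 i0 i0).
have [u uE] := iota_surj char_k w2 (F2 i1 i0).
have [b bE] := iota_surj char_k w2 (F2 i2 i0).
have gE : g' = iotam (low a u b).
  apply/matrixP => i j; rewrite [RHS]mxE; move: i j; apply: all3; apply: all3;
  rewrite /= row3E ?iota0 ?iota1 -?aE -?uE -?bE //.
  - by rewrite (iota_scal char_k w) iotaM iota_conj iota_inv iota_conj -aE -uE e21 e22.
  - by rewrite iota_inv iota_conj -aE.
have h22 : isz (herm (b, scal25 n3 (mul25 (conj25 u) (inv25 (conj25 a))), inv25 (conj25 a))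
                    (b, scal25 n3 (mul25 (conj25 u) (inv25 (conj25 a))), inv25 (conj25 a))).
  have r2 : row i2 (iotam (low a u b)) =
    iotav (b, scal25 n3 (mul25 (conj25 u) (inv25 (conj25 a))), inv25 (conj25 a)) by rewrite rowK.
  by rewrite iszE -(hermE char_k w2 r2 r2) -gE G' mxE.
have na : ~~ isz a by rewrite iszE -aE.
have [i hi e] := low_listed na h22; exists i; first exact: hi.
move=> M uM; rewrite -(QsZ (c := (g i1 i1)^-1) (M := g *m M)) ?invr_eq0 ?unitmx_mul ?(U_unit ug) //.
rewrite scalemxAl -g'E gE; apply: (cform_Qs char_k w2) => //; last exact: isU_t150.
by apply: (isU_U w2); rewrite -gE.
Qed.

(** Two unitary matrices with proportional first rows differ by a left factor to which [lower_conic]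
    applies. *)
Lemma U_row_base g c A : U g -> isU A -> row i0 g = c *: row i0 (iotam A) ->
  exists2 i, (i < 150)%N & forall M, M \in unitmx -> Qs (g *m M) = Qs (tm i *m (iotam A *m M)).
Proof.
move=> ug uA r0; have uiA := U_isU char_k w2 uA; have uuA := U_unit uiA.
have rE : row i0 (g *m invmx (iotam A)) = c *: row i0 1%:M.
  by rewrite row_mul r0 -scalemxAl -row_mul mulmxV.
have e j : (g *m invmx (iotam A)) i0 j = c * (1%:M : 'M[k]_3) i0 j.
  by have /rowP/(_ j) := rE; rewrite !mxE.
have [||i hi H] := lower_conic (UM ug (UV uiA)); try by rewrite e mxE mulr0.
exists i => // M uM; rewrite -H ?unitmx_mul ?uuA //.
by rewrite !mulmxA mulmxKV.
Qed.

(** Leaves 150 * 126 candidates; each conic appears once for each of its six special points. *)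
Lemma all_conics g : U g -> exists p i, [/\ mover p, (i < 150)%N &
  forall M, M \in unitmx -> Qs (g *m M) = Qs (iotam (mmul (t150 i) p) *m M)].
Proof.
move=> ug; have [p [mp [c c0 r0]]] := mover_row ug.
have [i hi H] := U_row_base ug (isU_mover mp) r0.
by exists p, i; split=> // M uM; rewrite H // iotam_mmul // mulmxA.
Qed.

(** The reparametrisations [tr o] act transitively on the six tangency points of a conic, so the
    matrix of a conic through the base point can be chosen with first row proportional to (1, 0,
    0). *)
Lemma base_conic g M : frame M -> U g -> Qs (g *m M) (pt (npt (Some 0) *m M)) ->
  exists2 i, (i < 150)%N & Qs (g *m M) = Qs (tm i *m M).
Proof.
move=> fM ug hP; have [uM _] := fM; have fgM := frame_U ug fM.
have zP : (Qs M `&` zeros f) (pt (npt (Some 0) *m M)).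
  by apply/(Qs_zeros char_k _ fM); exists (Some 0) => //; apply/(params_Some char_k); rewrite expr0n.
have [|o ho e] := (Qs_zeros char_k (pt (npt (Some 0) *m M)) fgM).1; first by split=> //; case: zP.
move: e; rewrite mulmxA.
have ugo := UM (U_tr char_k ho) ug.
have gn : npt o *m g != 0 by rewrite row_neq0 ?npt_neq0 ?(U_unit ug).
move/(pt_mul_eq uM (npt_neq0 _) gn)/esym/(pt_eq gn (npt_neq0 _)) => [c c0 e].
have [|i hi H] := U_row_base (c := c) (A := one_mat) ugo (isU_t150 0).
  by rewrite row_mul row_tr e iotam_one //; congr (_ *: _); apply/rowP => j; rewrite !mxE;
    move: j; apply: all3; rewrite /= ?expr0n.
exists i => //; have ugM : g *m M \in unitmx by case: fgM.
by rewrite -(Qs_tr o ugM) mulmxA H // iotam_one // mul1mx.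
Qed.

Lemma quart_oncon A x : isU A ->
  (quart (invmx (iotam A))).[iota x] = iota (qeval (qform A) (one25, x, mul25 x x)).
Proof.
move=> uA; rewrite quart_horner (qevalU char_k w2) //; congr (q0 (_ *m _)).
by rewrite /npt /iotav iotaM -expr2 iota1.
Qed.

Lemma oncon_npt A o : isU A ->
  oncon (qform A) (npt5 o) = (q0 (npt (omap (iota5 k) o) *m invmx (iotam A)) == 0).
Proof. by move=> uA; rewrite (onconE char_k w2) // (npt_iota char_k w). Qed.

(** Three common secants select the candidates. Those outside the list have a nonzero quartic with a
    double root in F_25, which contradicts the four common points, so no root outside F_25 has to be
    examined. *)
Lemma neighbour_listed g M : frame M -> U g -> Qs M `&` Qs (g *m M) #= `I_4 ->
  secants_of f (Qs M) `&` secants_of f (Qs (g *m M)) #= `I_3 ->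
  exists2 l, (l < 10)%N & Qs (g *m M) = Qs (iotam (nth one_mat E10 l) *m M).
Proof.
move=> fM ug; have [uM _] := fM; have [p [i [mp hi H]]] := all_conics ug; rewrite {}H //.
set A := mmul (t150 i) p; have uA : isU A by apply: (isU_mmul char_k w2); [exact: isU_t150|exact: isU_mover].
have uiA := U_isU char_k w2 uA.
move=> c4 /(shared_secants_card _ fM uiA); rewrite (shared_count_iota char_k w2) => c3.
have [L LE] : {L | L = [seq cform t | t <- E10]} by eexists.
have /all_nthP h := check_neighbours_true.
have {h} := h one_mat i hi; rewrite -/(t150 i) -LE => /all_moversP/(_ mp) h.
have {h} : if shared_count (six A) == 3%N then (nonzero_quartic A && double_root A) ||
  has (eqQ (cform A)) L else true := h.
rewrite -c3 eqxx => /orP[/andP[nq dr]|]; last first.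
  rewrite LE => /has_cform[l hl e]; exists l => //; apply: (cform_Qs char_k w2) => //.
  by rewrite nth_E10 //; exact: isU_h21.
exfalso; move: c4; have uu := U_unit uiA.
have hq x : (quart (invmx (iotam A))).[iota x] = iota (qeval (qform A) (one25, x, mul25 x x)).
  exact: quart_oncon.
have q0N : quart (invmx (iotam A)) != 0.
  apply: contraTneq nq => q00; apply/negP => /(has_nthP None)[j hj].
  rewrite oncon_npt //; case: (nth _ _ _) => [a|] /=; first by rewrite -quart_horner q00 horner0 eqxx.
  by rewrite -quart_lead q00 coef0 eqxx.
have /(has_nthP zero25)[j hj] := dr; set x := nth _ _ _ => /andP[].
rewrite iszE // -hq => /eqP rx; rewrite (eq25E char_k w2) => /eqP dx.
apply: (inter_double uM uu q0N (a := iota x)); apply/rootP => //.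
rewrite quart_deriv; apply/eqP; rewrite subr_eq0 -quart_horner rx subr0; apply/eqP.
have nE : npt (Some (iota x)) = iotav (one25, x, mul25 x x).
  by rewrite /npt /iotav iotaM -expr2 iota1.
have n'E : row3 0 1 (2%:R * iota x) = iotav (zero25, one25, scal25 n2 x).
  by rewrite /iotav iota_scal // iota0 iota1.
by rewrite nE n'E -(iotav_vadd char_k) -!(qevalU char_k w2).
Qed.

Lemma neighbour_E10 l M : frame M -> (l < 10)%N ->
  Qs M `&` Qs (hmx l.+1 *m M) #= `I_4 /\
  secants_of f (Qs M) `&` secants_of f (Qs (hmx l.+1 *m M)) #= `I_3.
Proof.
move=> fM hl; have [uM _] := fM; have uA := isU_h21 l.+1; have uiA := U_hmx l.+1.
have /all_nthP := check_E10_true; move=> /(_ one_mat l hl); rewrite nth_E10 //.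
case/and3P=> [/eqP c3 /eqP c4 ninf]; split; last first.
  by apply/(shared_secants_card _ fM uiA); rewrite (shared_count_iota char_k w2) c3.
have inj : injective iota.
  move=> [a b] [c d] e; have : eq25 (a, b) (c, d) by rewrite (eq25E char_k w2) e.
  by case: a b c d {e} => [] [] [] [].
pose s := [seq iota x | x <- all25 & oncon (qform (h21 l.+1)) (one25, x, mul25 x x)].
apply: (inter4 (s := s)) => //; first exact: U_unit uiA.
- by rewrite map_inj_uniq // filter_uniq.
- by rewrite size_map size_filter.
- move=> a /mapP[x]; rewrite mem_filter => /andP[hx _] ->.
  move: hx; rewrite /oncon iszE // => /eqP h.
  by rewrite -quart_horner quart_oncon.
by move: ninf; rewrite oncon_npt.
Qed.

Lemma h21_0 : hmx 0 = 1%:M.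
Proof. exact: iotam_one. Qed.

Lemma cform_listed A (L : seq mat) M : isU A -> all isU L -> M \in unitmx ->
  has (eqQ (cform A)) [seq cform h | h <- L] ->
  exists2 j, (j < size L)%N & Qs (iotam A *m M) = Qs (iotam (nth one_mat L j) *m M).
Proof.
move=> uA /all_nthP uL uM /has_cform[j hj e]; exists j => //.
by apply: (cform_Qs char_k w2) => //; exact: uL.
Qed.

Lemma h21_closed l j M : M \in unitmx -> (l < 10)%N -> (j < 21)%N ->
  exists2 i, (i < 21)%N & Qs (hmx l.+1 *m (hmx j *m M)) = Qs (hmx i *m M).
Proof.
move=> uM hl hj; have /and4P[hh _ _ _] := check_unitary_true.
have [L LE] : {L | L = [seq cform t | t <- H21]} by eexists.
have /all_nthP h := check_H21_true; have {h} := h one_mat j hj; rewrite -/(h21 j) -LE.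
move=> /all_nthP h; have {h} := h one_mat l hl; rewrite nth_E10 // LE => /(cform_listed _ hh uM)[|i hi e].
  by apply: (isU_mmul char_k w2); exact: isU_h21.
by exists i => //; rewrite mulmxA -iotam_mmul.
Qed.

Lemma h21_parent j M : M \in unitmx -> (j < 20)%N ->
  exists l i, [/\ (l < 10)%N, (i <= j)%N &
    Qs (hmx l.+1 *m (hmx i *m M)) = Qs (hmx j.+1 *m M)].
Proof.
move=> uM hj; have /all_nthP h := check_parents_true.
have := h 0%N j; rewrite size_iota nth_iota // add0n => /(_ hj).
case: (nth _ parents j) => l i /and3P[hl hi e]; exists l, i; split=> //.
rewrite mulmxA -(iotam_mmul char_k w2).
apply: (cform_Qs char_k w2); [|exact: isU_h21|exact: uM|].
  by apply: (isU_mmul char_k w2); exact: isU_h21.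
by rewrite -nth_E10.
Qed.

Lemma count1_unique (T : Type) (x0 : T) (a : pred T) s : count a s = 1%N ->
  exists2 i, (i < size s)%N & forall j, (j < size s)%N -> a (nth x0 s j) = (j == i).
Proof.
elim: s => //= x s IH; case ax: (a x) => /=; rewrite ?add1n ?add0n.
  case=> c0; exists 0%N => // -[|j] //= hj; apply/negbTE; move: c0 => /eqP.
  by rewrite -leqn0 leqNgt -has_count => /(has_nthP x0) h; apply/negP => aj; apply: h; exists j.
move/IH => [i hi H]; exists i.+1 => // -[|j] //= hj.
exact: H.
Qed.
End Orbits.

Lemma map_T150 (T : Type) (F : mat -> T) (G : nat -> T) i :
  [seq F t | t <- T150] = [seq G j | j <- seq.iota 0 150] -> (i < 150)%N -> F (t150 i) = G i.
Proof.
move=> e hi; rewrite -[RHS]/(G (0 + i)%N) -(nth_iota 0%N 0 hi) -(nth_map _ (G 0%N)) ?size_iota //.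
by rewrite -e (nth_map one_mat).
Qed.

(** * Components *)

Section Components.
Variable k : closedFieldType.
Hypothesis char_k : 5%N \in [pchar k].
Variable w : k.
Hypothesis w2 : w ^+ 2 = 2%:R.
Variable f : {mpoly k[3]}.
Implicit Types (M g : 'M[k]_3) (A B : mat).
Local Notation U := (U char_k).
Local Notation frame := (frame f).
Local Notation tm := (tm w).
Local Notation hmx := (hmx w).
Local Notation U_tm := (U_tm char_k w2).
Local Notation U_hmx := (U_hmx char_k w2).

Lemma unit_tm i : tm i \in unitmx. Proof. exact: U_unit (U_tm i). Qed.
Lemma unit_hmx j : hmx j \in unitmx. Proof. exact: U_unit (U_hmx j). Qed.

Lemma row_base g : row i0 g = npt (Some 0) *m g.
Proof. by rewrite rowE; congr (_ *m _); apply/rowP; apply: all3; rewrite row3E mxE /= ?expr0n. Qed.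

Lemma Qs_iff g M v : M \in unitmx -> g \in unitmx -> v != 0 ->
  Qs (g *m M) (pt (v *m M)) <-> q0 (v *m invmx g) = 0.
Proof.
move=> uM ug v0; have e : v *m M = v *m invmx g *m (g *m M) by rewrite mulmxA (mulmxKV ug).
rewrite {}e; apply: Qs_ptE; first by rewrite unitmx_mul ug.
by rewrite row_neq0 ?unitmx_inv.
Qed.

Lemma cover g M : M \in unitmx -> U g -> exists2 j, (j < 21)%N & forall j', (j' < 21)%N ->
  Qs (hmx j' *m M) (pt (npt (Some 0) *m (g *m M))) <-> j' = j.
Proof.
move=> uM ug; have [p [mp [c c0 e]]] := mover_row w2 ug.
have := all_moversP check_cover_true mp; rewrite count_map => /eqP/(count1_unique one_mat)[j hj H].
exists j => // j' hj'; rewrite mulmxA; have v0 : npt (Some 0) *m g != 0.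
  by rewrite row_neq0 ?npt_neq0 ?(U_unit ug).
apply: (iff_trans (Qs_iff uM (unit_hmx j') v0)).
rewrite -row_base e -scalemxAl q0Z -fst_rowE.
have := H j' hj'; rewrite /= (onconE char_k w2) ?isU_h21 // => h.
split=> [/eqP|/eqP]; first by rewrite mulf_eq0 expf_eq0 (negPf c0) /= h => /eqP.
by rewrite -h => /eqP ->; rewrite mulr0.
Qed.

(** Two equal conics would share a special point, which lies on only one conic of the list. *)
Lemma hmx_inj M : M \in unitmx ->
  {in seq.iota 0 21 &, injective (fun j => Qs (hmx j *m M))}.
Proof.
move=> uM j j'; rewrite !mem_iota => hj hj' e.
have [i hi H] := cover uM (U_hmx j).
have -> : j = i by apply/H => //; exists (Some 0).
by apply/esym/H => //; rewrite -e; exists (Some 0).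
Qed.

Lemma adj50 j l M : M \in unitmx -> (j < 50)%N -> (l < 7)%N ->
  exists2 m, (m < 21)%N & Qs (hmx m *m (tm l.+1 *m (tm j *m M))) =
    Qs (tm (nth 0 (nth [::] Adj50 j) l)%N *m M).
Proof.
move=> uM hj hl; have /all_nthP h := check_adj50_true.
have {h} := h 0%N j; rewrite size_iota nth_iota // add0n all2E => /(_ hj)/andP[/eqP sz].
move/all_nthP => h; have {h} := h (0, 0)%N l; rewrite size_zip -sz minnn nth_zip // nth_iota // add1n.
move=> /(_ hl)/(has_nthP one_mat)[m hm e].
exists m => //; rewrite (mulmxA (tm _)) mulmxA -!(iotam_mmul char_k w2).
by apply: (cform_Qs char_k w2) => //; do ?apply: (isU_mmul char_k w2);
  by [exact: isU_h21|exact: isU_t150].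
Qed.

Lemma base_on i M : M \in unitmx -> (i < 150)%N -> Qs (tm i *m M) (pt (npt (Some 0) *m M)).
Proof.
move=> uM hi; apply/(Qs_iff uM (unit_tm i) (npt_neq0 _))/eqP.
have /all_nthP h := check_base_true; have := h one_mat i hi.
by rewrite (oncon_npt char_k w2) ?isU_t150.
Qed.

Lemma tm_distinct i i' M : M \in unitmx -> (i < i' < 150)%N -> Qs (tm i *m M) <> Qs (tm i' *m M).
Proof.
move=> uM /andP[ii' hi']; have /(pairwiseP one_mat) h := check_distinct_true.
have {h} : has (fun v => ~~ oncon (qform (t150 i)) v) (six (t150 i')).
  exact: (h i i' (ltn_trans ii' hi') hi' ii').
rewrite has_map => /(has_nthP None)[x hx]; set o := nth _ _ _.
rewrite /= (onconE char_k w2) ?isU_t150 // iotav_vmul // -npt_iota // => no e.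
have z0 : npt (omap (iota5 k) o) *m tm i' != 0 by rewrite row_neq0 ?npt_neq0 ?unit_tm.
move/eqP: no; apply; apply/(Qs_iff uM (unit_tm i) z0); rewrite e -mulmxA.
by exists (omap (iota5 k) o).
Qed.

Definition Dm M : set (set (P2 k)) := [set Q | exists2 j, (j < 21)%N & Q = Qs (hmx j *m M)].

(** Both [tm i] and [tm i'] give conics through the base point, and a component has only one such
    conic; distinct conics of the list thus lie in distinct components. *)
Lemma Dm_inj i i' M : M \in unitmx -> (i < 150)%N -> (i' < 150)%N ->
  Dm (tm i *m M) = Dm (tm i' *m M) -> i = i'.
Proof.
move=> uM hi hi' e; have uiM : tm i *m M \in unitmx by rewrite unitmx_mul unit_tm.
have [j hj eQ] : Dm (tm i *m M) (Qs (tm i' *m M)).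
  by rewrite e; exists 0%N => //; rewrite h21_0 mul1mx.
have [j0 hj0 H] := cover uiM (UV (U_tm i)).
have bE : invmx (tm i) *m (tm i *m M) = M by rewrite mulmxA mulVmx ?mul1mx ?unit_tm.
rewrite bE in H.
have j0E : j = j0 by apply/H => //; rewrite -eQ; exact: base_on.
have e0 : 0%N = j0 by apply/H => //; rewrite h21_0 mul1mx; exact: base_on.
move: eQ; rewrite j0E -e0 h21_0 mul1mx => eQ.
have [ii'|ii'|//] := ltngtP i i'.
  by case: (@tm_distinct i i' M uM); rewrite ?ii'.
by case: (@tm_distinct i' i M uM); rewrite ?ii'.
Qed.

Definition counts i a := common_counts [seq qform h | h <- H21] (six (h21 a)) (uinv25 (t150 i)).

Lemma common_card i a b M : frame M -> (a < 21)%N -> (b < 21)%N -> forall n,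
  Qs (hmx a *m M) `&` Qs (hmx b *m (tm i *m M)) `&` zeros f #= `I_n <->
  n = nth 0%N (counts i a) b.
Proof.
move=> fM ha hb n; have faM := frame_U (U_hmx a) fM; have [uM _] := fM.
have [uaM _] := faM; have uiM : tm i *m M \in unitmx by rewrite unitmx_mul unit_tm.
have -> : nth 0%N (counts i a) b =
    size [seq o <- params k | q0 (npt o *m hmx a *m invmx (tm i) *m invmx (hmx b)) == 0].
  rewrite /counts /common_counts (nth_map (qform one_mat)) ?size_map //.
  rewrite (nth_map one_mat) // size_filter params_iota !count_map; apply: eq_count => o /=.
  rewrite (onconE char_k w2) ?isU_h21 // !iotav_vmul // iotam_uinv //.
  by rewrite (U_invE (U_tm i)) -npt_iota.
have z0 o : npt o *m hmx a *m invmx (tm i) != 0.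
  by rewrite !row_neq0 ?npt_neq0 ?unit_hmx ?unitmx_inv ?unit_tm.
have zE o : npt o *m (hmx a *m M) = npt o *m hmx a *m invmx (tm i) *m (tm i *m M).
  by rewrite !mulmxA mulmxKV ?unit_tm.
apply: (card_image_seq (F := fun o => pt (npt o *m (hmx a *m M)))).
- by rewrite filter_uniq // params_uniq.
- by move=> o o' _ _; apply: Qs_inj.
move=> P; split.
  case=> -[h1 h2] h3; have [|o ho oE] := (Qs_zeros char_k P faM).1; first by [].
  exists o => //; rewrite mem_filter ho andbT; apply/eqP/(Qs_iff uiM (unit_hmx b) (z0 o)).
  by rewrite -zE -oE.
case=> o; rewrite mem_filter => /andP[/eqP ho op] ->.
have [h1 h3] : (Qs (hmx a *m M) `&` zeros f) (pt (npt o *m (hmx a *m M))).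
  by apply/(Qs_zeros char_k _ faM); exists o.
by split=> //; split=> //; rewrite zE; apply/(Qs_iff uiM (unit_hmx b) (z0 o)).
Qed.

Lemma size_counts i a : size (counts i a) = 21%N.
Proof. by rewrite !size_map. Qed.

Lemma conic_typeE i a ty M : frame M -> (a < 21)%N ->
  has_conic_type f (Qs (hmx a *m M)) (Dm (tm i *m M)) ty <-> profileb (counts i a) ty.
Proof.
move=> fM ha; have [uM _] := fM; have uiM : tm i *m M \in unitmx by rewrite unitmx_mul unit_tm.
have key m n : [set Q' | Dm (tm i *m M) Q' /\ Qs (hmx a *m M) `&` Q' `&` zeros f #= `I_m] #= `I_n
    <-> n = count (pred1 m) (counts i a).
  have -> : count (pred1 m) (counts i a) =
      size [seq b <- seq.iota 0 21 | nth 0%N (counts i a) b == m].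
    by rewrite size_filter -[in LHS](mkseq_nth 0%N (counts i a)) size_counts count_map.
  apply: (card_image_seq (F := fun b => Qs (hmx b *m (tm i *m M)))).
  - by rewrite filter_uniq // iota_uniq.
  - by move=> b b'; rewrite !mem_filter => /andP[_ hb] /andP[_ hb']; exact: hmx_inj.
  move=> Q; split.
    case=> -[b hb ->] /(common_card _ fM ha hb) mE.
    by exists b => //; rewrite mem_filter mem_iota hb mE eqxx.
  case=> b; rewrite mem_filter mem_iota => /andP[/eqP mE hb] ->.
  by split; [exists b|apply/(common_card _ fM ha hb)].
split=> [h|/allP h m].
  by apply/allP => m _; apply/eqP/esym/key/h.
(* The test stops at m = 6 because a conic has six tangency points; for larger m both the profile
   and the count are 0. *)
apply/key; have [hm|hm] := ltnP m 7.
  by apply/esym/eqP/h; rewrite mem_iota.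
have -> : conic_profile ty m = 0%N by case: ty {h}; rewrite /= nth_default // (leq_trans _ hm).
apply/esym/eqP; rewrite -leqn0 leqNgt -has_count; apply/hasPn => c /mapP[q _ ->].
apply/negP => /eqP cm; move: hm; rewrite -cm ltnNge => /negP; apply.
by apply: leq_trans (count_size _ _) _; rewrite !size_map.
Qed.

(** One row of the adjacency table of H, in an arbitrary frame; changing the frame gives the rows of
    the other components. *)
Lemma component_typeE i M : frame M -> (i < 150)%N ->
  has_component_type f (Dm M) (Dm (tm i *m M)) Alpha15Gamma6 <-> (0 < i < 8)%N.
Proof.
move=> fM hi; have [uM _] := fM.
have key ty n : [set Q | Dm M Q /\ has_conic_type f Q (Dm (tm i *m M)) ty] #= `I_n
    <-> n = count (fun a => profileb (counts i a) ty) (seq.iota 0 21).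
  rewrite -size_filter; apply: (card_image_seq (F := fun a => Qs (hmx a *m M))).
  - by rewrite filter_uniq // iota_uniq.
  - by move=> b b'; rewrite !mem_filter => /andP[_ hb] /andP[_ hb']; exact: hmx_inj.
  move=> Q; split.
    case=> -[a ha ->] /(conic_typeE _ _ fM ha) h.
    by exists a => //; rewrite mem_filter mem_iota ha h.
  case=> a; rewrite mem_filter mem_iota => /andP[h ha] ->.
  by split; [exists a|apply/(conic_typeE _ _ fM ha)].
have -> : (0 < i < 8)%N = all (fun ty => count (fun a => profileb (counts i a) ty) (seq.iota 0 21)
    == component_profile Alpha15Gamma6 ty) [:: Alpha; Beta; Gamma].
  rewrite -(map_T150 (eqP check_hadj_true) hi) /hadj; cbv zeta.
  apply: eq_all => ty; congr (_ == _); rewrite !count_map.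
split=> [h|/and4P[/eqP h1 /eqP h2 /eqP h3 _] ty].
  by apply/and4P; split=> //; apply/eqP/esym/key/h.
by apply/key; case: ty.
Qed.

End Components.

(** * An explicit model of the graph on 50 vertices *)

Definition row50 i : seq nat := nth [::] Adj50 i.

(** Besides the parameters (50, 7, 0, 1), each vertex other than 0 is required to have a smaller
    neighbour, which makes connectedness an induction. *)
Definition check_graph : bool :=
  all (fun i => let r := row50 i in
    [&& all (fun z => z < 50)%N r, uniq r, size r == 7%N, i \notin r,
        (i == 0%N) || has (fun z => z < i)%N r &
        all (fun j => let r' := row50 j in let m := count (fun z => z \in r') r in
          if j \in r then (i \in r') && (m == 0%N) else (i == j) || (m == 1%N))
        (seq.iota 0 50)]) (seq.iota 0 50).
Lemma check_graph_true : check_graph. Proof. by vm_compute. Qed.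

Section Row.
Variable i : nat.
Hypothesis hi : (i < 50)%N.

Lemma row50P : [/\ {in row50 i, forall z, z < 50}%N, uniq (row50 i), size (row50 i) = 7%N,
  i \notin row50 i & (0 < i)%N -> exists2 z, (z < i)%N & z \in row50 i].
Proof.
have /allP/(_ i) := check_graph_true; rewrite mem_iota => /(_ hi).
case/and5P=> /allP h1 h2 /eqP h3 h4 /andP[h5 _]; split=> // i0.
by move: h5; rewrite -[_ == _]negbK -lt0n i0 => /hasP[z zr zi]; exists z.
Qed.

Lemma row50_pair j (m := count (fun z => z \in row50 j) (row50 i)) : (j < 50)%N ->
  if j \in row50 i then (i \in row50 j) && (m == 0%N) else (i == j) || (m == 1%N).
Proof.
move=> hj; have /allP/(_ i) := check_graph_true; rewrite mem_iota => /(_ hi).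
case/and5P=> _ _ _ _ /andP[_] /allP/(_ j); rewrite mem_iota; exact.
Qed.
End Row.

Definition graph50 : graph 'I_50 :=
  Graph setT (fun i j : 'I_50 => val j \in row50 i).

Lemma adj_graph50 (i j : 'I_50) : adj graph50 i j <-> val j \in row50 i.
Proof. by split=> [[]|]. Qed.

Lemma graph50_HS : is_Hoffman_Singleton graph50.
Proof.
have card (s : seq nat) (A : set 'I_50) n : uniq s -> {in s, forall z, z < 50}%N ->
    (forall j : 'I_50, A j <-> val j \in s) -> size s = n -> A #= `I_n.
  move=> us hs hA /esym sn; apply/(card_image_seq us (F := fun z => inord z)) => //.
    move=> z z' /hs hz /hs hz' /(congr1 val) /=.
    by rewrite !inordK.
  move=> j; split=> [/hA js|[z zs ->]]; first by exists (val j) => //; rewrite inord_val.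
  by apply/hA; rewrite /= inordK // hs.
split.
- split=> [i /adj_graph50|i j /adj_graph50 ij].
    by have [_ _ _ /negP] := row50P (ltn_ord i).
  by apply/adj_graph50; have := row50_pair (ltn_ord i) (ltn_ord j); rewrite ij => /andP[].
- by apply: (card (seq.iota 0 50)) => [|z|j|]; rewrite ?mem_iota ?ltn_ord.
- move=> i _; have [h1 h2 h3 _ _] := row50P (ltn_ord i).
  by apply: card _ _ _ h3  => // j; exact: adj_graph50.
- move=> i j /adj_graph50 ij; have [h1 h2 _ _ _] := row50P (ltn_ord i).
  have := row50_pair (ltn_ord i) (ltn_ord j); rewrite ij => /andP[_].
  rewrite -size_filter => /eqP; apply: card => [|z|z]; rewrite ?filter_uniq ?mem_filter //.
    by case/andP => _ /h1.
  split=> [[/adj_graph50 -> /adj_graph50 ->]//|/andP[? ?]].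
  by split; apply/adj_graph50.
move=> i j _ _ ij nij; have [h1 h2 _ _ _] := row50P (ltn_ord i).
have := row50_pair (ltn_ord i) (ltn_ord j); case: ifP => [/adj_graph50 //|_].
case/orP=> [/eqP/val_inj //|].
rewrite -size_filter => /eqP; apply: card => [|z|z]; rewrite ?filter_uniq ?mem_filter //.
  by case/andP => _ /h1.
split=> [[/adj_graph50 -> /adj_graph50 ->]//|/andP[? ?]].
by split; apply/adj_graph50.
Qed.

Section GraphComponents.
Variables (T : Type) (g : graph T).

Lemma component_eq x y : component g x y -> component g y = component g x.
Proof.
move=> [_ xy]; apply/seteqP; split=> z [vz h]; split=> //.
  exact: rst_trans xy h.
by apply: rst_trans h; exact: rst_sym.
Qed.

Lemma component_closed (C : set T) x : C x -> (forall y z, adj g y z -> C y <-> C z) ->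
  component g x `<=` C.
Proof.
move=> Cx H y [_ xy]; have [h _] : C x <-> C y; last exact: h.
by elim: xy => [a b ab|//|a b _ <-|a b c _ -> _ ->] //; exact: H.
Qed.
End GraphComponents.

(** * Components of G and of H in a frame *)

Section HoffmanSingleton.
Variable k : closedFieldType.
Hypothesis char_k : 5%N \in [pchar k].
Variable w : k.
Hypothesis w2 : w ^+ 2 = 2%:R.
Variable f : {mpoly k[3]}.
Implicit Types (M g : 'M[k]_3) (A B : mat).
Local Notation U := (U char_k).
Local Notation frame := (frame f).
Local Notation tm := (tm w).
Local Notation hmx := (hmx w).
Local Notation Dm := (Dm w).
Local Notation U_tm := (U_tm char_k w2).
Local Notation U_hmx := (U_hmx char_k w2).

Lemma adj_G_sym Q Q' : adj (graph_G f) Q Q' -> adj (graph_G f) Q' Q.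
Proof.
by move=> [vQ vQ' [/= ne c4 c3]]; split=> //; split; [exact: nesym|rewrite setIC|rewrite setIC].
Qed.

(** In the frame [hmx j *m M] the conic [Q] is the base conic, so [Q'] is one of its ten known
    neighbours, and these stay in the list by [h21_closed]. *)
Lemma Dm_closed M Q Q' : frame M -> adj (graph_G f) Q Q' -> Dm M Q -> Dm M Q'.
Proof.
move=> fM [_ /= tQ' [_ c4 c3]] [j hj jE]; rewrite {}jE in c4 c3.
have fjM := frame_U (U_hmx j) fM; have [uM _] := fM.
have [g [ug gE]] := tangent_frame char_k fjM tQ'; rewrite {}gE in c4 c3 tQ' *.
have [l hl ->] := neighbour_listed w2 fjM ug c4 c3.
rewrite nth_E10 // -/(hmx l.+1); have [i hi ->] := h21_closed char_k w2 uM hl hj.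
by exists i.
Qed.

(** [Dm M] is closed under adjacency, hence contains the component; conversely each listed conic is
    joined to the first by induction along its earlier neighbours. *)
Lemma component_Dm M : frame M -> component (graph_G f) (Qs M) = Dm M.
Proof.
move=> fM; have [uM _] := fM; apply/seteqP; split.
  apply: component_closed => [|Q Q' QQ'].
    by exists 0%N => //; rewrite h21_0 mul1mx.
  by split; apply: Dm_closed => //; exact: adj_G_sym.
move=> _ [j hj ->]; elim/ltn_ind: j hj => -[|j] IH hj.
  rewrite h21_0 mul1mx; split; first exact: frame_tangent.
  exact: rst_refl.
have tj i := frame_tangent char_k (frame_U (U_hmx i) fM).
split; first exact: tj.
have [l [i [hl hi e]]] := h21_parent char_k w2 uM hj.
have [c4 c3] := neighbour_E10 char_k w2 (frame_U (U_hmx i) fM) hl.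
have hi21 : (i < 21)%N by apply: leq_ltn_trans hi (ltnW hj).
have [_ h] := IH i hi hi21; apply: rst_trans h _; apply: rst_step; rewrite -e.
split; [exact: tj|rewrite e; exact: tj|split=> //].
rewrite e => /(hmx_inj char_k w2 uM); rewrite !mem_iota => /(_ hi21 hj) ij.
by move: hi; rewrite ij ltnn.
Qed.

Lemma calD_Dm M : frame M -> calD f (Dm M).
Proof. by move=> fM; exists (Qs M); [exact: frame_tangent|rewrite component_Dm]. Qed.

Lemma Dm_eq M M' : frame M -> frame M' -> Dm M (Qs M') -> Dm M = Dm M'.
Proof. by move=> fM fM'; rewrite -!component_Dm // => h; rewrite (component_eq h). Qed.

Lemma calD_tm M D : frame M -> calD f D -> exists2 i, (i < 150)%N & D = Dm (tm i *m M).
Proof.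
move=> fM [Q tQ ->]; have [g [ug ->]] := tangent_frame char_k fM tQ.
have [uM _] := fM; have fgM := frame_U ug fM; have [ugM _] := fgM.
(* Seen from the frame [g *m M], the base point of [M] is the image of the base point under the
   inverse of [g]; [cover] finds a conic of the component through it. *)
have [j hj H] := cover w2 ugM (UV ug).
have e0 : invmx g *m (g *m M) = M by rewrite mulmxA mulVmx ?mul1mx ?(U_unit ug).
have := (H j hj).2 erefl; rewrite e0 mulmxA => h.
have [i hi e] := base_conic w2 fM (UM (U_hmx j) ug) h; exists i; first exact: hi.
rewrite (component_Dm fgM); apply: (Dm_eq fgM (frame_U (U_tm i) fM)).
by exists j; [exact: hj|rewrite -e mulmxA].
Qed.

Lemma tm0 M : tm 0 *m M = M.
Proof.
have e : t150 0 = one_mat by vm_compute.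
by rewrite /tm e iotam_one mul1mx.
Qed.

Lemma adj_H_tm M D : frame M ->
  adj (graph_H f) (Dm M) D <-> exists2 l, (0 < l < 8)%N & D = Dm (tm l *m M).
Proof.
move=> fM; have [uM _] := fM; split.
  case=> _ /= cD [_]; have [i hi ->] := calD_tm fM cD.
  by move/(component_typeE char_k w2 fM hi) => h; exists i.
case=> l hl ->; have hl150 : (l < 150)%N by case/andP: hl => _ h; exact: ltn_trans h _.
split; [exact: calD_Dm|exact: (calD_Dm (frame_U (U_tm l) fM))|split].
  rewrite -{1}(tm0 M) => e; have l0 := @Dm_inj k char_k w w2 0 l M uM isT hl150 e.
  by rewrite -l0 in hl.
exact/(component_typeE char_k w2 fM hl150).
Qed.

Definition dl : 'M[k]_3 := iotam w delta.
Definition fr M c : 'M[k]_3 := iter c (mulmx dl) M.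

Lemma frame_fr M c : frame M -> frame (fr M c).
Proof.
move=> fM; elim: c => [|c IH]; [exact: fM|rewrite /fr iterS; apply: frame_U IH].
by apply: (U_isU char_k w2); have /and4P[_ _ ud _] := check_unitary_true.
Qed.

Lemma t150E c j : (c < 3)%N -> (j < 50)%N ->
  t150 (c * 50 + j) = iter c (mmul^~ delta) (nth one_mat T50 j).
Proof.
move=> hc hj; rewrite /t150 /T150 !nth_cat !size_map -[size _]/50%N.
case: c hc => [|[|[|//]]] _; rewrite ?mul0n ?add0n ?hj //.
  by rewrite mul1n ltnNge leq_addr addKn hj (nth_map one_mat).
rewrite mulSn -addnA ltnNge leq_addr addKn mul1n ltnNge leq_addr addKn.
by rewrite -[LHS]/(nth one_mat [seq mmul (mmul t delta) delta | t <- T50] j) (nth_map one_mat).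
Qed.

Lemma tm_fr M c j : (c < 3)%N -> (j < 50)%N -> tm (c * 50 + j) *m M = tm j *m fr M c.
Proof.
move=> hc hj; rewrite /tm (t150E hc hj) (t150E (isT : 0 < 3)%N hj : t150 j = _) /=.
elim: c {hc} M => //= c IH M; rewrite (iotam_mmul char_k w2) -mulmxA IH; congr (_ *m _).
by rewrite /fr -iterSr.
Qed.

Definition V M c j := Dm (tm j *m fr M c).

Lemma V_inj M c c' j j' : M \in unitmx -> (c < 3)%N -> (c' < 3)%N -> (j < 50)%N -> (j' < 50)%N ->
  V M c j = V M c' j' -> c = c' /\ j = j'.
Proof.
move=> uM hc hc' hj hj'; rewrite /V -!tm_fr // => /(Dm_inj char_k w2 uM) e.
have h150 a b : (a < 3)%N -> (b < 50)%N -> (a * 50 + b < 150)%N.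
  move=> ha hb; rewrite -[150%N]/(3 * 50)%N; apply: leq_trans (_ : a.+1 * 50 <= _)%N.
    by rewrite mulSn addnC ltn_add2r.
  by rewrite leq_pmul2r.
have {}e := e (h150 _ _ hc hj) (h150 _ _ hc' hj').
have dE a b : (b < 50)%N -> ((a * 50 + b) %/ 50)%N = a.
  by move=> hb; rewrite divnMDl // divn_small // addn0.
have ce : c = c' by rewrite -(dE c j hj) e dE.
by move: e; rewrite ce => /addnI.
Qed.

Lemma calD_V M D : frame M -> calD f D -> exists c j, [/\ (c < 3)%N, (j < 50)%N & D = V M c j].
Proof.
move=> fM /(calD_tm fM)[i hi ->]; exists (i %/ 50)%N, (i %% 50)%N.
have hc : (i %/ 50 < 3)%N by rewrite ltn_divLR.
have hj : (i %% 50 < 50)%N by rewrite ltn_mod.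
by split=> //; rewrite /V -tm_fr // -divn_eq.
Qed.

(** In the frame of the component number [j], its neighbours are given by [tm 1] to [tm 7]; the
    table [Adj50] tells which of the 50 listed conics lies in each of them, and a shared conic
    identifies the components. *)
Lemma adj_H_V M c j D : frame M -> (j < 50)%N ->
  adj (graph_H f) (V M c j) D <-> exists2 i, i \in row50 j & D = V M c i.
Proof.
move=> fM hj; have fN := frame_fr c fM; have [uN _] := fN.
have [h1 h2 h3 _ _] := row50P hj.
have e l : (l < 7)%N -> Dm (tm l.+1 *m (tm j *m fr M c)) = V M c (nth 0 (row50 j) l)%N.
  move=> hl; have [m hm e] := adj50 char_k w2 uN hj hl.
  apply: (Dm_eq (frame_U (U_tm _) (frame_U (U_tm j) fN)) (frame_U (U_tm _) fN)).
  by exists m; [exact: hm|rewrite e].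
apply: (iff_trans (adj_H_tm D (frame_U (U_tm j) fN))); split.
  case=> -[//|l] hl ->; exists (nth 0%N (row50 j) l); last exact: e.
  by rewrite mem_nth ?h3.
case=> i /(nthP 0%N)[l]; rewrite h3 => hl <- ->; exists l.+1 => //.
by rewrite -e.
Qed.

Definition HC M c : set (set (set (P2 k))) := [set D | exists2 j, (j < 50)%N & D = V M c j].

Lemma component_HC M c j : frame M -> (c < 3)%N -> (j < 50)%N ->
  component (graph_H f) (V M c j) = HC M c.
Proof.
move=> fM hc hj; have [uM _] := fM; apply/seteqP; split.
  apply: component_closed => [|D D' DD']; first by exists j.
  have [cD _ _] := DD'; have [c' [j' [hc' hj' DE]]] := calD_V fM cD.
  move: DD'; rewrite {}DE => /(adj_H_V _ _ fM hj')[i ir ->].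
  have [/(_ i ir) hi _ _ _ _] := row50P hj'.
  split=> -[a ha /(V_inj uM)[] // <- _].
    by exists i.
  by exists j'.
(* Connectedness: every vertex is joined to number 0 through neighbours of smaller index. *)
suff H a : (a < 50)%N -> component (graph_H f) (V M c 0) (V M c a).
  by rewrite (component_eq (H j hj)) => D [a ha ->]; exact: H.
have vert b : calD f (V M c b) by exact: (calD_Dm (frame_U (U_tm b) (frame_fr c fM))).
elim/ltn_ind: a => -[|a] IH ha; first by split; [exact: vert|exact: rst_refl].
have [_ _ _ _ [//|b hb br]] := row50P ha.
split; first exact: vert.
have [_ h] := IH b hb (ltn_trans hb ha); apply: rst_trans h _; apply: rst_sym; apply: rst_step.
by apply/(adj_H_V _ _ fM ha); exists b.
Qed.

Lemma components_H M C : frame M ->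
  components (graph_H f) C <-> exists2 c, c \in seq.iota 0 3 & C = HC M c.
Proof.
move=> fM; split.
  case=> D cD ->; have [c [j [hc hj ->]]] := calD_V fM cD.
  by exists c; [rewrite mem_iota|rewrite (component_HC fM)].
case=> c; rewrite mem_iota => hc ->; exists (V M c 0).
  exact: (calD_Dm (frame_U (U_tm 0) (frame_fr c fM))).
by rewrite (component_HC fM).
Qed.

Lemma HC_iso M c : frame M -> (c < 3)%N -> graph_iso (induced (graph_H f) (HC M c)) graph50.
Proof.
move=> fM hc; have [uM _] := fM.
pose phi D := odflt ord0 [pick j : 'I_50 | `[< D = V M c j >]].
have phiV (j : 'I_50) : phi (V M c j) = j.
  rewrite /phi; case: pickP => [i /asboolP /(V_inj uM hc hc)[] // _ /val_inj ->//|/(_ j)].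
  by rewrite asboolT.
exists phi; split.
  split=> //.
    move=> D D'; rewrite !inE => -[j hj ->] [j' hj' ->].
    by rewrite (phiV (Ordinal hj)) (phiV (Ordinal hj')) => -[->].
  by move=> j _; exists (V M c j); [exists j|exact: phiV].
move=> _ _ /= [j hj ->] [j' hj' ->].
rewrite (phiV (Ordinal hj)) (phiV (Ordinal hj')).
apply: iff_trans (iff_sym (adj_graph50 _ _)) => /=; split.
  case=> _ _ /(adj_H_V _ _ fM hj)[i ir] /(V_inj uM hc hc hj')[] // .
    by have [/(_ i ir)] := row50P hj.
  by move=> _ ->.
move=> jr; split; [by exists j|by exists j'|].
by apply/(adj_H_V _ _ fM hj); exists j'.
Qed.

End HoffmanSingleton.

Theorem theorem1p8 (k : closedFieldType) (char_k : 5%N \in [pchar k])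
    (f : {mpoly k[3]}) (f_Hermitian : is_Hermitian_curve f) :
  components (graph_H f) #= `I_3 /\
  exists HS : graph 'I_50, is_Hoffman_Singleton HS /\
    forall C, components (graph_H f) C -> graph_iso (induced (graph_H f) C) HS.
Proof.
have [w w2] := root_exists (2%:R : k) (isT : 0 < 2)%N.
have [M uM fE] := Hermitian_hform char_k f_Hermitian.
have fM : frame f M by [].
split.
  apply/(card_image_seq (iota_uniq 0 3) (F := HC w M)) => //.
    move=> c c'; rewrite !mem_iota => hc hc' e.
    have [j hj /(V_inj char_k w2 uM)[]//] : HC w M c' (V w M c 0) by rewrite -e; exists 0%N.
  by move=> C; exact: components_H.
exists graph50; split; first exact: graph50_HS.
move=> C /(components_H char_k w2 C fM)[c]; rewrite mem_iota => hc ->.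
exact: HC_iso.
Qed.
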